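(* Let $\mathfrak{o}$ be a compact discrete valuation ring (of arbitrary characteristic) with finite residue field $\mathbf{k}$ of cardinality $q$. (1) The set $\mathrm{Sh}_{\mathsf{GL}_3(\mathfrak{o})}$ of all similarity class shadows consists of ten elements, classified by the ten types $\mathcal{G},\mathcal{L},\mathcal{J},\mathcal{T}_1,\mathcal{T}_2,\mathcal{T}_3,\mathcal{M},\mathcal{N},\mathcal{K}_0,\mathcal{K}_\infty$ (one shadow of each type). (2) For all $\sigma,\tau\in\mathrm{Sh}_{\mathsf{GL}_3(\mathfrak{o})}$ there exists a polynomial $a_{\sigma,\tau}\in\mathbb{Z}[\frac16][t]$ such that the following holds: for every $\ell\in\mathbb{N}$ and every similarity class $\mathcal{C}$ in $\mathfrak{gl}_3(\mathfrak{o}_\ell)$ with shadow $\sigma$, the number of similarity classes $\widetilde{\mathcal{C}}$ in $\mathfrak{gl}_3(\mathfrak{o}_{\ell+1})$ with shadow $\tau$ lying above $\mathcal{C}$ is equal to $a_{\sigma,\tau}(q)$.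
   Context: $\mathfrak{p}$ is the valuation ideal and $\mathfrak{o}_\ell=\mathfrak{o}/\mathfrak{p}^\ell$ for $\ell\in\mathbb{N}_0$. A similarity class in $\mathfrak{gl}_3(\mathfrak{o}_\ell)$ is an orbit of $\mathsf{GL}_3(\mathfrak{o})$ acting by conjugation on $3\times3$ matrices over $\mathfrak{o}_\ell$. A class $\widetilde{\mathcal{C}}$ in $\mathfrak{gl}_3(\mathfrak{o}_{\ell+1})$ lies above $\mathcal{C}$ in $\mathfrak{gl}_3(\mathfrak{o}_\ell)$ if its reduction modulo $\mathfrak{p}^\ell$ equals $\mathcal{C}$. For $A\in\mathfrak{gl}_3(\mathfrak{o}_\ell)$ the group centraliser shadow $\mathrm{sh}_{\mathsf{GL}}(A)\le\mathsf{GL}_3(\mathbf{k})$ is the image modulo $\mathfrak{p}$ of $\mathrm{C}_{\mathsf{GL}_3(\mathfrak{o})}(A)=\{g\in\mathsf{GL}_3(\mathfrak{o})\mid gA=Ag \text{ over }\mathfrak{o}_\ell\}$, and the Lie centraliser shadow $\mathrm{sh}_{\mathfrak{gl}}(A)\le\mathfrak{gl}_3(\mathbf{k})$ is the image modulo $\mathfrak{p}$ of $\mathrm{C}_{\mathfrak{gl}_3(\mathfrak{o})}(A)=\{X\in\mathfrak{gl}_3(\mathfrak{o})\mid XA=AX\text{ over }\mathfrak{o}_\ell\}$. The shadow of a similarity class $\mathcal{C}$ is $\{(\mathrm{sh}_{\mathsf{GL}}(A),\mathrm{sh}_{\mathfrak{gl}}(A))\mid A\in\mathcal{C}\}$; $\mathrm{Sh}_{\mathsf{GL}_3(\mathfrak{o})}$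 is the set of all shadows of similarity classes in $\mathfrak{gl}_3(\mathfrak{o}_\ell)$, for all $\ell\in\mathbb{N}_0$. Types: a shadow is determined by the $\mathsf{GL}_3(\mathbf{k})$-conjugacy class of its Lie centraliser shadows (the group centraliser shadow being the unit group of the Lie centraliser shadow), and the type is determined by this conjugacy class as follows. For the first eight types it is the class of the centraliser in $\mathfrak{gl}_3(\mathbf{k})$ of a matrix with minimal polynomial over $\mathbf{k}$ of the form (differently named roots in $\mathbf{k}$ being distinct): $\mathcal{G}$: $t-\alpha$; $\mathcal{L}$: $(t-\alpha_1)(t-\alpha_2)$; $\mathcal{J}$: $(t-\alpha)^2$; $\mathcal{T}_1$: $(t-\alpha_1)(t-\alpha_2)(t-\alpha_3)$ (in all cases, the class of the algebra of diagonal matrices); $\mathcal{T}_2$: $(t-\alpha)f(t)$ with $f$ an irreducible quadratic; $\mathcal{T}_3$: an irreducible cubic; $\mathcal{M}$: $(t-\alpha_1)(t-\alpha_2)^2$; $\mathcal{N}$: $(t-\alpha)^3$. Type $\mathcal{K}_0$: the class of $\{t\,\mathrm{Id}_3+s_1E_{13}+s_3E_{23}\mid t,s_1,s_3\in\mathbf{k}\}$. Type $\mathcal{K}_\infty$: the class of $\{t\,\mathrm{Id}_3+s_2E_{21}+s_3E_{23}\mid t,s_2,s_3\in\mathbf{k}\}$. Here $E_{ij}$ are elementary matrices. *)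

(* Defs.v *)
From HB Require Import structures.
From mathcomp Require Import all_boot all_order all_algebra.
From mathcomp Require Import all_classical.
From mathcomp Require Import topology.

Set Implicit Arguments.
Unset Strict Implicit.
Unset Printing Implicit Defensive.

Import GRing.Theory.
Local Open Scope classical_set_scope.
Local Open Scope ring_scope.
Local Open Scope quotient_scope.

Definition is_ideal (R : comNzRingType) (I : set R) : Prop :=
  [/\ I 0, (forall x y, I x -> I y -> I (x + y))
    & forall a x, I x -> I (a * x)].

Definition nonunits (R : comUnitRingType) : set R :=
  [set x | x \isn't a GRing.unit].

(* A discrete valuation ring: a local principal ideal domain that is not a
   field.  Its maximal ideal is then [nonunits R]. *)
Definition is_dvr (R : idomainType) : Prop :=
  [/\ forall I : set R, is_ideal I -> exists a, I = range (fun x => x * a),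
      is_ideal (@nonunits R)
    & exists2 x : R, x != 0 & nonunits x].

Definition ideal_mul (R : comNzRingType) (I J : set R) : set R :=
  [set x | exists n (a b : 'I_n -> R),
     (forall i, I (a i) /\ J (b i)) /\ x = \sum_i a i * b i].

Definition maxideal_pow (R : comUnitRingType) (l : nat) : set R :=
  iter l (ideal_mul (@nonunits R)) setT.

Section Quotients.
Variable R : comUnitRingType.

Lemma maxideal_pow_ideal l : is_ideal (@maxideal_pow R l).
Proof.
case: l => [|l]; first by split.
rewrite /maxideal_pow iterS -/(maxideal_pow l).
have JM : forall l (a : R) x, maxideal_pow l x -> maxideal_pow l (a * x).
  elim=> [|m IH] a x //= [n [u [v [uv ->]]]].
  exists n, u, (fun i => a * v i); split.
    by move=> i; have [? ?] := uv i; split=> //; exact: IH.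
  by rewrite mulr_sumr; apply: eq_bigr => i _; rewrite mulrCA.
split.
- exists 0, (fun=> 0), (fun=> 0); split; first by case.
  by rewrite big_ord0.
- move=> x y [n [a [b [ab ->]]]] [m [c [d [cd ->]]]].
  exists (n + m)%N.
  exists (fun i => match fintype.split i with inl j => a j | inr j => c j end).
  exists (fun i => match fintype.split i with inl j => b j | inr j => d j end).
  split; first by move=> i; case: (fintype.split i).
  rewrite big_split_ord /=; congr (_ + _); apply: eq_bigr => i _.
    by rewrite -[lshift _ _]/(unsplit (inl i)) unsplitK.
  by rewrite -[rshift _ _]/(unsplit (inr i)) unsplitK.
- by move=> a x xP; exact: (JM l.+1).
Qed.

Lemma maxideal_powW l m (x : R) :
  (l <= m)%N -> maxideal_pow m x -> maxideal_pow l x.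
Proof.
move=> /subnK <-; elim: (m - l)%N x => [//|d IH] x.
rewrite addSn => -[n [a [b [ab ->]]]].
have [I0 ID IM] := maxideal_pow_ideal l.
by apply: big_ind => // i _; apply: IM; apply: IH; case: (ab i).
Qed.

Definition maxideal_powb (l : nat) : {pred R} :=
  fun x => `[< maxideal_pow l x >].

Lemma maxideal_powb_closed l : zmod_closed (maxideal_powb l).
Proof.
have [I0 ID IM] := maxideal_pow_ideal l.
split=> [|x y /asboolP xI /asboolP yI]; apply/asboolP => //.
by apply: ID => //; rewrite -mulN1r; exact: IM.
Qed.

HB.instance Definition _ l :=
  GRing.isZmodClosed.Build R (maxideal_powb l) (maxideal_powb_closed l).

(* The truncation R / p^l, where p is the set of nonunits; for l = 0 this is
   the zero ring, which is why {ideal_quot _} of a proper ideal is not used. *)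
Definition trunc (l : nat) : Type := Quotient.quot (maxideal_powb l).

HB.instance Definition _ l := EqQuotient.on (trunc l).
HB.instance Definition _ l := Choice.on (trunc l).
HB.instance Definition _ l := GRing.Zmodule.on (trunc l).

Definition trunc_one l : trunc l := \pi_(trunc l) (1 : R).
Definition trunc_mul l (x y : trunc l) : trunc l := \pi_(trunc l) (repr x * repr y).

Lemma eq_trunc l (x y : R) :
  (\pi_(trunc l) x = \pi_(trunc l) y) <-> maxideal_pow l (x - y).
Proof.
split=> [/eqP|/asboolP h].
  by rewrite -(Quotient.idealrBE (maxideal_powb l)) => /asboolP.
by apply/eqP; rewrite -(Quotient.idealrBE (maxideal_powb l)).
Qed.

Lemma pi_trunc_mul l :
  {morph (\pi_(trunc l) : R -> trunc l) : x y / x * y >-> trunc_mul x y}.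
Proof.
move=> x y; apply/eq_trunc.
have [_ ID IM] := maxideal_pow_ideal l.
have hx : maxideal_pow l (x - repr (\pi_(trunc l) x)).
  by apply/eq_trunc; rewrite reprK.
have hy : maxideal_pow l (y - repr (\pi_(trunc l) y)).
  by apply/eq_trunc; rewrite reprK.
set x' := repr _ in hx *; set y' := repr _ in hy *.
have -> : x * y - x' * y' = y * (x - x') + x' * (y - y').
  by rewrite !mulrBr [y * x]mulrC [y * x']mulrC addrA subrK.
by apply: ID; apply: IM.
Qed.

Lemma trunc_mulA l : associative (@trunc_mul l).
Proof.
move=> x y z; rewrite -[x]reprK -[y]reprK -[z]reprK.
move: (repr x) (repr y) (repr z) => a b c.
by rewrite -(pi_trunc_mul l b c) -(pi_trunc_mul l a b) -(pi_trunc_mul l a (b * c))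
           -(pi_trunc_mul l (a * b) c) mulrA.
Qed.

Lemma trunc_mulC l : commutative (@trunc_mul l).
Proof. by move=> x y; rewrite /trunc_mul mulrC. Qed.

Lemma trunc_mul1 l : left_id (@trunc_one l) (@trunc_mul l).
Proof.
move=> x; rewrite -[x]reprK; move: (repr x) => a.
by rewrite -(pi_trunc_mul l 1 a) mul1r.
Qed.

Lemma pi_truncD l :
  {morph (\pi_(trunc l) : R -> trunc l) : x y / x + y >-> x + y}.
Proof. exact: (@Quotient.pi_add R (maxideal_powb l)). Qed.

Lemma trunc_mulDl l : left_distributive (@trunc_mul l) +%R.
Proof.
move=> x y z; rewrite -[x]reprK -[y]reprK -[z]reprK.
move: (repr x) (repr y) (repr z) => a b c.
rewrite -(pi_truncD l a b) -(pi_trunc_mul l (a + b) c) -(pi_trunc_mul l a c).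
by rewrite -(pi_trunc_mul l b c) mulrDl -(pi_truncD l (a * c)).
Qed.

HB.instance Definition _ l := GRing.Zmodule_isComPzRing.Build (trunc l)
  (@trunc_mulA l) (@trunc_mulC l) (@trunc_mul1 l) (@trunc_mulDl l).

Definition to_trunc l (x : R) : trunc l := \pi_(trunc l) x.

Lemma to_trunc_zmod l : zmod_morphism (@to_trunc l).
Proof. by move=> x y; exact: (raddfB (\pi_(Quotient.quot (maxideal_powb l)))). Qed.

Lemma to_trunc_monoid l : monoid_morphism (@to_trunc l).
Proof. by split=> // x y; exact: pi_trunc_mul. Qed.

HB.instance Definition _ l :=
  GRing.isZmodMorphism.Build R (trunc l) (@to_trunc l) (@to_trunc_zmod l).
HB.instance Definition _ l :=
  GRing.isMonoidMorphism.Build R (trunc l) (@to_trunc l) (@to_trunc_monoid l).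

Definition trunc_red l (x : trunc l.+1) : trunc l := to_trunc l (repr x).

Lemma trunc_redE l (x : R) : trunc_red (to_trunc l.+1 x) = to_trunc l x.
Proof.
apply/eq_trunc; apply: (@maxideal_powW l l.+1) => //.
by apply/eq_trunc; rewrite reprK.
Qed.

End Quotients.

(* R with the topology in which the sets x + p^n, n : nat, form a basis of
   neighbourhoods of x. *)
Definition adic (R : comUnitRingType) : Type := R.

Section Adic.
Variable R : comUnitRingType.
HB.instance Definition _ := Choice.on (adic R).

Definition adic_open : set_system (adic R) :=
  [set U | forall x : R, U x ->
     exists n, forall y : R, maxideal_pow n (y - x) -> U y].

Lemma adic_openT : adic_open setT.
Proof. by move=> x _; exists 0. Qed.

Lemma adic_openI : setI_closed adic_open.
Proof.
move=> U V Uo Vo x [/Uo[n Un] /Vo[m Vm]]; exists (maxn n m) => y xy.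
split; [apply: Un | apply: Vm].
  exact: maxideal_powW (leq_maxl n m) xy.
exact: maxideal_powW (leq_maxr n m) xy.
Qed.

Lemma adic_open_bigU (I : Type) (f : I -> set (adic R)) :
  (forall i, adic_open (f i)) -> adic_open (\bigcup_i f i).
Proof.
move=> fo x [i _ /fo[n fn]]; exists n => y /fn fiy.
by exists i.
Qed.

HB.instance Definition _ := isOpenTopological.Build (adic R)
  adic_openT adic_openI adic_open_bigU.
End Adic.

(* res presents k as the residue field R / p. *)
Definition is_residue_map (R : comUnitRingType) (k : fieldType)
    (res : {rmorphism R -> k}) : Prop :=
  (forall y, exists x, res x = y) /\ (forall x, res x = 0 <-> nonunits x).

Section SimilarityClasses.
Variable o : idomainType.

Definition similarity_class l (C : set 'M[trunc o l]_3) : Prop :=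
  exists A : 'M[trunc o l]_3,
    C = [set B | exists2 g : 'M[o]_3, g \in unitmx &
           B = map_mx (to_trunc l) g *m A *m map_mx (to_trunc l) (invmx g)].

Definition lies_above l (D : set 'M[trunc o l.+1]_3)
    (C : set 'M[trunc o l]_3) : Prop :=
  [set map_mx (@trunc_red o l) B | B in D] = C.

Variables (k : finFieldType) (res : {rmorphism o -> k}).

Definition shadow_GL l (A : 'M[trunc o l]_3) : set {'GL_3[k]} :=
  [set u : {'GL_3[k]} | exists g : 'M[o]_3,
     [/\ g \in unitmx,
         map_mx (to_trunc l) g *m A = A *m map_mx (to_trunc l) g
       & map_mx res g = GLval u]].

Definition shadow_gl l (A : 'M[trunc o l]_3) : set 'M[k]_3 :=
  [set map_mx res X | X in [set X : 'M[o]_3 |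
     map_mx (to_trunc l) X *m A = A *m map_mx (to_trunc l) X]].

Definition shadow_type : Type := set (set {'GL_3[k]} * set 'M[k]_3).

Definition shadow l (C : set 'M[trunc o l]_3) : shadow_type :=
  [set (shadow_GL A, shadow_gl A) | A in C].

Definition Sh : set shadow_type :=
  [set sigma | exists l (C : set 'M[trunc o l]_3),
     similarity_class C /\ sigma = shadow C].

End SimilarityClasses.

Inductive stype :=
  typeG | typeL | typeJ | typeT1 | typeT2 | typeT3 | typeM | typeN
| typeK0 | typeKinf.

Section Types.
Variable k : finFieldType.

Definition centraliser (X : 'M[k]_3) : set 'M[k]_3 :=
  [set Y | Y *m X = X *m Y].

Definition conj_sets (S h : set 'M[k]_3) : Prop :=
  exists2 g : 'M[k]_3, g \in unitmx &
    h = [set g *m X *m invmx g | X in S].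

(* Elementary matrices, with indices starting from 1. *)
Definition elem_mx (i j : nat) : 'M[k]_3 := delta_mx (inord i.-1) (inord j.-1).

Definition algK0 : set 'M[k]_3 :=
  [set X | exists t s1 s3 : k, X = t%:M + s1 *: elem_mx 1 3 + s3 *: elem_mx 2 3].

Definition algKinf : set 'M[k]_3 :=
  [set X | exists t s2 s3 : k, X = t%:M + s2 *: elem_mx 2 1 + s3 *: elem_mx 2 3].

(* lie_class s is the GL_3(k)-conjugacy class of subalgebras of gl_3(k)
   attached to s.  For #|k| = 2 no matrix over k has three distinct
   eigenvalues in k, so typeT1 is described by the diagonal matrices. *)
Definition lie_class (s : stype) (h : set 'M[k]_3) : Prop :=
  match s with
  | typeG => exists (X : 'M[k]_3) (a : k),
      mxminpoly X = 'X - a%:P /\ h = centraliser X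
  | typeL => exists (X : 'M[k]_3) (a b : k),
      [/\ a != b, mxminpoly X = ('X - a%:P) * ('X - b%:P)
        & h = centraliser X]
  | typeJ => exists (X : 'M[k]_3) (a : k),
      mxminpoly X = ('X - a%:P) ^+ 2 /\ h = centraliser X
  | typeT1 => conj_sets [set X | is_diag_mx X] h
  | typeT2 => exists (X : 'M[k]_3) (a : k) (f : {poly k}),
      [/\ irreducible_poly f, size f = 3,
          mxminpoly X = ('X - a%:P) * f & h = centraliser X]
  | typeT3 => exists X : 'M[k]_3,
      [/\ irreducible_poly (mxminpoly X), size (mxminpoly X) = 4
        & h = centraliser X]
  | typeM => exists (X : 'M[k]_3) (a b : k),
      [/\ a != b, mxminpoly X = ('X - a%:P) * ('X - b%:P) ^+ 2
        & h = centraliser X]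
  | typeN => exists (X : 'M[k]_3) (a : k),
      mxminpoly X = ('X - a%:P) ^+ 3 /\ h = centraliser X
  | typeK0 => conj_sets algK0 h
  | typeKinf => conj_sets algKinf h
  end.

(* The Lie centraliser shadows occurring in sigma are exactly the members of
   the conjugacy class attached to s. *)
Definition has_type (sigma : shadow_type k) (s : stype) : Prop :=
  [set P.2 | P in sigma] = [set h | lie_class s h].

End Types.

Definition over_Zinv6 (a : {poly rat}) : Prop :=
  forall i, exists (m : int) (n : nat), a`_i = m%:~R / 6%:R ^+ n.

(* Main.v *)
(* Write [h_l(A)] for the Lie centraliser shadow of [A] at level [l] and [im_l(A)] for
   the residues of [[X, A] / p^l], where [[X, A]] is divisible by [p^l].  By invariance
   of the trace form, [im_l(A)] is the orthogonal of [h = h_{l+1}(A)].  Hence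
   [D X := [X, A] / p^{l+1}] is well defined on [h] modulo the orthogonal of [h], and
   [tr (D X * Y)] is an alternating form on [h] for which [D] is a derivation.  When
   [h] is commutative of dimension 3 this form vanishes, as [h] then contains a
   nonscalar residue of a matrix commuting with [A]; for the types L and J an explicit
   computation shows that [D] is inner; for type G, [A] is scalar modulo [p^{l+1}].  So
   [A] may be changed modulo [p^{l+1}] to a matrix [A0] with [h_{l+2}(A0) = h].  The classes
   above that of [A] at level [l+2] are those of [A0 + p^{l+1} Z]; they correspond to
   the orbits of the units of [h] on the dual of [h], and the shadow of
   [A0 + p^{l+1} Z] is the stabiliser in [h] of the functional [Y |-> tr (Z * Y)].
   Explicit representatives of these orbits give the shadows by induction on the level,
   and their number for each type is a polynomial in [#|k|]. *)

Require Import Defs.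
From HB Require Import structures.
From mathcomp Require Import all_boot all_order all_algebra.
From mathcomp Require Import all_classical.
From mathcomp Require Import topology.
From mathcomp Require Import ring lra finfield qfpoly qpoly.

Set Implicit Arguments.
Unset Strict Implicit.
Unset Printing Implicit Defensive.

Import Order.TTheory GRing.Theory Num.Theory.
Local Open Scope classical_set_scope.
Local Open Scope ring_scope.

(** * 3x3 matrices *)

(** The step from level [l] to [l + 1] is uniform only around a base point whose shadow does not
    shrink. The obstruction to finding one is the class of [D] modulo inner derivations, and it
    vanishes for different reasons. If [h] is spanned by [1], [b], [c] and commutative, the form
    kills scalars, so it is the single number [\tr (D b * c)], and one nonscalar element of the
    radical makes it zero; that element is the residue of [(A - a) / p^m], with [m] as large as
    possible. For L and J the Leibniz rule leaves three free values, exactly as many as inner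
    derivations provide. A commutative [h] acts trivially on its dual, whence $a_{\sigma,\sigma} =
    q^3$ for the seven commutative types. The denominator 6 comes from the $\binom{q}{3}$ cubics
    with distinct roots in [k]; irreducible quadratics and cubics contribute denominators 2 and 3.
    Two constraints shape the proof. And for [q = 2] no diagonal matrix has three distinct entries,
    so type T1 is handled through the algebra of diagonal matrices and found above type L. *)

Definition o0 : 'I_3 := @Ordinal 3 0 isT.
Definition o1 : 'I_3 := @Ordinal 3 1 isT.
Definition o2 : 'I_3 := @Ordinal 3 2 isT.

Lemma ord3P (P : 'I_3 -> Prop) : P o0 -> P o1 -> P o2 -> forall i, P i.
Proof.
move=> h0 h1 h2 [[|[|[|//]]] h].
- by rewrite (_ : Ordinal h = o0) //; apply: val_inj.
- by rewrite (_ : Ordinal h = o1) //; apply: val_inj.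
- by rewrite (_ : Ordinal h = o2) //; apply: val_inj.
Qed.

Lemma big_ord3 (V : nmodType) (F : 'I_3 -> V) :
  \sum_i F i = F o0 + (F o1 + F o2).
Proof.
rewrite !big_ord_recl big_ord0 addr0.
by congr (F _ + (F _ + F _)); apply: val_inj.
Qed.

Section Mx3.
Variable R : pzRingType.
Implicit Types a b c d e f g h i : R.

Definition mx3 a b c d e f g h i : 'M[R]_3 :=
  \matrix_(r, s) nth 0 (nth [::] [:: [:: a; b; c]; [:: d; e; f]; [:: g; h; i]] r) s.

Lemma mx3_eta (X : 'M[R]_3) :
  X = mx3 (X o0 o0) (X o0 o1) (X o0 o2) (X o1 o0) (X o1 o1) (X o1 o2)
          (X o2 o0) (X o2 o1) (X o2 o2).
Proof. by apply/matrixP; apply: ord3P; apply: ord3P; rewrite mxE. Qed.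

Lemma mx3P (P : 'M[R]_3 -> Prop) :
  (forall a b c d e f g h i, P (mx3 a b c d e f g h i)) -> forall X, P X.
Proof. by move=> hP X; rewrite (mx3_eta X). Qed.

Lemma mx3_inj a b c d e f g h i a' b' c' d' e' f' g' h' i' :
  mx3 a b c d e f g h i = mx3 a' b' c' d' e' f' g' h' i' ->
  [/\ a = a', b = b' & c = c'] /\ [/\ d = d', e = e' & f = f'] /\
  [/\ g = g', h = h' & i = i'].
Proof.
move=> /matrixP E; do !split.
- by have := E o0 o0; rewrite !mxE. - by have := E o0 o1; rewrite !mxE.
- by have := E o0 o2; rewrite !mxE. - by have := E o1 o0; rewrite !mxE.
- by have := E o1 o1; rewrite !mxE. - by have := E o1 o2; rewrite !mxE.
- by have := E o2 o0; rewrite !mxE. - by have := E o2 o1; rewrite !mxE.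
- by have := E o2 o2; rewrite !mxE.
Qed.

Lemma mx3D a b c d e f g h i a' b' c' d' e' f' g' h' i' :
  mx3 a b c d e f g h i + mx3 a' b' c' d' e' f' g' h' i' =
  mx3 (a + a') (b + b') (c + c') (d + d') (e + e') (f + f')
      (g + g') (h + h') (i + i').
Proof. by apply/matrixP; apply: ord3P; apply: ord3P; rewrite !mxE. Qed.

Lemma mx3N a b c d e f g h i :
  - mx3 a b c d e f g h i =
  mx3 (- a) (- b) (- c) (- d) (- e) (- f) (- g) (- h) (- i).
Proof. by apply/matrixP; apply: ord3P; apply: ord3P; rewrite !mxE. Qed.

Lemma mx3Z x a b c d e f g h i :
  x *: mx3 a b c d e f g h i =
  mx3 (x * a) (x * b) (x * c) (x * d) (x * e) (x * f) (x * g) (x * h) (x * i).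
Proof. by apply/matrixP; apply: ord3P; apply: ord3P; rewrite !mxE. Qed.

Lemma mx3M a b c d e f g h i a' b' c' d' e' f' g' h' i' :
  mx3 a b c d e f g h i *m mx3 a' b' c' d' e' f' g' h' i' =
  mx3 (a * a' + (b * d' + c * g')) (a * b' + (b * e' + c * h'))
      (a * c' + (b * f' + c * i'))
      (d * a' + (e * d' + f * g')) (d * b' + (e * e' + f * h'))
      (d * c' + (e * f' + f * i'))
      (g * a' + (h * d' + i * g')) (g * b' + (h * e' + i * h'))
      (g * c' + (h * f' + i * i')).
Proof. by apply/matrixP; apply: ord3P; apply: ord3P; rewrite !mxE big_ord3 !mxE. Qed.

Lemma mx3_scalar a : a%:M = mx3 a 0 0 0 a 0 0 0 a.
Proof. by apply/matrixP; apply: ord3P; apply: ord3P; rewrite !mxE. Qed.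

Lemma mx3_0 : 0 = mx3 0 0 0 0 0 0 0 0 0.
Proof. by apply/matrixP; apply: ord3P; apply: ord3P; rewrite !mxE. Qed.

Lemma mxtrace3 a b c d e f g h i : \tr (mx3 a b c d e f g h i) = a + (e + i).
Proof. by rewrite /mxtrace big_ord3 !mxE. Qed.

Lemma mx3_eq a b c d e f g h i a' b' c' d' e' f' g' h' i' :
  a = a' -> b = b' -> c = c' -> d = d' -> e = e' -> f = f' ->
  g = g' -> h = h' -> i = i' ->
  mx3 a b c d e f g h i = mx3 a' b' c' d' e' f' g' h' i'.
Proof. by do 9!move->. Qed.

End Mx3.

Definition mx3E := (mx3_scalar, mx3_0, mx3M, mx3D, mx3N, mx3Z, mxtrace3).

Lemma unitmx_of_mulmx (R : comUnitRingType) n (P Q : 'M[R]_n) :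
  P *m Q = 1%:M -> P \in unitmx /\ invmx P = Q.
Proof.
move=> PQ; have [uP _] := mulmx1_unit PQ; split=> //.
by rewrite -[invmx P]mulmx1 -PQ mulKmx.
Qed.

Lemma invmx_mulmx (R : comUnitRingType) n (A B : 'M[R]_n) : A \in unitmx -> B \in unitmx ->
  invmx (A *m B) = invmx B *m invmx A.
Proof.
move=> uA uB; have [] // := @unitmx_of_mulmx _ _ (A *m B) (invmx B *m invmx A).
by rewrite mulmxA mulmxK // mulmxV.
Qed.

Lemma det_mx3 (R : comNzRingType) (a b c d e f g h i : R) :
  \det (mx3 a b c d e f g h i) =
  a * (e * i - f * h) - b * (d * i - f * g) + c * (d * h - e * g).
Proof.
rewrite (expand_det_row _ o0) big_ord3 /cofactor.
rewrite !(expand_det_row _ ord0) !big_ord_recl !big_ord0 /cofactor !det_mx11.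
rewrite !mxE /= /bump /=.
rewrite !addn0 !add0n !expr0 ?expr1 ?exprS ?expr0.
ring.
Qed.

(** * The trace form *)

Section TraceForm.
Variables (k : finFieldType).
Implicit Types (h : set 'M[k]_3) (X Y Z W g : 'M[k]_3).

Definition orth h : set 'M[k]_3 := [set Z | forall X, h X -> \tr (Z *m X) = 0].

Definition is_subspace h : Prop :=
  [/\ h 0, forall X Y, h X -> h Y -> h (X + Y) & forall c X, h X -> h (c *: X)].

Definition subalg h : Prop :=
  [/\ is_subspace h, h 1%:M & forall X Y, h X -> h Y -> h (X *m Y)].

Lemma orth_subspace h : is_subspace (orth h).
Proof.
split=> [X _|X Y oX oY W hW|c X oX W hW]; first by rewrite mul0mx mxtrace0.
  by rewrite mulmxDl mxtraceD oX ?oY ?addr0.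
by rewrite -scalemxAl mxtraceZ oX ?mulr0.
Qed.

Lemma subspace_sum h (I : finType) (F : I -> 'M[k]_3) :
  is_subspace h -> (forall i, h (F i)) -> h (\sum_i F i).
Proof. by move=> [h0 hD _] hF; elim/big_ind: _ => // *; apply: hD. Qed.

(** As [k] is finite, the elements of [h] can be listed as the rows of one matrix [M]. If [Z] is
    outside its row space, some column of [cokermx M] is a functional that kills [h] but not [Z],
    and the trace form represents it. *)
Lemma orth_orth h Z : is_subspace h ->
  (forall W, orth h W -> \tr (Z *m W) = 0) -> h Z.
Proof.
move=> hs hZ; pose s := [seq X <- enum {: 'M[k]_3} | `[< h X >]].
pose M := \matrix_(i < size s) mxvec s`_i.
have hs_nth (i : 'I_(size s)) : h s`_i.
  by have := mem_nth 0 (ltn_ord i); rewrite mem_filter => /andP[/asboolP].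
have [/submxP[D ZD]|ZM] := boolP (mxvec Z <= M)%MS.
  have -> : Z = \sum_i D 0 i *: s`_i.
    rewrite -[LHS]mxvecK ZD mulmx_sum_row linear_sum; apply: eq_bigr => i _.
    by rewrite linearZ /= rowK mxvecK.
  by apply: subspace_sum => // i; case: hs => _ _; apply.
have /negP[] : ~~ (mxvec Z *m cokermx M == 0).
  by apply: contra ZM => /eqP h0; rewrite submxE h0.
apply/eqP/rowP => j; rewrite [RHS]mxE.
(* The transpose makes [W] represent the column [w]: [\tr (X *m W)] is the product of [mxvec X] with
   [w]. *)
pose w := col j (cokermx M); pose W := (vec_mx w^T)^T.
have trW X : \tr (X *m W) = (mxvec X *m w) 0 0.
  rewrite /mxtrace mxE (reindex _ (curry_mxvec_bij _ _)) /=.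
  rewrite (eq_bigr (fun i => \sum_j X i j * W j i)); last by move=> i _; rewrite mxE.
  rewrite pair_bigA /=; apply: eq_bigr => -[a b] _ /=.
  by rewrite mxvecE !mxE.
have /hZ : orth h W.
  move=> X hX; rewrite mxtrace_mulC trW.
  have : (mxvec X <= M)%MS.
    have sX : X \in s by rewrite mem_filter mem_enum andbT; apply/asboolP.
    have lt : (index X s < size s)%N by rewrite index_mem.
    by apply/submxP; exists (delta_mx 0 (Ordinal lt)); rewrite -rowE rowK /= nth_index.
  rewrite submxE => /eqP h0.
  by rewrite /w colE mulmxA h0 mul0mx mxE.
by rewrite trW /w colE mulmxA -colE mxE.
Qed.

Lemma mxtrace_nondeg Z : (forall X, \tr (Z *m X) = 0) -> Z = 0.
Proof.
move=> hZ; apply: (@orth_orth [set 0]) => [|X _]; last exact: hZ.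
by split=> [//|X Y -> ->|c X ->]; rewrite /= ?addr0 ?scaler0.
Qed.

(** Commuting with $E_{12}$, $E_{23}$ and $E_{31}$ is enough, as these generate the full matrix
    algebra. *)
Lemma central_scalar X : (forall Y, Y *m X = X *m Y) -> is_scalar_mx X.
Proof.
move: X; apply: mx3P => a b c d e f g h i cX; apply/is_scalar_mxP; exists a.
move: (cX (mx3 0 1 0 0 0 0 0 0 0)) (cX (mx3 0 0 0 0 0 1 0 0 0)) (cX (mx3 0 0 0 0 0 0 1 0 0)).
rewrite !mx3E !(mul0r, mulr0, mul1r, mulr1, addr0, add0r).
move=> /mx3_inj[[d0 ea f0] [_ [_ g0 _]]] /mx3_inj[[_ _ b0] [[_ h0 ie] _]].
move=> /mx3_inj[_ [_ [_ _ c0]]].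
by rewrite d0 f0 -g0 -b0 h0 ie ea c0.
Qed.

(* Modulo [orth h], a matrix is a functional on [h], on which the units of [h] act by
   conjugation; [radf h Z] is the stabiliser of the functional [Z] in [h]. *)
Definition eqv h Z Z' : Prop :=
  exists2 g, h g & g \in unitmx /\ orth h (g *m Z - Z' *m g).

Definition radf h Z : set 'M[k]_3 := [set X | h X /\ orth h (X *m Z - Z *m X)].

Lemma eqv_orth h Z Z' : subalg h -> orth h (Z - Z') -> eqv h Z Z'.
Proof.
by move=> [_ h1 _] oZ; exists 1%:M => //; rewrite unitmx1 mul1mx mulmx1.
Qed.

(* The properties of [X |-> [X, A] / p ^ l] on the Lie centraliser shadow of [A];
   values are only determined modulo [orth h]. *)
Definition alt_deriv h (D : 'M[k]_3 -> 'M[k]_3) : Prop :=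
  [/\ forall X Y, h X -> h Y -> orth h (D (X + Y) - (D X + D Y)),
      forall c X, h X -> orth h (D (c *: X) - c *: D X),
      forall X, h X -> \tr (D X *m X) = 0
    & forall X Y, h X -> h Y -> orth h (D (X *m Y) - (D X *m Y + X *m D Y))].

(** The sign is that of the correction: replacing [A] by [A + p ^ l Z] adds $[X, Z]$ to [D X], so
    such a [Z] cancels [D] modulo [orth h]. *)
Definition inner_for h (D : 'M[k]_3 -> 'M[k]_3) : Prop :=
  exists Z, forall X, h X -> orth h (D X + (X *m Z - Z *m X)).

Lemma orth_tr h X Y Z : orth h (X - Y) -> h Z -> \tr (X *m Z) = \tr (Y *m Z).
Proof.
by move=> o hZ; apply/eqP; rewrite -subr_eq0 -raddfB -mulmxBl; apply/eqP/o.
Qed.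

(** * The alternating form attached to a derivation *)

Section AltDeriv.
Variables (h : set 'M[k]_3) (D : 'M[k]_3 -> 'M[k]_3).
Hypothesis hD : alt_deriv h D.
Hypothesis ha : subalg h.
Local Notation B X Y := (\tr (D X *m Y)).

Lemma altD X Y Z : h X -> h Y -> h Z -> B (X + Y) Z = B X Z + B Y Z.
Proof.
case: hD => oD _ _ _ hX hY hZ; rewrite (orth_tr (oD _ _ hX hY)) //.
by rewrite mulmxDl mxtraceD.
Qed.

Lemma altZ c X Z : h X -> h Z -> B (c *: X) Z = c * B X Z.
Proof.
case: hD => _ oZ _ _ hX hZ; rewrite (orth_tr (oZ c _ hX)) //.
by rewrite -scalemxAl mxtraceZ.
Qed.

(** The Leibniz rule is paired with [Z] and the trace is rotated. Together with [altC] this makes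
    the form a cyclic 1-cocycle on [h]. *)
Lemma altM X Y Z : h X -> h Y -> h Z -> B (X *m Y) Z = B X (Y *m Z) + B Y (Z *m X).
Proof.
case: hD => _ _ _ oM hX hY hZ; rewrite (orth_tr (oM _ _ hX hY)) //.
rewrite mulmxDl mxtraceD -mulmxA; congr (_ + _).
by rewrite -mulmxA mxtrace_mulC mulmxA.
Qed.

Lemma altDr X Y Z : B X (Y + Z) = B X Y + B X Z.
Proof. by rewrite mulmxDr mxtraceD. Qed.

Lemma altZr c X Z : B X (c *: Z) = c * B X Z.
Proof. by rewrite -scalemxAr mxtraceZ. Qed.

Lemma altC X Y : h X -> h Y -> B X Y = - B Y X.
Proof.
move=> hX hY; have [_ _ alt _] := hD; have [[_ hDD _] _ _] := ha.
have := alt _ (hDD _ _ hX hY); rewrite altDr !altD //.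
by rewrite alt // [B Y Y]alt // addr0 add0r addrC => /eqP; rewrite addr_eq0 => /eqP.
Qed.

(** The Leibniz rule for [1 * 1 = 1] equates a value of the form with its double. *)
Lemma alt1 c Y : h Y -> B c%:M Y = 0.
Proof.
move=> hY; have [[_ _ hZ] h1 _] := ha; have := altM h1 h1 hY.
rewrite !mul1mx mulmx1 -[c%:M]scalemx1 altZ // => /eqP.
by rewrite -subr_eq subrr eq_sym => /eqP ->; rewrite mulr0.
Qed.

Lemma alt1r c Y : h Y -> B Y c%:M = 0.
Proof.
move=> hY; rewrite altC ?alt1 ?oppr0 //.
by have [[_ _ hZ] h1 _] := ha; rewrite -scalemx1; apply: hZ.
Qed.

(** Scalars lie in the radical, so the form lives on the span of [b] and [c], where an alternating
    form is the single number [B b c]. The nonscalar [Y] in the radical has a nonzero coordinate on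
    [b] or [c], and pairing it with the other one gives [B b c = 0]. *)
Lemma alt3 b c Y : h b -> h c ->
  (forall X, h X -> exists x y z, X = x%:M + y *: b + z *: c) ->
  h Y -> (forall x, Y != x%:M) -> orth h (D Y) -> forall X, h X -> orth h (D X).
Proof.
move=> hb hc hs hY nY oY; have [[_ hDD hZ] h1 _] := ha; have [_ _ alt _] := hD.
have hsc x : h x%:M by rewrite -scalemx1; apply: hZ.
have Bbc : B b c = 0.
  have [x [y [z YE]]] := hs _ hY.
  have hyb := hZ y _ hb; have hzc := hZ z _ hc.
  have zB : z * B c b = 0.
    rewrite -(oY _ hb) YE !altD //; last exact: hDD.
    by rewrite alt1 // !altZ // alt // mulr0 !add0r.
  have yB : y * B b c = 0.
    rewrite -(oY _ hc) YE !altD //; last exact: hDD.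
    by rewrite alt1 // !altZ // [B c c]alt // mulr0 addr0 add0r.
  have [y0|y0] := eqVneq y 0; last by move/eqP: yB; rewrite mulf_eq0 (negPf y0) => /eqP.
  have [z0|z0] := eqVneq z 0.
    by have := nY x; rewrite YE y0 z0 !scale0r !addr0 eqxx.
  by rewrite altC //; move/eqP: zB; rewrite mulf_eq0 (negPf z0) => /eqP ->; rewrite oppr0.
move=> X hX W hW; have [x [y [z ->]]] := hs _ hX; have [x' [y' [z' ->]]] := hs _ hW.
have [hyb hzc] := (hZ y _ hb, hZ z _ hc).
rewrite !altDr alt1r ?add0r; last by do !apply: (hDD).
rewrite !altZr !altD //; do ?by apply: (hDD).
by rewrite !alt1 // !altZ // [B c b]altC // !alt // Bbc oppr0 !(mulr0, addr0).
Qed.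
End AltDeriv.

(** * Transport along conjugation *)

Definition conjs g h : set 'M[k]_3 := [set g *m X *m invmx g | X in h].

Lemma conjsP g h X : g \in unitmx -> conjs g h X <-> h (invmx g *m X *m g).
Proof.
move=> ug; split=> [[Y hY <-]|hX].
  by rewrite !mulmxA mulVmx // mul1mx mulmxKV.
by exists (invmx g *m X *m g) => //; rewrite !mulmxA mulmxV // mul1mx mulmxK.
Qed.

Lemma conjs_comp g g' h : g \in unitmx -> g' \in unitmx ->
  conjs g' (conjs g h) = conjs (g' *m g) h.
Proof.
move=> ug ug'; apply/seteqP; split=> X; rewrite !conjsP ?unitmx_mul ?ug ?ug' //.
  by rewrite invmx_mulmx // !mulmxA.
by rewrite invmx_mulmx // !mulmxA.
Qed.

Lemma conjs1 h : conjs 1%:M h = h.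
Proof.
apply/seteqP; split=> X; rewrite conjsP ?unitmx1 // invmx1 mul1mx mulmx1 //.
Qed.

Lemma conjs_mulK g X Y : g \in unitmx ->
  (g *m X *m invmx g) *m (g *m Y *m invmx g) = g *m (X *m Y) *m invmx g.
Proof. by move=> ug; rewrite !mulmxA mulmxKV. Qed.

Lemma conj_mxtrace g X : g \in unitmx -> \tr (g *m X *m invmx g) = \tr X.
Proof. by move=> ug; rewrite mxtrace_mulC mulmxA mulVmx // mul1mx. Qed.

Lemma orth_conjs g h Z : g \in unitmx ->
  orth (conjs g h) (g *m Z *m invmx g) <-> orth h Z.
Proof.
move=> ug; split=> [o X hX|o _ [X hX <-]].
  by rewrite -(conj_mxtrace _ ug) -conjs_mulK // o //; exists X.
by rewrite conjs_mulK // conj_mxtrace // o.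
Qed.

Lemma radf_conjs g h Z : g \in unitmx ->
  radf (conjs g h) (g *m Z *m invmx g) = conjs g (radf h Z).
Proof.
move=> ug; apply/seteqP; split=> [_ [[X hX <-] o]|_ [X [hX o] <-]].
  exists X => //; split=> //; apply/(orth_conjs _ _ ug).
  by rewrite mulmxBr mulmxBl -!conjs_mulK.
split; first by exists X.
by rewrite !conjs_mulK // -mulmxBl -mulmxBr; apply/(orth_conjs _ _ ug).
Qed.

Lemma unitmx_conj g X : g \in unitmx -> (g *m X *m invmx g \in unitmx) = (X \in unitmx).
Proof. by move=> ug; rewrite !unitmx_mul unitmx_inv ug andbT. Qed.

Lemma eqv_conjs g h Z Z' : g \in unitmx ->
  eqv (conjs g h) (g *m Z *m invmx g) (g *m Z' *m invmx g) <-> eqv h Z Z'.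
Proof.
move=> ug; split=> [[_ [X hX <-]]|[X hX]].
  rewrite unitmx_conj // => -[uX o]; exists X => //; split=> //.
  by apply/(orth_conjs _ _ ug); rewrite mulmxBr mulmxBl -!conjs_mulK.
move=> [uX o]; exists (g *m X *m invmx g); first by exists X.
rewrite unitmx_conj //; split=> //.
by rewrite !conjs_mulK // -mulmxBl -mulmxBr; apply/(orth_conjs _ _ ug).
Qed.

Lemma subalg_conjs g h : g \in unitmx -> subalg h -> subalg (conjs g h).
Proof.
move=> ug [[h0 hD hZ] h1 hM]; split=> [||X Y]; last first.
- by move=> [X' hX <-] [Y' hY <-]; rewrite conjs_mulK //; exists (X' *m Y') => //; apply: hM.
- by apply/(conjsP _ _ ug); rewrite mulmx1 mulVmx.
split=> [|X Y|c X]; rewrite !conjsP //.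
- by rewrite mulmx0 mul0mx.
- by rewrite mulmxDr mulmxDl; apply: hD.
- by rewrite -scalemxAr -scalemxAl; apply: hZ.
Qed.

End TraceForm.

(** * Centraliser shadows over a discrete valuation ring *)

(** Locked so that the rewriting rules for matrix sums and products do not reach inside a
    commutator. *)
HB.lock Definition comm3 (R : pzRingType) (X A : 'M[R]_3) : 'M[R]_3 :=
  X *m A - A *m X.

Lemma dvr_uniformiser (o : idomainType) : is_dvr o ->
  exists2 p : o, p != 0 & forall x, nonunits x <-> exists y, x = y * p.
Proof.
move=> [pid idl [x x0 xn]]; have [p hp] := pid _ idl.
have pE y : nonunits y <-> exists z, y = z * p.
  by rewrite hp; split=> [[z _ <-]|[z ->]]; exists z.
exists p => //; apply: contra x0 => /eqP p0.
by have /pE[y ->] := xn; rewrite p0 mulr0.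
Qed.

Section Uniformiser.
Variables (o : idomainType) (k : finFieldType) (res : {rmorphism o -> k}).
Variable p : o.
Hypothesis p0 : p != 0.
Hypothesis pE : forall x, nonunits x <-> exists y, x = y * p.
Hypothesis res_surj : forall y, exists x, res x = y.
Hypothesis res_ker : forall x, res x = 0 <-> nonunits x.

Lemma maxideal_powE l (x : o) : maxideal_pow l x <-> exists y, x = p ^+ l * y.
Proof.
elim: l x => [|l IH] x.
  by split=> // _; exists x; rewrite expr0 mul1r.
rewrite /maxideal_pow iterS -/(maxideal_pow l); split=> [[n [a [b [ab ->]]]]|[y ->]].
  have /choice[y hy] i : exists y, a i * b i = p ^+ l.+1 * y.
    have [/pE[u ->] /IH[v ->]] := ab i; exists (u * v).
    by rewrite exprS -!mulrA; ring.
  by exists (\sum_i y i); rewrite mulr_sumr; apply: eq_bigr.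
exists 1%N, (fun=> p), (fun=> p ^+ l * y); rewrite big_ord1 exprS mulrA; split=> // _.
split; first by apply/pE; exists 1; rewrite mul1r.
by apply/IH; exists y.
Qed.

Definition dvm l (X : 'M[o]_3) : Prop := exists Y : 'M[o]_3, X = p ^+ l *: Y.

Lemma map_to_truncE l (X Y : 'M[o]_3) :
  map_mx (to_trunc l) X = map_mx (to_trunc l) Y <-> dvm l (X - Y).
Proof.
split=> [/matrixP E|[W E]].
  have /choice[F hF] (ij : 'I_3 * 'I_3) : exists y, (X - Y) ij.1 ij.2 = p ^+ l * y.
    by apply/maxideal_powE; rewrite !mxE; apply/eq_trunc; have := E ij.1 ij.2; rewrite !mxE.
  by exists (\matrix_(i, j) F (i, j)); apply/matrixP => i j; rewrite (hF (i, j)) !mxE.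
apply/matrixP => i j; rewrite !mxE; apply/eq_trunc/maxideal_powE.
by exists (W i j); move/matrixP/(_ i j): E; rewrite !mxE.
Qed.

Lemma scalepI l (X Y : 'M[o]_3) : p ^+ l *: X = p ^+ l *: Y -> X = Y.
Proof.
move=> /matrixP E; apply/matrixP => i j; have := E i j; rewrite !mxE.
by apply: mulfI; rewrite expf_neq0.
Qed.

Lemma res_p : res p = 0.
Proof. by apply/res_ker/pE; exists 1; rewrite mul1r. Qed.

Lemma map_res_p l (X : 'M[o]_3) : map_mx res (p ^+ l.+1 *: X) = 0.
Proof. by apply/matrixP => i j; rewrite !mxE rmorphM rmorphXn /= res_p exprS !mul0r. Qed.

Lemma map_res_p1 (X : 'M[o]_3) : map_mx res (p *: X) = 0.
Proof. by rewrite -(expr1 p) map_res_p. Qed.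

Lemma map_res_eq0 (X : 'M[o]_3) : map_mx res X = 0 -> exists Y : 'M[o]_3, X = p *: Y.
Proof.
move=> /matrixP E.
have /choice[F hF] (ij : 'I_3 * 'I_3) : exists y, X ij.1 ij.2 = y * p.
  by apply/pE/res_ker; have := E ij.1 ij.2; rewrite !mxE.
exists (\matrix_(i, j) F (i, j)); apply/matrixP => i j.
by rewrite (hF (i, j)) !mxE mulrC.
Qed.

Lemma map_res_eq (X X' : 'M[o]_3) : map_mx res X = map_mx res X' ->
  exists Y : 'M[o]_3, X = X' + p *: Y.
Proof.
move=> E; have [Y YE] : exists Y, X - X' = p *: Y.
  by apply: map_res_eq0; rewrite map_mxB E subrr.
by exists Y; rewrite -YE addrC subrK.
Qed.

Lemma map_res_surj n m (Z : 'M[k]_(n, m)) : exists X, map_mx res X = Z.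
Proof.
have /choice[f fK] := res_surj; exists (map_mx f Z).
by apply/matrixP => i j; rewrite !mxE fK.
Qed.

Lemma unitmx_res (g : 'M[o]_3) : (g \in unitmx) = (map_mx res g \in unitmx).
Proof.
rewrite !unitmxE det_map_mx unitfE; apply/idP/idP.
  by move=> u; apply/eqP => /res_ker /negP; apply.
by move=> /eqP n0; apply/negPn/negP => u; apply: n0; apply/res_ker.
Qed.

Implicit Types A B : 'M[o]_3.

Lemma comm3D X Y A : comm3 (X + Y) A = comm3 X A + comm3 Y A.
Proof. by rewrite comm3.unlock mulmxDl mulmxDr opprD addrACA. Qed.

Lemma comm3Dr X A B : comm3 X (A + B) = comm3 X A + comm3 X B.
Proof. by rewrite comm3.unlock mulmxDl mulmxDr opprD addrACA. Qed.

Lemma comm3Z c X A : comm3 (c *: X) A = c *: comm3 X A.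
Proof. by rewrite comm3.unlock -scalemxAl -scalemxAr scalerBr. Qed.

Lemma comm3Zr c X A : comm3 X (c *: A) = c *: comm3 X A.
Proof. by rewrite comm3.unlock -scalemxAl -scalemxAr scalerBr. Qed.

Lemma comm3M X Y A : comm3 (X *m Y) A = comm3 X A *m Y + X *m comm3 Y A.
Proof. by rewrite comm3.unlock mulmxBl mulmxBr !mulmxA [RHS]addrC addrA subrK. Qed.

Lemma comm3_scalar (X : 'M[o]_3) a : comm3 X a%:M = 0.
Proof. by rewrite comm3.unlock scalar_mxC subrr. Qed.

Lemma comm3_trace X Y A : \tr (X *m comm3 Y A) = - \tr (Y *m comm3 X A).
Proof.
rewrite comm3.unlock !mulmxBr [LHS]raddfB [X in _ = - X]raddfB /= opprB mxtrace_mulC -!mulmxA; congr (_ - _).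
by rewrite !mulmxA mxtrace_mulC mulmxA.
Qed.

Lemma map_comm3 X A :
  map_mx res (comm3 X A) = map_mx res X *m map_mx res A - map_mx res A *m map_mx res X.
Proof. by rewrite comm3.unlock map_mxB !map_mxM. Qed.

Lemma comm30 A : comm3 0 A = 0.
Proof. by rewrite comm3.unlock mul0mx mulmx0 subrr. Qed.

Lemma comm31 A : comm3 1%:M A = 0.
Proof. by rewrite comm3.unlock mul1mx mulmx1 subrr. Qed.

Lemma comm3_trace0 X A : \tr (comm3 X A *m X) = 0.
Proof. by rewrite mxtrace_mulC comm3.unlock mulmxBr raddfB /= [X in X - _]mxtrace_mulC -mulmxA subrr. Qed.

(** This is $h_l(A)$, and [cim l A] below is $im_l(A)$, both for a lift [A] over [o]: only there can
    a commutator be divided by [p ^+ l]. *)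
Definition csh l (A : 'M[o]_3) : set 'M[k]_3 :=
  [set Z | exists X Y : 'M[o]_3, comm3 X A = p ^+ l *: Y /\ map_mx res X = Z].

Definition cim l (A : 'M[o]_3) : set 'M[k]_3 :=
  [set Z | exists X Y : 'M[o]_3, comm3 X A = p ^+ l *: Y /\ map_mx res Y = Z].

Lemma csh_subalg l A : subalg (csh l A).
Proof.
split.
- split.
  + by exists 0, 0; rewrite comm30 scaler0 map_mx0.
  + move=> _ _ [X [Y [E <-]]] [X' [Y' [E' <-]]]; exists (X + X'), (Y + Y').
    by rewrite comm3D E E' scalerDr map_mxD.
  + move=> c _ [X [Y [E <-]]]; have [c' <-] := res_surj c; exists (c' *: X), (c' *: Y).
    by rewrite comm3Z E scalerA mulrC -scalerA map_mxZ.
- by exists 1%:M, 0; rewrite comm31 scaler0 map_mx1.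
- move=> _ _ [X [Y [E <-]]] [X' [Y' [E' <-]]]; exists (X *m X'), (Y *m X' + X *m Y').
  by rewrite comm3M E E' -scalemxAl -scalemxAr scalerDr map_mxM.
Qed.

Lemma cim_subspace l A : is_subspace (cim l A).
Proof.
split.
+ by exists 0, 0; rewrite comm30 scaler0 map_mx0.
+ move=> _ _ [X [Y [E <-]]] [X' [Y' [E' <-]]]; exists (X + X'), (Y + Y').
  by rewrite comm3D E E' scalerDr map_mxD.
+ move=> c _ [X [Y [E <-]]]; have [c' <-] := res_surj c; exists (c' *: X), (c' *: Y).
  by rewrite comm3Z E scalerA mulrC -scalerA map_mxZ.
Qed.

Lemma cshS l A Z : csh l.+1 A Z -> csh l A Z.
Proof.
move=> [X [Y [E ZE]]]; exists X, (p *: Y); split=> //.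
by rewrite E exprSr scalerA.
Qed.

Lemma cimS l A Z : cim l A Z -> cim l.+1 A Z.
Proof.
move=> [X [Y [E ZE]]]; exists (p *: X), Y; split=> //.
by rewrite comm3Z E exprS scalerA.
Qed.

Lemma csh1 A : csh 1 A = centraliser (map_mx res A).
Proof.
apply/seteqP; split=> Z.
  move=> [X [Y [E <-]]]; apply/eqP; rewrite -subr_eq0 -map_comm3 E.
  by rewrite map_res_p.
have [X <-] := map_res_surj Z => cX.
have [Y YE] : exists Y, comm3 X A = p *: Y.
  by apply: map_res_eq0; rewrite map_comm3 cX subrr.
by exists X, Y; rewrite expr1.
Qed.

Lemma csh0 A : csh 0 A = setT.
Proof.
apply/seteqP; split=> // Z _; have [X <-] := map_res_surj Z.
by exists X, (comm3 X A); rewrite expr0 scale1r.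
Qed.

Lemma map_trace (X : 'M[o]_3) : \tr (map_mx res X) = res (\tr X).
Proof. by rewrite /mxtrace rmorph_sum /=; apply: eq_bigr => i _; rewrite mxE. Qed.

Lemma pI (x y : o) l : p ^+ l * x = p ^+ l * y -> x = y.
Proof. by apply: mulfI; rewrite expf_neq0. Qed.

(** By invariance of the trace form, $\mathrm{tr}(X_1 [X_2, A]) = -\mathrm{tr}(X_2 [X_1, A])$ for
    the lifts. The right side carries one more factor [p] than the left, so after division by
    [p ^+ l] the value vanishes modulo [p]. *)
Lemma csh_cim l A X Z : csh l.+1 A X -> cim l A Z -> \tr (X *m Z) = 0.
Proof.
move=> [X1 [Y1 [E1 <-]]] [X2 [Y2 [E2 <-]]].
rewrite -map_mxM map_trace.
rewrite (_ : \tr _ = - (p * \tr (X2 *m Y1))); first by rewrite raddfN /= rmorphM /= res_p mul0r oppr0.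
apply: (@pI _ _ l); rewrite -[LHS]mxtraceZ scalemxAr -E2 comm3_trace E1.
by rewrite -scalemxAr mxtraceZ exprSr -mulrA mulrN.
Qed.

(* If [\tr (W Z) = 0] for all [Z] in [cim l.+1], lift [W] to [X] with
   [comm3 X A = p ^ l.+1 D]; since [\tr (D Y) = - \tr (X D1)] for [comm3 Y A = p ^ l.+1 D1],
   the residue of [D] lies in the double orthogonal of [cim l], so that [X] can be
   corrected by a multiple of [p]. *)
Lemma orth_cim_csh l A W : orth (cim l A) W -> csh l.+1 A W.
Proof.
elim: l W => [|l IH] W oW.
  (* At level 0 all commutators with the residue of [A] lie in [cim 0 A], and nondegeneracy turns
     orthogonality to them into commuting. *)
  rewrite csh1; apply/eqP; rewrite -subr_eq0; apply/eqP.
  apply: mxtrace_nondeg => X; have [X' XE] := map_res_surj X.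
  have /oW : cim 0 A (X *m map_mx res A - map_mx res A *m X).
    by exists X', (comm3 X' A); rewrite expr0 scale1r map_comm3 XE.
  rewrite mulmxBr [LHS]raddfB /= => /eqP; rewrite subr_eq0 => /eqP E.
  rewrite mulmxBl [LHS]raddfB /= -!mulmxA.
  by rewrite -E [X in _ - X]mxtrace_mulC -mulmxA subrr.
have [X [D [E XW]]] : csh l.+1 A W.
  by apply: IH => Z hZ; apply: oW; apply: cimS.
have : cim l A (map_mx res D).
  apply: orth_orth; first exact: cim_subspace.
  move=> Y /IH [Y1 [D1 [E1 <-]]].
  have : \tr (W *m map_mx res D1) = 0 by apply: oW; exists Y1, D1.
  rewrite -XW -!map_mxM !map_trace => h0.
  rewrite mxtrace_mulC; rewrite (_ : \tr _ = - \tr (X *m D1)); first by rewrite raddfN /= h0 oppr0.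
  apply: (@pI _ _ l.+1); rewrite -[LHS]mxtraceZ scalemxAr -E comm3_trace E1.
  by rewrite -scalemxAr mxtraceZ mulrN.
move=> [X1 [D1 [E1 /map_res_eq[Y DE]]]].
exists (X - p *: X1), (- Y); split; last first.
  by rewrite map_mxB map_res_p1 subr0.
rewrite comm3D -scaleNr comm3Z E E1 DE scalerDr scaleNr exprS !scalerA mulrC.
rewrite scalerDr opprD !scalerA [p * p ^+ l]mulrC addrA subrr add0r scalerN.
by rewrite !exprSr [p * _]mulrC.
Qed.

Lemma cimE l A : cim l A = orth (csh l.+1 A).
Proof.
apply/seteqP; split=> Z.
  by move=> hZ X hX; rewrite mxtrace_mulC; apply: csh_cim hX hZ.
move=> oZ; apply: orth_orth; first exact: cim_subspace.
by move=> W /orth_cim_csh /oZ.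
Qed.

Lemma csh_cong l A Z : csh l (A + p ^+ l *: Z) = csh l A.
Proof.
apply/seteqP; split=> _ [X [Y [E <-]]].
  exists X, (Y - comm3 X Z); split=> //.
  by rewrite scalerBr -E comm3Dr comm3Zr addrK.
exists X, (Y + comm3 X Z); split=> //.
by rewrite scalerDr -E comm3Dr comm3Zr.
Qed.

(* Two lifts of the same residue differ by a multiple of [p], so the quotients
   of their commutators by [p ^+ l.+1] agree modulo [orth]. *)
Lemma lift_orth l A X X' Y Y' : map_mx res X = map_mx res X' ->
  comm3 X A = p ^+ l.+1 *: Y -> comm3 X' A = p ^+ l.+1 *: Y' ->
  orth (csh l.+1 A) (map_mx res Y - map_mx res Y').
Proof.
move=> /map_res_eq[W ->]; rewrite comm3D => E E'; rewrite -map_mxB -cimE.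
exists W, (Y - Y'); split=> //; apply: (@scalepI 1).
rewrite expr1 scalerA -exprS scalerBr -E -E' comm3Z.
by rewrite [RHS]addrC addrA addNr add0r.
Qed.

(** [D X] is only asked to come from some lift of [X]; by [lift_orth] another lift changes it by an
    element of the orthogonal. *)
Definition quot_of l A (D : 'M[k]_3 -> 'M[k]_3) : Prop :=
  forall X, csh l A X -> exists X' Y : 'M[o]_3,
    [/\ comm3 X' A = p ^+ l *: Y, map_mx res X' = X & map_mx res Y = D X].

(** Each identity holds over [o] for the chosen lifts, and [qD] carries it to the values of [D] at
    the cost of [orth]. Alternation is $\mathrm{tr}([X, A] X) = 0$ divided by the power of [p],
    hence holds in characteristic 2 as well. *)
Lemma quot_ofP l A : exists2 D, alt_deriv (csh l.+1 A) D & quot_of l.+1 A D.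
Proof.
pose P X D := csh l.+1 A X -> exists X' Y : 'M[o]_3,
  [/\ comm3 X' A = p ^+ l.+1 *: Y, map_mx res X' = X & map_mx res Y = D].
have /choice[D hD] X : exists D, P X D.
  have [[X' [Y [E XE]]]|nX] := pselect (csh l.+1 A X); last by exists 0.
  by exists (map_mx res Y) => _; exists X', Y.
exists D => //.
have qD X X' Y : comm3 X' A = p ^+ l.+1 *: Y -> map_mx res X' = X ->
    orth (csh l.+1 A) (D X - map_mx res Y).
  move=> E XE; have [|X1 [Y1 [E1 X1E <-]]] := hD X; first by exists X', Y.
  by apply: lift_orth E1 E; rewrite X1E.
split=> [X Y /hD[X1 [D1 [E1 <- <-]]] /hD[Y1 [D2 [E2 <- <-]]]|
  c X /hD[X1 [D1 [E1 <- <-]]]|X /hD[X1 [D1 [E1 <- <-]]]|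
  X Y /hD[X1 [D1 [E1 <- <-]]] /hD[Y1 [D2 [E2 <- <-]]]].
- by rewrite -!map_mxD; apply: (qD _ (X1 + Y1)) => //; rewrite comm3D E1 E2 scalerDr.
- have [c' <-] := res_surj c; rewrite -!map_mxZ; apply: (qD _ (c' *: X1)) => //.
  by rewrite comm3Z E1 !scalerA mulrC.
- rewrite -map_mxM map_trace (_ : \tr _ = 0) ?rmorph0 //.
  apply: (@pI _ _ l.+1); rewrite mulr0 -[LHS]mxtraceZ scalemxAl -E1 comm3_trace0 //.
- rewrite -!map_mxM -map_mxD; apply: (qD _ (X1 *m Y1)) => //.
  by rewrite comm3M E1 E2 scalerDr scalemxAl scalemxAr.
Qed.

(* A good matrix serves as the origin among the matrices congruent to it modulo
   [p ^+ l]. *)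
Definition good l A : Prop := forall X, csh l A X -> csh l.+1 A X.

(** By [cimE] the hypothesis says that the quotient of $[X, A + p^{l+1} Z]$ by $p^{l+1}$ has the
    same residue as the quotient of some $[W, A]$ by $p^l$. Subtracting [p *: W] from the lift of
    [X] gains a power of [p] and keeps the residue. *)
Lemma good_lift l A D Z : quot_of l.+1 A D ->
  (forall X, csh l.+1 A X -> orth (csh l.+1 A) (D X + (X *m map_mx res Z - map_mx res Z *m X))) ->
  good l.+1 (A + p ^+ l.+1 *: Z).
Proof.
move=> hD hZ X; rewrite csh_cong => hX.
have := hZ _ hX; have [X1 [Y1 [E1 <- <-]]] := hD _ hX.
rewrite -map_comm3 -map_mxD -cimE => -[W [V [E2 /map_res_eq[U VE]]]].
exists (X1 - p *: W), (- U - comm3 W Z); split; last by rewrite map_mxB map_res_p1 subr0.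
rewrite comm3D -scaleNr comm3Z !comm3Dr !comm3Zr E1 E2 VE.
by apply/matrixP => i j; rewrite !mxE !exprS; ring.
Qed.

(** Goodness gives each [X] a lift whose commutator with [A] is divisible by $p^{l+2}$. What remains
    is $p^{l+1} [X, Z]$, and changing the lift by [p *: W] alters its quotient by elements of
    [cim l A], the orthogonal of the shadow. *)
Lemma csh_good l A Z : good l.+1 A ->
  csh l.+2 (A + p ^+ l.+1 *: Z) = radf (csh l.+1 A) (map_mx res Z).
Proof.
move=> gA; apply/seteqP; split=> X.
  move=> [X1 [Y1 [E1 XE]]].
  have hX : csh l.+1 A X.
    by rewrite -(csh_cong _ _ Z); apply: cshS; exists X1, Y1.
  split=> //; have [X2 [Y2 [E2 XE2]]] := gA _ hX.
  have [W WE] : exists W, X1 = X2 + p *: W by apply: map_res_eq; rewrite XE2.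
  rewrite -cimE -XE -map_comm3; exists (- W), (comm3 X1 Z + p *: (Y2 - Y1)); split.
    apply: (@scalepI 1); rewrite expr1.
    rewrite -comm3Z scalerN (_ : - (p *: W) = X2 - X1); last first.
      by rewrite WE opprD addrA subrr add0r.
    have -> : comm3 (X2 - X1) A = p ^+ l.+2 *: Y2 - (p ^+ l.+2 *: Y1 - p ^+ l.+1 *: comm3 X1 Z).
      by rewrite -E2 -E1 comm3Dr comm3Zr addrK -scaleN1r comm3D comm3Z scaleN1r.
    by apply/matrixP => i j; rewrite !mxE !exprS; ring.
  by rewrite map_mxD map_res_p1 addr0.
move=> [hX]; have [X1 [Y1 [E1 <-]]] := gA _ hX.
rewrite -map_comm3 -cimE => -[W [V [E2 /map_res_eq[U VE]]]].
exists (X1 - p *: W), (Y1 - U - comm3 W Z); split; last by rewrite map_mxB map_res_p1 subr0.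
rewrite comm3D -scaleNr comm3Z !comm3Dr !comm3Zr E1 E2 VE.
by apply/matrixP => i j; rewrite !mxE !exprS; ring.
Qed.

(** A conjugating [g] commutes with [A] modulo $p^{l+1}$, so its residue lies in the shadow. Up to a
    multiple of [p] it is a lift supplied by goodness; then only [g Z - Z' g] remains, to be read
    modulo [cim l A]. *)
Lemma conj_good l A Z Z' : good l.+1 A ->
  (exists2 g, g \in unitmx &
     dvm l.+2 (g *m (A + p ^+ l.+1 *: Z) - (A + p ^+ l.+1 *: Z') *m g))
  <-> eqv (csh l.+1 A) (map_mx res Z) (map_mx res Z').
Proof.
move=> gA.
have gE g : g *m (A + p ^+ l.+1 *: Z) - (A + p ^+ l.+1 *: Z') *m g =
    comm3 g A + p ^+ l.+1 *: (g *m Z - Z' *m g).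
  rewrite comm3.unlock mulmxDl mulmxDr -scalemxAl -scalemxAr scalerBr opprD.
  by rewrite addrACA.
split=> [[g ug]|[g hg]].
  rewrite gE => -[Y1 E1]; exists (map_mx res g).
    exists g, (p *: Y1 - (g *m Z - Z' *m g)); split=> //.
    by rewrite scalerBr scalerA -exprSr -E1 addrK.
  rewrite -unitmx_res ug; split=> //.
  have hg : csh l.+1 A (map_mx res g).
    exists g, (p *: Y1 - (g *m Z - Z' *m g)); split=> //.
    by rewrite scalerBr scalerA -exprSr -E1 addrK.
  have [g2 [Y2 [E2 gg2]]] := gA _ hg.
  have [W WE] := map_res_eq gg2.
  rewrite -!map_mxM -map_mxB -cimE; exists W, (g *m Z - Z' *m g + p *: (Y2 - Y1)); split.
    apply: (@scalepI 1); rewrite expr1 -comm3Z (_ : p *: W = g2 - g); last first.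
      by rewrite WE [g + _]addrC addrK.
    have -> : comm3 (g2 - g) A = p ^+ l.+2 *: Y2 - (p ^+ l.+2 *: Y1 - p ^+ l.+1 *: (g *m Z - Z' *m g)).
      by rewrite -E2 -E1 addrK -scaleN1r comm3D comm3Z scaleN1r.
    by apply/matrixP => i j; rewrite 2!mxE [in RHS]mxE [in RHS]mxE !exprS !mxE; ring.
  by rewrite map_mxD map_res_p1 addr0.
have [g1 [Y1 [E1 <-]]] := gA _ hg; rewrite -unitmx_res => -[ug].
rewrite -!map_mxM -map_mxB -cimE => -[W [V [E2 /map_res_eq[U VE]]]].
exists (g1 - p *: W).
  by rewrite unitmx_res map_mxB map_res_p1 subr0 -unitmx_res.
rewrite mulmxBl mulmxBr.
have -> : g1 *m (A + p ^+ l.+1 *: Z) - p *: W *m (A + p ^+ l.+1 *: Z)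
    - ((A + p ^+ l.+1 *: Z') *m g1 - (A + p ^+ l.+1 *: Z') *m (p *: W)) =
  comm3 g1 A + p ^+ l.+1 *: (g1 *m Z - Z' *m g1)
  - p *: (comm3 W A + p ^+ l.+1 *: (W *m Z - Z' *m W)).
  rewrite -gE comm3.unlock !(mulmxDl, mulmxDr) -!(scalemxAl, scalemxAr).
  by apply/matrixP => i j; do !rewrite [in RHS]mxE [in LHS]mxE; rewrite !mxE; ring.
exists (Y1 - U - (W *m Z - Z' *m W)).
rewrite E1 E2 VE; move: (g1 *m Z - _) (W *m Z - _) => P1 P2.
by apply/matrixP => i j; rewrite !mxE !exprS; ring.
Qed.

Lemma scalar_decomp l A :
  (exists a A', A = a%:M + p ^+ l *: A') \/
  (exists m a A', (m < l)%N /\ A = a%:M + p ^+ m *: A' /\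
                  ~~ is_scalar_mx (map_mx res A')).
Proof.
elim: l => [|l [[a [A' AE]]|[m [a [A' [ml h]]]]]].
- by left; exists 0, A; rewrite expr0 scale1r raddf0 add0r.
- have [/is_scalar_mxP[c cE]|ns] := boolP (is_scalar_mx (map_mx res A')); last first.
    by right; exists l, a, A'.
  have [c' c'E] := res_surj c.
  have [W WE] : exists W, A' = c'%:M + p *: W.
    by apply: map_res_eq; rewrite map_scalar_mx /= c'E.
  left; exists (a + p ^+ l * c'), W.
  by rewrite AE WE scalerDr scalerA -exprSr addrA raddfD /= scale_scalar_mx.
- by right; exists m, a, A'; rewrite ltnS ltnW.
Qed.

(** The quotient [A'] of [A - a] by the largest possible power of [p] commutes with [A] exactly. It
    supplies the element of the radical that [alt3] asks for. *)
Lemma nonscalar_commuting l A : csh l A <> setT ->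
  exists Y, [/\ comm3 Y A = 0 & ~~ is_scalar_mx (map_mx res Y)].
Proof.
have [[a [A' ->]] []|[m [a [A' [_ [-> ns]]]]] _] := scalar_decomp l A.
  apply/seteqP; split=> // X _; have [X' <-] := map_res_surj X.
  by exists X', (comm3 X' A'); rewrite comm3Dr comm3_scalar comm3Zr add0r.
exists A'; split=> //; rewrite comm3Dr comm3_scalar comm3Zr add0r.
by rewrite comm3.unlock subrr scaler0.
Qed.

(** If [A] ceased to be scalar at a level [m < l], every matrix over [k] would commute with the
    nonscalar residue of [A']. *)
Lemma csh_setT l A : csh l A = setT -> exists a A', A = a%:M + p ^+ l *: A'.
Proof.
move=> hT; have [//|[m [a [A' [ml [AE /negP[]]]]]]] := scalar_decomp l A.
apply: central_scalar => X.
have : csh l A X by rewrite hT.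
  move=> [X' [Y []]]; rewrite AE comm3Dr comm3_scalar comm3Zr add0r => E <-.
  apply/eqP; rewrite -subr_eq0 -map_comm3; apply/eqP.
  rewrite (_ : comm3 X' A' = p ^+ (l - m.+1).+1 *: Y) ?map_res_p //.
  by apply: (@scalepI m); rewrite E scalerA -exprD addnS -addSn subnKC.
Qed.

Lemma good_setT l A : csh l A = setT -> exists Z, good l (A + p ^+ l *: Z).
Proof.
move=> /csh_setT[a [A' ->]]; exists (- A'); rewrite scalerN addrK => X _.
have [X' <-] := map_res_surj X; exists X', 0.
by rewrite comm3_scalar scaler0.
Qed.

Lemma good_inner l A :
  (forall D, alt_deriv (csh l.+1 A) D -> inner_for (csh l.+1 A) D) ->
  exists Z, good l.+1 (A + p ^+ l.+1 *: Z).
Proof.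
move=> inn; have [D /inn[Z hZ] qD] := quot_ofP l A.
have [Z' ZE] := map_res_surj Z; exists Z'; apply: (good_lift qD) => X.
by rewrite ZE; apply: hZ.
Qed.

Lemma good_span3 l A b c : csh l.+1 A <> setT -> csh l.+1 A b -> csh l.+1 A c ->
  (forall X, csh l.+1 A X -> exists x y z, X = x%:M + y *: b + z *: c) ->
  exists Z, good l.+1 (A + p ^+ l.+1 *: Z).
Proof.
move=> nT hb hc hs; have [D hD qD] := quot_ofP l A.
have [Y [YA nY]] := nonscalar_commuting nT.
have hY : csh l.+1 A (map_mx res Y) by exists Y, 0; rewrite YA scaler0.
exists 0; apply: (good_lift qD) => X hX.
rewrite map_mx0 mulmx0 mul0mx subrr addr0; move: X hX.
apply: (alt3 hD (csh_subalg _ _) hb hc hs hY).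
  by move=> x; apply: contra nY => /eqP ->; apply/is_scalar_mxP; exists x.
have [Y1 [D1 [E1 YE <-]]] := qD _ hY.
rewrite -[map_mx res D1]subr0 -(map_mx0 res).
by apply: (lift_orth YE E1); rewrite YA scaler0.
Qed.

End Uniformiser.

(** * Similarity over the residue field *)

Section Similarity.
Variable k : finFieldType.
Implicit Types (X Y P : 'M[k]_3) (a b c : k).

Definition simil X Y : Prop := exists2 P, P \in unitmx & P *m X = Y *m P.

Lemma simil_trans X Y Z : simil X Y -> simil Y Z -> simil X Z.
Proof.
move=> [P uP E] [Q uQ F]; exists (Q *m P); first by rewrite unitmx_mul uQ.
by rewrite -mulmxA E mulmxA F mulmxA.
Qed.

Lemma simil_sym X Y : simil X Y -> simil Y X.
Proof.
move=> [P uP E]; exists (invmx P); first by rewrite unitmx_inv.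
by apply: (can_inj (mulKmx uP)); rewrite mulKVmx // mulmxA E mulmxK.
Qed.

Lemma simil_conj P X : P \in unitmx -> simil X (P *m X *m invmx P).
Proof. by move=> uP; exists P => //; rewrite mulmxKV. Qed.

Definition comp3 a b c : 'M[k]_3 := mx3 0 1 0 0 0 1 a b c.

Definition dpair : Type := {ab : k * k | ab.1 != ab.2}.
HB.instance Definition _ := Finite.on dpair.

(* The rational canonical forms of size 3, in which the non-cyclic ones are
   replaced by [a, a, b] diagonal and scalar plus square-zero matrices. *)
Definition cform : Type := ((k + dpair) + (k + (k * k * k)))%type.
HB.instance Definition _ := Finite.on cform.

Definition cform_mx (x : cform) : 'M[k]_3 :=
  match x with
  | inl (inl a) => a%:M
  | inl (inr ab) => mx3 (val ab).1 0 0 0 (val ab).1 0 0 0 (val ab).2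
  | inr (inl a) => mx3 a 0 1 0 a 0 0 0 a
  | inr (inr (a, b, c)) => comp3 a b c
  end.

Definition has_cform X : Prop := exists x, simil X (cform_mx x).

Lemma has_cform_simil X Y : simil X Y -> has_cform Y -> has_cform X.
Proof. by move=> XY [x Yx]; exists x; apply: simil_trans Yx. Qed.

Lemma mx3_unit a b c d e f g h i :
  (mx3 a b c d e f g h i \in unitmx) =
  (a * (e * i - f * h) - b * (d * i - f * g) + c * (d * h - e * g) != 0 :> k).
Proof. by rewrite unitmxE det_mx3 unitfE. Qed.

Lemma row_mx3 (a b c d e f g h i : k) :
  (row o0 (mx3 a b c d e f g h i) = \row_j nth 0 [:: a; b; c] j) *
  (row o1 (mx3 a b c d e f g h i) = \row_j nth 0 [:: d; e; f] j) *
  (row o2 (mx3 a b c d e f g h i) = \row_j nth 0 [:: g; h; i] j).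
Proof. by do !split; apply/rowP; apply: ord3P; rewrite !mxE. Qed.

Lemma row3_unit (u : 'rV[k]_3) : u = \row_j nth 0 [:: u 0 o0; u 0 o1; u 0 o2] j.
Proof. by apply/rowP; apply: ord3P; rewrite !mxE. Qed.

Lemma row3_delta : (\row_j nth 0 [:: 0; 1; 0] j = delta_mx 0 o1 :> 'rV[k]_3) *
  (\row_j nth 0 [:: 0; 0; 1] j = delta_mx 0 o2 :> 'rV[k]_3).
Proof. by split; apply/rowP; apply: ord3P; rewrite !mxE. Qed.

(** The rows of [P] are $v, vX, vX^2$ for a cyclic row vector [v]. In this basis [X] is a companion
    matrix, whose last row [r] holds the coordinates of $vX^3$. *)
Lemma cform_cyclic X P : P \in unitmx ->
  row o1 P = row o0 P *m X -> row o2 P = row o1 P *m X -> has_cform X.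
Proof.
move=> uP E1 E2; pose r := row o2 P *m X *m invmx P.
exists (inr (inr (r 0 o0, r 0 o1, r 0 o2))); exists P => //=.
apply/row_matrixP; apply: ord3P; rewrite !row_mul !row_mx3.
- by rewrite -E1 row3_delta -rowE.
- by rewrite -E2 row3_delta -rowE.
- by rewrite -row3_unit mulmxKV.
Qed.

Lemma simil_row1 X P : P \in unitmx -> row o1 P = row o0 P *m X ->
  exists a b c d e f, simil X (mx3 0 1 0 a b c d e f).
Proof.
move=> uP E1; set Y := P *m X *m invmx P.
exists (Y o1 o0), (Y o1 o1), (Y o1 o2), (Y o2 o0), (Y o2 o1), (Y o2 o2), P => //.
rewrite -[LHS](mulmxKV uP) -/Y; congr (_ *m P); rewrite {1}[Y]mx3_eta.
have EY : row o0 Y = delta_mx 0 o1.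
  by rewrite !row_mul -E1 rowE -mulmxA mulmxV // mulmx1.
have YE j : Y o0 j = (delta_mx 0 o1 : 'rV[k]_3) 0 j by rewrite -EY [RHS]mxE.
by rewrite !YE !mxE.
Qed.

Lemma mul_row3 (x y z a b c d e f g h i : k) :
  (\row_j nth 0 [:: x; y; z] j : 'rV[k]_3) *m mx3 a b c d e f g h i =
  \row_j nth 0 [:: x * a + y * d + z * g; x * b + y * e + z * h;
                    x * c + y * f + z * i] j.
Proof.
by apply/rowP; apply: ord3P; rewrite !mxE big_ord3 !mxE /= addrA.
Qed.

Lemma row3_inj (x y z x' y' z' : k) : x = x' -> y = y' -> z = z' ->
  (\row_j nth 0 [:: x; y; z] j : 'rV[k]_3) = \row_j nth 0 [:: x'; y'; z'] j.
Proof. by move=> -> -> ->. Qed.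

(** The vector tried is $v = (x, y, 1)$. The last coordinate of $v(X - f)$ is zero and the others
    form $w = (d + ay - fx, e + x + (b - f)y)$. The determinant of $v, vX, vX^2$ is that of [w] and
    its image under the upper left block, which is the expression assumed nonzero. *)
Lemma cform_cyclic_block a b d e f x y :
  (d + a * y - f * x) * ((d + a * y - f * x) + b * (e + x + (b - f) * y))
    - a * (e + x + (b - f) * y) ^+ 2 != 0 ->
  has_cform (mx3 0 1 0 a b 0 d e f).
Proof.
move=> Q0; apply: (@cform_cyclic _ (mx3 x y 1 (a * y + d) (x + b * y + e) f
   (a * (x + b * y + e) + d * f) (a * y + d + b * (x + b * y + e) + e * f) (f ^+ 2))).
- by rewrite mx3_unit; apply: contra Q0 => /eqP <-; apply/eqP; ring.
- by rewrite !row_mx3 mul_row3; apply: row3_inj; ring.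
- by rewrite !row_mx3 mul_row3; apply: row3_inj; ring.
Qed.

Lemma cform_block a b c d e f : has_cform (mx3 0 1 0 a b c d e f).
Proof.
have [c0|c0] := eqVneq c 0; last first.
  apply: (@cform_cyclic _ (mx3 1 0 0 0 1 0 a b c)).
  - by rewrite mx3_unit; apply: contra c0 => /eqP <-; apply/eqP; ring.
  - by rewrite !row_mx3 mul_row3; apply: row3_inj; ring.
  - by rewrite !row_mx3 mul_row3; apply: row3_inj; ring.
rewrite {c}c0.
have [m0|m0] := eqVneq (f ^+ 2 - b * f - a) 0; last first.
  (* This solves $w = (1, 0)$, a linear system in [x] and [y] whose determinant is the
     characteristic polynomial of the block at [f]. *)
  pose y := (d + f * e - 1) / (f ^+ 2 - b * f - a).
  apply: (@cform_cyclic_block _ _ _ _ _ (- (b - f) * y - e) y).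
  have -> : d + a * y - f * (- (b - f) * y - e) = 1.
    rewrite (_ : _ - _ = d + f * e - (f ^+ 2 - b * f - a) * y); last by ring.
    by rewrite [X in _ - X]mulrC divfK //; ring.
  have -> : e + (- (b - f) * y - e) + (b - f) * y = 0 by ring.
  by rewrite mulr0 addr0 mul1r expr0n mulr0 subr0 oner_eq0.
have [d0|d0] := eqVneq (d + f * e) 0; last first.
  (* Now $v = (-e, 0, 1)$, for which $w = (d + fe, 0)$. *)
  apply: (@cform_cyclic_block _ _ _ _ _ (- e) 0).
  rewrite (_ : _ - _ = (d + f * e) ^+ 2); last by ring.
  by rewrite expf_neq0.
(* What is left is annihilated by $(t - f)(t - (b - f))$; equal and distinct roots give the two
   nonscalar non-cyclic forms. *)
have {m0} -> : a = f ^+ 2 - b * f by rewrite -[LHS]add0r -m0; ring.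
have {d0} -> : d = - (f * e) by rewrite -[LHS]subr0 -d0; ring.
have [bf|bf] := eqVneq b (f + f).
  exists (inr (inl f)), (mx3 1 0 0 (- e) 0 1 (- f) 1 0).
    by rewrite mx3_unit (_ : _ + _ = -1) ?oppr_eq0 ?oner_eq0 //; ring.
  by rewrite /= bf !mx3M; apply: mx3_eq; ring.
have bf' : f != b - f by apply: contra bf => /eqP {1}->; rewrite subrK.
exists (inl (inr (exist _ (f, b - f) bf'))), (mx3 (- e) 0 1 (- (b - f)) 1 0 (- f) 1 0).
  rewrite mx3_unit (_ : _ + _ = f - (b - f)) ?subr_eq0 //; ring.
by rewrite /= !mx3M; apply: mx3_eq; ring.
Qed.

(** Unless [X] is scalar, one of the row vectors $e_1, e_2, e_3, e_1 + e_2, e_1 + e_3$ is not an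
    eigenvector. It and its image start a basis in which [X] has the shape of [cform_block]. *)
Lemma cformP X : has_cform X.
Proof.
have step P : P \in unitmx -> row o1 P = row o0 P *m X -> has_cform X.
  move=> uP E; have [a [b [c [d [e [f XY]]]]]] := simil_row1 uP E.
  exact: has_cform_simil XY (cform_block _ _ _ _ _ _).
move: step; rewrite [X]mx3_eta; move: (X o0 o0) (X o0 o1) (X o0 o2) (X o1 o0)
  (X o1 o1) (X o1 o2) (X o2 o0) (X o2 o1) (X o2 o2) => a b c d e f g h i step.
have go x y z u v w x' y' z' : mx3 x y z u v w x' y' z' \in unitmx ->
    u = x * a + y * d + z * g -> v = x * b + y * e + z * h ->
    w = x * c + y * f + z * i -> has_cform (mx3 a b c d e f g h i).
  move=> uP E1 E2 E3; apply: (step _ uP); rewrite !row_mx3 mul_row3.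
  by rewrite E1 E2 E3.
have [b0|b0] := eqVneq b 0; last first.
  apply: (go 1 0 0 a b c 0 0 1); try ring.
  by rewrite mx3_unit; apply: contra b0 => /eqP <-; apply/eqP; ring.
have [c0|c0] := eqVneq c 0; last first.
  apply: (go 1 0 0 a b c 0 1 0); try ring.
  by rewrite mx3_unit -oppr_eq0; apply: contra c0 => /eqP <-; apply/eqP; ring.
have [d0|d0] := eqVneq d 0; last first.
  apply: (go 0 1 0 d e f 0 0 1); try ring.
  by rewrite mx3_unit -oppr_eq0; apply: contra d0 => /eqP <-; apply/eqP; ring.
have [f0|f0] := eqVneq f 0; last first.
  apply: (go 0 1 0 d e f 1 0 0); try ring.
  by rewrite mx3_unit; apply: contra f0 => /eqP <-; apply/eqP; ring.
have [g0|g0] := eqVneq g 0; last first.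
  apply: (go 0 0 1 g h i 0 1 0); try ring.
  by rewrite mx3_unit; apply: contra g0 => /eqP <-; apply/eqP; ring.
have [h0|h0] := eqVneq h 0; last first.
  apply: (go 0 0 1 g h i 1 0 0); try ring.
  by rewrite mx3_unit -oppr_eq0; apply: contra h0 => /eqP <-; apply/eqP; ring.
have [ae|ae] := eqVneq a e; last first.
  apply: (go 1 1 0 a e 0 0 0 1); rewrite ?b0 ?c0 ?d0 ?f0 ?g0 ?h0; try ring.
  by rewrite mx3_unit -oppr_eq0; apply: contra ae => /eqP E; rewrite -subr_eq0 -E; apply/eqP; ring.
have [ai|ai] := eqVneq a i; last first.
  apply: (go 1 0 1 a 0 i 0 1 0); rewrite ?b0 ?c0 ?d0 ?f0 ?g0 ?h0; try ring.
  by rewrite mx3_unit; apply: contra ai => /eqP E; rewrite -subr_eq0 -E; apply/eqP; ring.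
exists (inl (inl a)), 1%:M; rewrite ?unitmx1 //= mul1mx mulmx1 mx3_scalar.
by rewrite b0 c0 d0 f0 g0 h0 -ae -ai.
Qed.

End Similarity.

#[local] Opaque mxminpoly.

(** * Minimal polynomials of the canonical forms *)

Section MinimalPolynomials.
Variable k : finFieldType.
Implicit Types (X Y P : 'M[k]_3) (a b c r : k) (p q : {poly k}).

(** The signs make [cub a b c] the characteristic polynomial of [comp3 a b c], and [quad a b] that
    of the companion block with last row [a, b]. *)
Definition quad a b : {poly k} := 'X^2 - b%:P * 'X - a%:P.
Definition cub a b c : {poly k} := 'X^3 - c%:P * 'X^2 - b%:P * 'X - a%:P.

Lemma cubE a b c : cub a b c = [:: - a; - b; - c; 1] :> seq k.
Proof.
rewrite -[RHS](@PolyK _ 0) ?oner_eq0 //; congr polyseq; apply/polyP => i.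
rewrite coef_Poly /cub; case: i => [|[|[|[|i]]]];
  rewrite !coefE /= ?mulr0 ?mulr1 ?subr0 ?sub0r ?addr0 ?add0r ?nth_nil //; ring.
Qed.

Lemma quadE a b : quad a b = [:: - a; - b; 1] :> seq k.
Proof.
rewrite -[RHS](@PolyK _ 0) ?oner_eq0 //; congr polyseq; apply/polyP => i.
rewrite coef_Poly /quad; case: i => [|[|[|i]]];
  rewrite !coefE /= ?mulr0 ?mulr1 ?subr0 ?sub0r ?addr0 ?add0r ?nth_nil //; ring.
Qed.

Lemma size_cub a b c : size (cub a b c) = 4.
Proof. by rewrite cubE. Qed.

Lemma size_quad a b : size (quad a b) = 3.
Proof. by rewrite quadE. Qed.

Lemma cub_monic a b c : cub a b c \is monic.
Proof. by rewrite monicE lead_coefE cubE. Qed.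

Lemma quad_monic a b : quad a b \is monic.
Proof. by rewrite monicE lead_coefE quadE. Qed.

Lemma cub_inj a b c a' b' c' : cub a b c = cub a' b' c' -> [/\ a = a', b = b' & c = c'].
Proof. by move=> /(congr1 (@polyseq _)); rewrite !cubE => -[/oppr_inj-> /oppr_inj-> /oppr_inj->]. Qed.

Lemma quad_inj a b a' b' : quad a b = quad a' b' -> a = a' /\ b = b'.
Proof. by move=> /(congr1 (@polyseq _)); rewrite !quadE => -[/oppr_inj-> /oppr_inj->]. Qed.

Lemma monic_cub p : p \is monic -> size p = 4 -> exists a b c, p = cub a b c.
Proof.
move=> pm sp; exists (- p`_0), (- p`_1), (- p`_2); apply: val_inj => /=.
rewrite cubE !opprK; apply: (@eq_from_nth _ 0); rewrite sp // => i.
move: pm; rewrite monicE lead_coefE sp => /eqP p3.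
by case: i => [|[|[|[|//]]]].
Qed.

Lemma monic_quad p : p \is monic -> size p = 3 -> exists a b, p = quad a b.
Proof.
move=> pm sp; exists (- p`_0), (- p`_1); apply: val_inj => /=.
rewrite quadE !opprK; apply: (@eq_from_nth _ 0); rewrite sp // => i.
move: pm; rewrite monicE lead_coefE sp => /eqP p3.
by case: i => [|[|[|//]]].
Qed.

Lemma mulXquad r a b :
  ('X - r%:P) * quad a b = cub (- (r * a)) (a - r * b) (b + r).
Proof. by rewrite /quad /cub rmorphN rmorphB rmorphD !rmorphM /=; ring. Qed.

Lemma mulXX a b : ('X - a%:P) * ('X - b%:P) = quad (- (a * b)) (a + b).
Proof. by rewrite /quad rmorphN rmorphD rmorphM /=; ring. Qed.

Lemma horner_quad a b x : (quad a b).[x] = x ^+ 2 - b * x - a.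
Proof. by rewrite /quad !hornerE. Qed.

Lemma horner_mx_cub X a b c :
  horner_mx X (cub a b c) = X *m X *m X - c *: (X *m X) - b *: X - a%:M.
Proof.
rewrite /cub exprSr expr2 !rmorphB !rmorphM /= !horner_mx_C !horner_mx_X.
by rewrite -!mulmxE !mul_scalar_mx.
Qed.

Lemma horner_mx_quad X a b : horner_mx X (quad a b) = X *m X - b *: X - a%:M.
Proof.
rewrite /quad expr2 !rmorphB !rmorphM /= !horner_mx_C !horner_mx_X.
by rewrite -!mulmxE !mul_scalar_mx.
Qed.

Lemma mxminpoly_eq X p : p \is monic -> horner_mx X p = 0 ->
  (size p <= size (mxminpoly X))%N -> mxminpoly X = p.
Proof.
move=> pm X0 sz; have := mxminpoly_min X0.
move/dvdp_size_eqp => E; apply/eqP; rewrite -eqp_monic ?mxminpoly_monic //.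
rewrite -E eqn_leq sz andbT dvdp_leq ?monic_neq0 //.
exact: mxminpoly_min.
Qed.

Lemma size_minpoly_nonscalar X : ~~ is_scalar_mx X -> (2 < size (mxminpoly X))%N.
Proof. by rewrite -mxminpoly_linear_is_scalar size_mxminpoly -ltnNge. Qed.

Lemma size_minpoly_scalar X : (size (mxminpoly X) <= 2)%N -> exists a, X = a%:M.
Proof. by rewrite size_mxminpoly ltnS mxminpoly_linear_is_scalar => /is_scalar_mxP. Qed.

Lemma size_minpoly_le X : (size (mxminpoly X) <= 4)%N.
Proof.
rewrite (leq_trans (dvdp_leq _ (mxminpoly_dvd_char X))) ?size_char_poly //.
by rewrite monic_neq0 ?char_poly_monic.
Qed.

Lemma size_minpoly_free X :
  (forall x y z, x%:M + y *: X + z *: (X *m X) = 0 -> z = 0) ->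
  ~~ is_scalar_mx X -> size (mxminpoly X) = 4.
Proof.
move=> free /size_minpoly_nonscalar s2; apply/eqP.
rewrite eqn_leq size_minpoly_le ltn_neqAle s2 andbT.
apply/eqP => /esym s3; have [a [b E]] := monic_quad (mxminpoly_monic X) s3.
have := mx_root_minpoly X; rewrite E horner_mx_quad => E0.
have /eqP : (1 : k) = 0; last by rewrite oner_eq0.
apply: (free (- a) (- b)); rewrite scale1r scaleNr raddfN /= -E0.
by rewrite [RHS]addrC [RHS]addrA [_ - b *: X + _]addrAC -!addrA; congr (_ + _); rewrite addrC.
Qed.

Lemma simil_minpoly X Y : simil X Y -> mxminpoly X = mxminpoly Y.
Proof.
move=> [P uP E]; have <- : conjmx P X = Y by rewrite conjumx // E mulmxK.
by rewrite mxminpoly_uconj.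
Qed.

Lemma simil_trace X Y : simil X Y -> \tr X = \tr Y.
Proof.
by move=> [P uP E]; rewrite -(conj_mxtrace X uP) E mulmxK.
Qed.

Lemma comp3_minpoly a b c : mxminpoly (comp3 a b c) = cub a b c.
Proof.
have ns : ~~ is_scalar_mx (comp3 a b c).
  apply/negP => /is_scalar_mxP[x]; rewrite mx3_scalar => /mx3_inj[[_ /eqP]].
  by rewrite oner_eq0.
have sz : size (mxminpoly (comp3 a b c)) = 4.
  apply: size_minpoly_free => // x y z; rewrite /comp3 !mx3E => /mx3_inj[[_ _ +] _].
  by rewrite !(mul0r, mulr0, mulr1, add0r, addr0).
apply: mxminpoly_eq; rewrite ?cub_monic ?sz ?size_cub //.
by rewrite horner_mx_cub /comp3 !mx3E; apply: mx3_eq; ring.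
Qed.

Definition cform_poly (x : cform k) : {poly k} :=
  match x with
  | inl (inl a) => 'X - a%:P
  | inl (inr ab) => ('X - (val ab).1%:P) * ('X - (val ab).2%:P)
  | inr (inl a) => ('X - a%:P) ^+ 2
  | inr (inr (a, b, c)) => cub a b c
  end.

Lemma mxminpoly_cform (x : cform k) : mxminpoly (cform_mx x) = cform_poly x.
Proof.
case: x => [[a|[[a b] /= ab]]|[a|[[a b] c]]] /=.
- apply: mxminpoly_eq; rewrite ?monicXsubC //.
    by rewrite rmorphB /= horner_mx_C horner_mx_X subrr.
  by rewrite size_XsubC size_mxminpoly ltnS mxminpoly_nonconstant.
- apply: mxminpoly_eq; rewrite mulXX ?quad_monic ?size_quad //.
    by rewrite horner_mx_quad !mx3E; apply: mx3_eq; ring.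
  apply: size_minpoly_nonscalar; apply: contra ab => /is_scalar_mxP[x].
  by rewrite mx3_scalar => /mx3_inj[[-> _ _] [_ [_ _ ->]]].
- rewrite expr2; apply: mxminpoly_eq; rewrite mulXX ?quad_monic ?size_quad //.
    by rewrite horner_mx_quad !mx3E; apply: mx3_eq; ring.
  apply: size_minpoly_nonscalar; apply/negP => /is_scalar_mxP[x].
  by rewrite mx3_scalar => /mx3_inj[[_ _ /eqP]]; rewrite oner_eq0.
- exact: comp3_minpoly.
Qed.

Lemma sqrB_eq0 (a b : k) : (a - b) ^+ 2 = 0 -> a = b.
Proof. by move/eqP; rewrite expf_eq0 subr_eq0 => /eqP. Qed.

(** The minimal polynomial separates all forms except diag(a, a, b) and diag(b, b, a); the trace
    tells these two apart. *)
Lemma cform_inj (x y : cform k) : simil (cform_mx x) (cform_mx y) -> x = y.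
Proof.
move=> xy; have := simil_minpoly xy; have := simil_trace xy; rewrite {xy} !mxminpoly_cform.
have szX (a : k) : size ('X - a%:P) = 2 by rewrite size_XsubC.
have noX a b c (p : {poly k}) : size p = 3 -> p = cub a b c -> False.
  by move=> + E; rewrite E size_cub.
have noX1 a (p : {poly k}) : size p != 2 -> 'X - a%:P = p -> False.
  by move=> + E; rewrite -E szX.
have s2 a b : size (('X - a%:P) * ('X - b%:P) : {poly k}) = 3 by rewrite mulXX size_quad.
have s2' a : size (('X - a%:P) ^+ 2 : {poly k}) = 3 by rewrite expr2 s2.
case: x => [[a|[[a b] /= ab]]|[a|[[a b] c]]]; case: y => [[a'|[[a' b'] /= ab']]|[a'|[[a' b'] c']]] /=;
  rewrite ?mx3E => tr; try by (move=> /noX1[]; rewrite ?s2 ?s2' ?size_cub) ||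
    (move=> /esym/noX1[]; rewrite ?s2 ?s2' ?size_cub) || (by move=> /noX[]) || (by move=> /esym/noX[]).
- by move=> /addrI/oppr_inj/polyC_inj ->.
- rewrite !mulXX => /quad_inj[_ E].
  have aa : a = a'.
    apply: (addIr (a' + b')); rewrite -{1}E addrA [in RHS]addrA -[RHS]addrA.
    by rewrite -addrA tr.
  subst a'; move: E => /addrI E; subst b'.
  by congr (inl (inr _)); apply: val_inj.
- rewrite expr2 !mulXX => /quad_inj[/oppr_inj E1 E2]; case/eqP: ab.
  (* The discriminant $(a - b)^2$ is a polynomial in the coefficients and vanishes for a square, in
     characteristic 2 as well. *)
  apply: sqrB_eq0; rewrite (_ : _ ^+ 2 = (a + b) ^+ 2 - 4%:R * (a * b)); last by ring.
  by rewrite E1 E2; ring.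
- rewrite expr2 !mulXX => /quad_inj[/oppr_inj E1 E2]; case/eqP: ab'.
  apply: sqrB_eq0; rewrite (_ : _ ^+ 2 = (a' + b') ^+ 2 - 4%:R * (a' * b')); last by ring.
  by rewrite -E1 -E2; ring.
- rewrite !expr2 !mulXX => /quad_inj[_ E].
  by move: tr; rewrite E => /addIr ->.
- by move=> /cub_inj[-> -> ->].
Qed.

Lemma comp3_of_minpoly X a b c : mxminpoly X = cub a b c -> simil X (comp3 a b c).
Proof.
move=> E; have [x Xx] := cformP X; have := simil_minpoly Xx.
rewrite E mxminpoly_cform => Ex; suff -> : comp3 a b c = cform_mx x by [].
move: Ex; case: x Xx => [[a'|[[a' b'] /= ab']]|[a'|[[a' b'] c']]] _ /= /(congr1 (fun p : {poly k} => p)).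
- by move/(congr1 (fun p : {poly k} => size p)); rewrite size_cub size_XsubC.
- by move/(congr1 (fun p : {poly k} => size p)); rewrite size_cub mulXX size_quad.
- by move/(congr1 (fun p : {poly k} => size p)); rewrite size_cub expr2 mulXX size_quad.
- by move/cub_inj => [-> -> ->].
Qed.

Lemma simil_of_minpoly X Y : size (mxminpoly X) = 4 -> mxminpoly X = mxminpoly Y ->
  simil X Y.
Proof.
move=> sX E; have [a [b [c Xc]]] := monic_cub (mxminpoly_monic X) sX.
apply: (@simil_trans _ _ (comp3 a b c)); first exact: comp3_of_minpoly.
by apply/simil_sym/comp3_of_minpoly; rewrite -E.
Qed.

(** The first rows of $1, C, C^2$ are the three unit vectors. So a matrix commuting with the
    companion matrix $C$ is the polynomial in $C$ whose coefficients form its first row. *)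
Lemma centraliser_comp3 a b c Y : centraliser (comp3 a b c) Y ->
  Y = (Y o0 o0)%:M + Y o0 o1 *: comp3 a b c + Y o0 o2 *: (comp3 a b c *m comp3 a b c).
Proof.
rewrite {2}[Y]mx3_eta /centraliser /=; rewrite [in X in X -> _](mx3_eta Y).
move: (Y o0 o0) (Y o0 o1) (Y o0 o2) (Y o1 o0) (Y o1 o1) (Y o1 o2) (Y o2 o0)
  (Y o2 o1) (Y o2 o2) => y00 y01 y02 y10 y11 y12 y20 y21 y22.
rewrite /comp3 !mx3E => /mx3_inj[[E1 E2 E3] [[E4 E5 E6] _]].
rewrite !(mul0r, mulr0, mul1r, mulr1, add0r, addr0) in E1 E2 E3 E4 E5 E6.
by rewrite -E4 -E5 -E6 -E1 -E2 -E3; apply: mx3_eq; ring.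
Qed.

End MinimalPolynomials.

(** * Centralisers of regular matrices and of types L and J *)

Section Centralisers.
Variable k : finFieldType.
Implicit Types (X Y P : 'M[k]_3) (a b c r : k) (p q : {poly k}) (h : set 'M[k]_3).

Lemma conjs_centraliser g X : g \in unitmx ->
  conjs g (centraliser X) = centraliser (g *m X *m invmx g).
Proof.
move=> ug; apply/seteqP; split=> [_ [Y YX <-]|Y YX].
  by rewrite /centraliser /= !conjs_mulK // YX.
apply/(conjsP _ _ ug); rewrite /centraliser /=.
have /(congr1 (fun M => invmx g *m M *m g)) := YX.
by rewrite !mulmxA mulVmx // mul1mx mulmxKV.
Qed.

Lemma simil_centraliser X Y : simil X Y ->
  exists2 g, g \in unitmx & centraliser Y = conjs g (centraliser X).
Proof.
move=> [P uP E]; exists P => //; rewrite conjs_centraliser //.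
by rewrite E mulmxK.
Qed.

Lemma centraliser_regular X : size (mxminpoly X) = 4 -> forall Y,
  centraliser X Y <-> exists x y z, Y = x%:M + y *: X + z *: (X *m X).
Proof.
move=> sX Y; split=> [YX|[x [y [z ->]]]]; last first.
  rewrite /centraliser /= !mulmxDl !mulmxDr scalar_mxC -!scalemxAl -!scalemxAr.
  by rewrite mulmxA.
have [a [b [c E]]] := monic_cub (mxminpoly_monic X) sX.
have [P uP XP] := comp3_of_minpoly E.
have CE : comp3 a b c = P *m X *m invmx P by rewrite XP mulmxK.
have /centraliser_comp3 : centraliser (comp3 a b c) (P *m Y *m invmx P).
  by rewrite CE -conjs_centraliser //; exists Y.
move: (_ o0 o0) (_ o0 o1) (_ o0 o2) => x y z E'.
exists x, y, z; apply: (can_inj (mulKmx uP)); apply: (can_inj (mulmxK (_ : invmx P \in unitmx))).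
  by rewrite unitmx_inv.
rewrite E' CE conjs_mulK // !mulmxDr !mulmxDl -!scalemxAr -!scalemxAl.
by rewrite -scalemx1 -!scalemxAr -scalemxAl mulmx1 mulmxV.
Qed.

Lemma centraliser_horner X Y : size (mxminpoly X) = 4 ->
  centraliser X Y <-> exists p, Y = horner_mx X p.
Proof.
move=> sX; split=> [/(centraliser_regular sX)[x [y [z ->]]]|[p ->]].
  exists (x%:P + y%:P * 'X + z%:P * ('X * 'X)).
  rewrite !rmorphD !rmorphM /= !horner_mx_C horner_mx_X.
  by rewrite -!mulmxE !mul_scalar_mx.
by rewrite /centraliser /= !mulmxE; apply: comm_horner_mx; apply: commr_refl.
Qed.

Lemma centraliser_eq X Y : size (mxminpoly X) = 4 -> size (mxminpoly Y) = 4 ->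
  centraliser X Y -> centraliser X = centraliser Y.
Proof.
move=> sX sY XY.
suff sub (U V : 'M[k]_3) : size (mxminpoly U) = 4 -> size (mxminpoly V) = 4 ->
    centraliser U V -> centraliser U `<=` centraliser V.
  by apply/seteqP; split; apply: sub => //; rewrite /centraliser /= XY.
move=> sU sV /(centraliser_horner _ sU)[p ->] W /(centraliser_horner _ sU)[q ->].
by rewrite /centraliser /= !mulmxE -!rmorphM /= mulrC.
Qed.

(** The centraliser of a regular [X] is [k[X]]. So it is enough to find a generator [p(X)] of this
    algebra with the minimal polynomial of [Y], even if those of [X] and [Y] differ. *)
Lemma centraliser_conj_of_poly X Y p : size (mxminpoly X) = 4 -> size (mxminpoly Y) = 4 ->
  mxminpoly (horner_mx X p) = mxminpoly Y ->
  exists2 g, g \in unitmx & centraliser Y = conjs g (centraliser X).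
Proof.
move=> sX sY E; have sp : size (mxminpoly (horner_mx X p)) = 4 by rewrite E.
have -> : centraliser X = centraliser (horner_mx X p).
  by apply: (centraliser_eq sX sp); apply/(centraliser_horner _ (sX)); exists p.
exact: simil_centraliser (simil_of_minpoly sp E).
Qed.

Lemma conj_setsP (S : set 'M[k]_3) h : conj_sets S h <-> exists2 g, g \in unitmx & h = conjs g S.
Proof. by split=> [[g]|[g]]; exists g. Qed.

Lemma subalg_centraliser X : subalg (centraliser X).
Proof.
split; last 1 first.
- by move=> Y Z; rewrite /centraliser /= => YX ZX; rewrite -mulmxA ZX mulmxA YX mulmxA.
- split=> [|Y Z|c Y]; rewrite /centraliser /=; first by rewrite mulmx0 mul0mx.
    by move=> YX ZX; rewrite mulmxDl mulmxDr YX ZX.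
  by move=> YX; rewrite -scalemxAl -scalemxAr YX.
- by rewrite /centraliser /= mul1mx mulmx1.
Qed.

Definition algL : set 'M[k]_3 := [set X | exists a b c d e, X = mx3 a b 0 c d 0 0 0 e].
Definition algJ : set 'M[k]_3 := [set X | exists a b c d e, X = mx3 a b c 0 d e 0 0 a].

Lemma centraliser_L a b : a != b -> centraliser (mx3 a 0 0 0 a 0 0 0 b) = algL.
Proof.
move=> ab; apply/seteqP; split=> [X|_ [x [y [z [t [u ->]]]]]]; last first.
  by rewrite /centraliser /= !mx3E; apply: mx3_eq; ring.
rewrite /centraliser /= (mx3_eta X) !mx3E => /mx3_inj[[_ _ E1] [[_ _ E2] [E3 E4 _]]].
rewrite !(mul0r, mulr0, add0r, addr0) in E1 E2 E3 E4.
have h0 (x : k) : x * b = a * x -> x = 0.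
  move=> /eqP; rewrite mulrC -subr_eq0 -mulrBl mulf_eq0 subr_eq0 eq_sym (negPf ab) /=.
  by move/eqP.
have h1 (x : k) : x * a = b * x -> x = 0 by move=> E; apply: h0; rewrite mulrC -E mulrC.
rewrite (h0 _ E1) (h0 _ E2) (h1 _ E3) (h1 _ E4).
by do 5!eexists.
Qed.

Lemma centraliser_J a : centraliser (mx3 a 0 1 0 a 0 0 0 a) = algJ.
Proof.
apply/seteqP; split=> [X|_ [x [y [z [t [u ->]]]]]]; last first.
  by rewrite /centraliser /= !mx3E; apply: mx3_eq; ring.
rewrite /centraliser /= (mx3_eta X); move: (X o0 o0) (X o0 o1) (X o0 o2) (X o1 o0)
  (X o1 o1) (X o1 o2) (X o2 o0) (X o2 o1) (X o2 o2) => x00 x01 x02 x10 x11 x12 x20 x21 x22.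
rewrite !mx3E => /mx3_inj[[E1 E2 E3] [[_ _ E4] _]].
have e20 : x20 = 0 by move: E1; rewrite !(mul0r, mulr0, add0r, addr0, mul1r, mulr1) mulrC => /eqP; rewrite eq_sym -subr_eq0 addrC addKr => /eqP.
have e21 : x21 = 0 by move: E2; rewrite !(mul0r, mulr0, add0r, addr0, mul1r, mulr1) mulrC => /eqP; rewrite eq_sym -subr_eq0 addrC addKr => /eqP.
have e10 : x10 = 0 by move: E4; rewrite !(mul0r, mulr0, add0r, addr0, mul1r, mulr1) [a * _]mulrC => /eqP; rewrite -subr_eq0 addrK => /eqP.
have e22 : x22 = x00 by apply/eqP; move: E3; rewrite !(mul0r, mulr0, add0r, addr0, mul1r, mulr1) mulrC addrC => /eqP; rewrite [a * _]mulrC (inj_eq (addrI _)) eq_sym.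
by rewrite e20 e21 e10 e22; do 5!eexists.
Qed.

End Centralisers.

(** * The ten classes of algebras *)

Section FiniteFieldRoots.
Variable k : finFieldType.
Implicit Types (p q f g : {poly k}).

Lemma in_qpoly_eq0 f p : monic_irreducible_poly f -> (in_qpoly f p == 0) = (f %| p).
Proof.
move=> fI; have fm : f \is monic by case: fI.
apply/eqP/idP => [/val_eqP /= | hDp].
  by rewrite -Pdiv.IdomainMonic.modpE mk_monicE.
by apply/val_eqP; rewrite /= -Pdiv.IdomainMonic.modpE mk_monicE.
Qed.

(** Every element of the finite field [k[t]/f] is fixed by raising it to the order of that field. *)
Lemma irreducible_dvd_XqX f p : monic_irreducible_poly f ->
  f %| p ^+ (#|k| ^ (size f).-1) - p.
Proof.
move=> fI; rewrite -in_qpoly_eq0 // rmorphB rmorphXn /=.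
pose E := {poly %/ f with fI}.
by have := @expf_card E (in_qpoly f p); rewrite card_qfpoly => ->; rewrite subrr.
Qed.

(* [g] divides ['X ^+ (#|k| ^ n) - 'X], which splits in [{poly k} / f], so [g] has
   a root [p] there. *)
Lemma irreducible_comp_root f g : monic_irreducible_poly f -> monic_irreducible_poly g ->
  size f = size g -> exists p, f %| g \Po p.
Proof.
move=> fI gI sfg; pose E := {poly %/ f with fI}.
pose iota := qfpoly_const fI.
have : map_poly iota g %| map_poly iota ('X ^+ (#|k| ^ (size f).-1) - 'X).
  by rewrite dvdp_map sfg; apply: irreducible_dvd_XqX.
rewrite rmorphB /= map_polyXn map_polyX -(card_qfpoly fI) finField_genPoly.
move=> /dvdp_prod_XsubC[m].
move: (mask _ _) => s gs.
have [e re] : exists e, root (map_poly iota g) e.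
  case: s gs => [|e s] gs.
    have := eqp_size gs; rewrite big_nil size_poly1 size_map_poly.
    by move=> E1; have [] := gI.1; rewrite E1.
  by exists e; rewrite (eqp_root gs) big_cons rootM root_XsubC eqxx.
exists (val e); rewrite -in_qpoly_eq0 // in_qpoly_comp_horner.
rewrite (_ : in_qpoly f (val e) = e) //.
apply: val_inj; apply: in_qpoly_small.
exact: size_mk_monic.
Qed.

End FiniteFieldRoots.

(** * Representatives of the ten types *)

Section TypeOrbits.
Variable k : finFieldType.
Implicit Types (X Y : 'M[k]_3) (a b c : k) (p q f : {poly k}) (h : set 'M[k]_3).

Definition reg_poly (s : stype) p : Prop :=
  match s with
  | typeT2 => exists a f, [/\ irreducible_poly f, size f = 3 & p = ('X - a%:P) * f]
  | typeT3 => irreducible_poly p /\ size p = 4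
  | typeM => exists a b, a != b /\ p = ('X - a%:P) * ('X - b%:P) ^+ 2
  | typeN => exists a, p = ('X - a%:P) ^+ 3
  | _ => False
  end.

(** The value [set0] is a placeholder: types with [is_std] false are described by [reg_poly], as
    centralisers of regular matrices. *)
Definition std_alg (s : stype) : set 'M[k]_3 :=
  match s with
  | typeG => setT
  | typeL => @algL k
  | typeJ => @algJ k
  | typeT1 => [set X | is_diag_mx X]
  | typeK0 => @algK0 k
  | typeKinf => @algKinf k
  | _ => set0
  end.

Definition is_std (s : stype) : bool :=
  match s with typeT2 | typeT3 | typeM | typeN => false | _ => true end.

Lemma XsubC3 a : ('X - a%:P) ^+ 3 = ('X - a%:P) * quad (- (a * a)) (a + a).
Proof. by rewrite -mulXX exprS expr2. Qed.

Lemma XsubC12 a b : ('X - a%:P) * ('X - b%:P) ^+ 2 = ('X - a%:P) * quad (- (b * b)) (b + b).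
Proof. by rewrite -mulXX expr2. Qed.

Lemma reg_poly_size s p : reg_poly s p -> size p = 4.
Proof.
case: s => //=.
- move=> [a [f [_ sf ->]]]; rewrite size_proper_mul ?lead_coefXsubC ?mul1r.
    by rewrite size_XsubC sf.
  by rewrite lead_coef_eq0 -size_poly_eq0 sf.
- by move=> [].
- by move=> [a [b [_ ->]]]; rewrite XsubC12 mulXquad size_cub.
- by move=> [a ->]; rewrite XsubC3 mulXquad size_cub.
Qed.

Lemma lie_class_reg s h : ~~ is_std s ->
  lie_class s h <-> exists2 X, reg_poly s (mxminpoly X) & h = centraliser X.
Proof.
case: s => //= _; split.
- by move=> [X [a [f [fI sf E ->]]]]; exists X => //; exists a, f.
- by move=> [X [a [f [fI sf E ->]]]]; exists X, a, f.
- by move=> [X [fI sf ->]]; exists X.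
- by move=> [X [fI sf ->]]; exists X.
- by move=> [X [a [b [ab E ->]]]]; exists X => //; exists a, b.
- by move=> [X [a [b [ab E ->]]]]; exists X, a, b.
- by move=> [X [a [E ->]]]; exists X => //; exists a.
- by move=> [X [a E ->]]; exists X, a.
Qed.

Lemma lie_class_std s h : is_std s ->
  lie_class s h <-> exists2 g, g \in unitmx & h = conjs g (std_alg s).
Proof.
have conjT (g : 'M[k]_3) : g \in unitmx -> conjs g setT = setT.
  by move=> ug; apply/seteqP; split=> // X _; apply/conjsP.
case: s => //= _; try exact: conj_setsP.
- split=> [[X [a [E ->]]]|[g ug ->]].
    have [c ->] : exists c, X = c%:M by apply: size_minpoly_scalar; rewrite E size_XsubC.
    exists 1%:M; rewrite ?unitmx1 // conjs1; apply/seteqP; split=> // Y _.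
    by rewrite /centraliser /= scalar_mxC.
  exists 0%:M, 0; split; first exact: (mxminpoly_cform (inl (inl 0))).
  rewrite conjT //; apply/seteqP; split=> // Y _.
  by rewrite /centraliser /= scalar_mxC.
- split=> [[X [a [b [ab E ->]]]]|[g ug ->]].
    have [x Xx] := cformP X; have := simil_minpoly Xx; rewrite E mxminpoly_cform.
    case: x Xx => [[c|[[c d] /= cd]]|[c|[[c d] e]]] Xx /=.
    + by move/(congr1 (fun p : {poly k} => size p)); rewrite mulXX size_quad size_XsubC.
    + have [g ug ->] := simil_centraliser (simil_sym Xx); rewrite centraliser_L //.
      by exists g.
    + rewrite expr2 !mulXX => /quad_inj[/oppr_inj E1 E2]; case/eqP: ab.
      apply: sqrB_eq0; rewrite (_ : _ ^+ 2 = (a + b) ^+ 2 - 4%:R * (a * b)); last by ring.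
      by rewrite E1 E2; ring.
    + by move/(congr1 (fun p : {poly k} => size p)); rewrite mulXX size_quad size_cub.
  have n01 : (0 : k) != 1 by rewrite eq_sym oner_eq0.
  exists (g *m mx3 0 0 0 0 0 0 0 0 1 *m invmx g), 0, 1; split=> //.
    rewrite -(simil_minpoly (simil_conj _ ug)).
    have := mxminpoly_cform (inl (inr (exist _ (0, 1) n01))).
    by rewrite /= !subr0.
  by rewrite -conjs_centraliser // centraliser_L.
- split=> [[X [a [E ->]]]|[g ug ->]].
    have [x Xx] := cformP X; have := simil_minpoly Xx; rewrite E mxminpoly_cform.
    case: x Xx => [[c|[[c d] /= cd]]|[c|[[c d] e]]] Xx /=.
    + by move/(congr1 (fun p : {poly k} => size p)); rewrite expr2 mulXX size_quad size_XsubC.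
    + rewrite expr2 !mulXX => /quad_inj[/oppr_inj E1 E2]; case/eqP: cd.
      apply: sqrB_eq0; rewrite (_ : _ ^+ 2 = (c + d) ^+ 2 - 4%:R * (c * d)); last by ring.
      by rewrite -E1 -E2; ring.
    + have [g ug ->] := simil_centraliser (simil_sym Xx); rewrite centraliser_J.
      by exists g.
    + by move/(congr1 (fun p : {poly k} => size p)); rewrite expr2 mulXX size_quad size_cub.
  exists (g *m mx3 0 0 1 0 0 0 0 0 0 *m invmx g), 0; split=> //.
    rewrite -(simil_minpoly (simil_conj _ ug)).
    exact: (mxminpoly_cform (inr (inl 0))).
  by rewrite -conjs_centraliser // centraliser_J.
Qed.

End TypeOrbits.

(** * Each type is a single conjugacy orbit *)

Section LieClassOrbits.
Variable k : finFieldType.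
Implicit Types (X Y : 'M[k]_3) (a b c : k) (p q f m : {poly k}) (h : set 'M[k]_3).

Lemma horner_mx_comp X p q : horner_mx X (p \Po q) = horner_mx (horner_mx X q) p.
Proof.
elim/poly_ind: p => [|p c IH]; first by rewrite comp_poly0 !rmorph0.
by rewrite comp_polyD comp_polyM comp_polyX comp_polyC !rmorphD !rmorphM /= IH
  !horner_mx_C horner_mx_X.
Qed.

Lemma minpoly_horner_dvd X p q :
  (mxminpoly (horner_mx X p) %| q) = (mxminpoly X %| q \Po p).
Proof. by rewrite [LHS]dvd_mxminpoly [RHS]dvd_mxminpoly horner_mx_comp. Qed.

Lemma monic_dvd_size p q : p \is monic -> q \is monic -> p %| q ->
  (size q <= size p)%N -> p = q.
Proof.
move=> pm qm pq sz; apply/eqP; rewrite -eqp_monic // -dvdp_size_eqp //.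
by rewrite eqn_leq sz andbT dvdp_leq ?monic_neq0.
Qed.

(** The minimal polynomial of [X] divides that of [p(X)] composed with [p], and composition with a
    polynomial of degree 1 keeps degrees. So the minimal polynomial of [p(X)] has degree at least 3,
    while it divides [m]. *)
Lemma minpoly_affine X u v m : size (mxminpoly X) = 4 -> u != 0 ->
  m \is monic -> size m = 4 -> mxminpoly X %| m \Po (u *: 'X + v%:P) ->
  mxminpoly (horner_mx X (u *: 'X + v%:P)) = m.
Proof.
move=> sX u0 mm sm; set p := u *: 'X + _; rewrite -minpoly_horner_dvd => dv.
apply: monic_dvd_size => //; first exact: mxminpoly_monic.
have sp : size p = 2.
  by rewrite size_polyDl size_scale ?size_polyX // size_polyC; case: (v == 0).
have mn : mxminpoly (horner_mx X p) \is monic by exact: mxminpoly_monic.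
have {dv} dv' : mxminpoly X %| mxminpoly (horner_mx X p) \Po p.
  by rewrite -minpoly_horner_dvd dvdpp.
move: mn dv'; move: (mxminpoly (horner_mx X p)) => n mn /dvdp_leq.
rewrite comp_poly2_eq0 // monic_neq0 // sX size_comp_poly2 // sm.
by apply.
Qed.

Lemma irreducible_root f a : irreducible_poly f -> (2 < size f)%N -> ~~ root f a.
Proof.
move=> fI sf; apply/negP => fa.
have := fI.2 ('X - a%:P); rewrite size_XsubC dvdp_XsubCl => /(_ isT fa) /eqp_size.
by rewrite size_XsubC => E; rewrite -E in sf.
Qed.

Lemma monic_factor a f : ('X - a%:P) * f \is monic -> f \is monic.
Proof. by rewrite !monicE lead_coefM lead_coefXsubC mul1r. Qed.

Lemma comp_poly_sub_dvd p q r : q - r %| (p \Po q) - (p \Po r).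
Proof.
elim/poly_ind: p => [|p c IH]; first by rewrite !comp_poly0 subrr dvdp0.
rewrite !comp_polyD !comp_polyM !comp_polyX !comp_polyC.
rewrite [X in _ %| X](_ : _ = ((p \Po q) - (p \Po r)) * q + (p \Po r) * (q - r)); last by ring.
by apply: dvdp_add; [apply: dvdp_mulr | apply: dvdp_mull].
Qed.

Lemma irreducible_coprime f p : irreducible_poly f -> ~~ (f %| p) -> coprimep f p.
Proof.
move=> fI nfp; apply/negPn/negP => ncop; move/negP: nfp; apply.
by rewrite -(eqp_dvdl _ (fI.2 _ ncop (dvdp_gcdl _ _))) dvdp_gcdr.
Qed.

(** The polynomial [p] has to carry the roots of the first minimal polynomial to those of the
    second. For T2 and T3 it comes from a root of one irreducible factor in the field of the other,
    for M from the affine map with [a -> a'] and [b -> b'], for N from a translation. *)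
Lemma reg_poly_orbit s X Y : reg_poly s (mxminpoly X) -> reg_poly s (mxminpoly Y) ->
  exists p, mxminpoly (horner_mx X p) = mxminpoly Y.
Proof.
move=> rX rY; have [sX sY] := (reg_poly_size rX, reg_poly_size rY).
have mX := mxminpoly_monic X; have mY := mxminpoly_monic Y.
case: s rX rY => //=.
- move=> [a [f [fI sf E]]] [a' [f' [fI' sf' E']]].
  have fm : f \is monic by move: mX; rewrite E => /monic_factor.
  have fm' : f' \is monic by move: mY; rewrite E' => /monic_factor.
  have [p0 fp0] := irreducible_comp_root (conj fI fm) (conj fI' fm') (etrans sf (esym sf')).
  have fa : ~~ root f a by apply: irreducible_root; rewrite ?sf.
  have fa' : ~~ root f' a' by apply: irreducible_root; rewrite ?sf'.
  (* [p] is the Chinese remainder solution of [p = p0 mod f], [p a = a']. *)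
  pose p := p0 + ((a' - p0.[a]) / f.[a])%:P * f.
  have pa : p.[a] = a' by rewrite /p !hornerE divfK // addrC subrK.
  have fp : f %| f' \Po p.
    rewrite -(subrK (f' \Po p0) (f' \Po p)) dvdp_add // (dvdp_trans _ (comp_poly_sub_dvd _ _ _)) //.
    by rewrite /p addrC addKr dvdp_mull.
  exists p; set m := mxminpoly (horner_mx X p).
  have mq : m %| ('X - a'%:P) * f'.
    rewrite minpoly_horner_dvd E comp_polyM dvdp_mul //.
    by rewrite comp_polyB comp_polyX comp_polyC dvdp_XsubCl rootE hornerD hornerN hornerC pa subrr.
  have fXp r : m %| r -> f %| r \Po p.
    by rewrite minpoly_horner_dvd E; apply: dvdp_trans; apply: dvdp_mull.
  have aXp r : m %| r -> 'X - a%:P %| r \Po p.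
    by rewrite minpoly_horner_dvd E; apply: dvdp_trans; apply: dvdp_mulr.
  have mm : m \is monic by exact: mxminpoly_monic.
  clearbody m; rewrite E'.
  (* Otherwise [m] divides [t - a'], so [p] is congruent to [a'] modulo [f], and [f] divides the
     nonzero constant [f'(a')]. *)
  have f'm : f' %| m.
    apply/negPn/negP => /(irreducible_coprime fI') cop.
    have /fXp : m %| 'X - a'%:P by rewrite -(Gauss_dvdpl _ (_ : coprimep m f')) // coprimep_sym.
    rewrite comp_polyB comp_polyX comp_polyC => fpa.
    have : f %| f'.[a']%:P.
      have := dvdp_trans fpa (comp_poly_sub_dvd f' p a'%:P).
      by rewrite comp_polyCr dvdp_subr.
    move=> /dvdp_leq; rewrite polyC_eq0 => /(_ fa'); rewrite sf size_polyC.
    by case: (_ == 0).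
  (* Otherwise [m] divides [f'], and the irreducible quadratic [f'] vanishes at [p(a) = a']. *)
  have am : root m a'.
    apply/negPn/negP; rewrite -dvdp_XsubCl => na.
    have cop : coprimep m ('X - a'%:P).
      by rewrite coprimep_XsubC -dvdp_XsubCl.
    have : m %| f' by rewrite -(Gauss_dvdpr _ cop).
    move=> /aXp.
    by rewrite dvdp_XsubCl root_comp pa (negPf fa').
  rewrite E' in mY; apply/eqP; rewrite -eqp_monic // /eqp mq /= Gauss_dvdp.
    by rewrite dvdp_XsubCl am.
  by rewrite coprimep_sym coprimep_XsubC.
- move=> [fI _] [fI' _].
  have [p fp] := irreducible_comp_root (conj fI mX) (conj fI' mY) (etrans sX (esym sY)).
  exists p; apply/eqP; rewrite -eqp_monic ?mxminpoly_monic //.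
  apply: fI'.2; last by rewrite minpoly_horner_dvd.
  by rewrite size_mxminpoly eqSS -lt0n mxminpoly_nonconstant.
- move=> [a [b [ab E]]] [a' [b' [ab' E']]].
  pose u := (a' - b') / (a - b); pose v := b' - u * b.
  have u0 : u != 0 by rewrite mulf_neq0 ?invr_eq0 ?subr_eq0.
  have ua : u * a + v = a'.
    rewrite /v addrCA -mulrBr /u divfK ?subr_eq0 //; ring.
  have ub : u * b + v = b' by rewrite /v addrC subrK.
  clearbody u v.
  exists (u *: 'X + v%:P); apply: (minpoly_affine sX u0 mY sY).
  rewrite E E' comp_polyM !expr2 !comp_polyM !comp_polyB !comp_polyX !comp_polyC -ua -ub.
  rewrite (_ : u *: 'X + v%:P - (u * a + v)%:P = u%:P * ('X - a%:P)); last first.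
    by rewrite -mul_polyC polyCD polyCM; ring.
  rewrite (_ : u *: 'X + v%:P - (u * b + v)%:P = u%:P * ('X - b%:P)); last first.
    by rewrite -mul_polyC polyCD polyCM; ring.
  by do 2?[apply: dvdp_mul]; apply: dvdp_mull.
- move=> [a E] [a' E'].
  exists (1 *: 'X + (a' - a)%:P); apply: (minpoly_affine sX (oner_neq0 _) mY sY).
  rewrite E E' !exprS expr0 !mulr1 !comp_polyM !comp_polyB !comp_polyX !comp_polyC.
  by rewrite (_ : _ - a'%:P = 'X - a%:P) // scale1r polyCB; ring.
Qed.

End LieClassOrbits.

Definition mul01E := (mul0r, mulr0, mul1r, mulr1, @add0r, @addr0, @oppr0).

(** * Invariants separating the ten types *)

Section LieClassDisjoint.
Variable k : finFieldType.
Implicit Types (X Y V : 'M[k]_3) (a b c : k) (p q f m : {poly k}) (h : set 'M[k]_3).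

Lemma lie_class_conjs s h (g : 'M[k]_3) : g \in unitmx -> lie_class s h ->
  lie_class s (conjs g h).
Proof.
move=> ug; have [st|nst] := boolP (is_std s).
  move=> /(lie_class_std _ st)[g' ug' ->]; apply/lie_class_std => //.
  by exists (g *m g'); rewrite ?unitmx_mul ?ug // conjs_comp.
move=> /(lie_class_reg _ nst)[X rX ->]; apply/lie_class_reg => //.
exists (g *m X *m invmx g); last exact: conjs_centraliser.
by rewrite -(simil_minpoly (simil_conj _ ug)).
Qed.

Lemma conjsK h (g : 'M[k]_3) : g \in unitmx -> conjs (invmx g) (conjs g h) = h.
Proof. by move=> ug; rewrite conjs_comp ?unitmx_inv // mulVmx // conjs1. Qed.

Lemma lie_class_orbit s h h' : lie_class s h -> lie_class s h' ->
  exists2 g, g \in unitmx & h' = conjs g h.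
Proof.
have [st|nst] := boolP (is_std s).
  move=> /(lie_class_std _ st)[g ug ->] /(lie_class_std _ st)[g' ug' ->].
  exists (g' *m invmx g); first by rewrite unitmx_mul ug' unitmx_inv.
  by rewrite -conjs_comp ?unitmx_inv ?conjsK // unitmx_mul ug' unitmx_inv.
move=> /(lie_class_reg _ nst)[X rX ->] /(lie_class_reg _ nst)[Y rY ->].
have [p] := reg_poly_orbit rX rY.
exact: centraliser_conj_of_poly (reg_poly_size rX) (reg_poly_size rY).
Qed.

Lemma diag_mx3 X : is_diag_mx X <-> exists a b c, X = mx3 a 0 0 0 b 0 0 0 c.
Proof.
split=> [/is_diag_mxP dX|[a [b [c ->]]]]; last first.
  by apply/is_diag_mxP; apply: ord3P; apply: ord3P; rewrite !mxE.
exists (X o0 o0), (X o1 o1), (X o2 o2); rewrite {1}(mx3_eta X).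
by rewrite (dX o0 o1) // (dX o0 o2) // (dX o1 o0) // (dX o1 o2) // (dX o2 o0) // (dX o2 o1).
Qed.

Lemma elem_mxE : (elem_mx k 1 3 = mx3 0 0 1 0 0 0 0 0 0) *
  (elem_mx k 2 3 = mx3 0 0 0 0 0 1 0 0 0) * (elem_mx k 2 1 = mx3 0 0 0 1 0 0 0 0 0).
Proof.
rewrite /elem_mx; have -> : inord 1.-1 = o0 by apply/val_inj; rewrite /= inordK.
have -> : inord 2.-1 = o1 by apply/val_inj; rewrite /= inordK.
have -> : inord 3.-1 = o2 by apply/val_inj; rewrite /= inordK.
by do !split; apply/matrixP; apply: ord3P; apply: ord3P; rewrite !mxE.
Qed.

Lemma algK0E X : algK0 X <-> exists t s u, X = mx3 t 0 s 0 t u 0 0 t.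
Proof.
split=> -[t [s [u ->]]]; exists t, s, u; rewrite !elem_mxE !mx3E; apply: mx3_eq; ring.
Qed.

Lemma algKinfE X : algKinf X <-> exists t s u, X = mx3 t 0 0 s t u 0 0 t.
Proof.
split=> -[t [s [u ->]]]; exists t, s, u; rewrite !elem_mxE !mx3E; apply: mx3_eq; ring.
Qed.

(* Conjugation invariants that separate the ten classes; the fourth one says that
   [h] is diagonalisable over [k]. *)
Definition feat (i : nat) h : Prop :=
  match i with
  | 0 => forall X Y, h X -> h Y -> X *m Y = Y *m X
  | 1 => exists X, [/\ h X, X != 0, X *m X = 0 & forall Y, h Y -> X *m Y = Y *m X]
  | 2 => exists X, [/\ h X, X != 0, X != 1%:M, X *m X = X & forall Y, h Y -> X *m Y = Y *m X]
  | 3 => forall X, h X -> X ^+ #|k| = X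
  | 4 => exists X, [/\ h X, X *m X != 0 & X *m X *m X = 0]
  | _ => forall X Y V, h X -> h Y -> X != 0 -> X *m X = 0 -> Y *m Y = 0 ->
           V *m X = 0 -> V *m Y = 0
  end.

(** [None] marks an undecided entry. Any two rows have opposite decided entries in some column,
    which is what [lie_class_inj] exploits. *)
Definition feat_table (s : stype) (i : nat) : option bool :=
  match s, i with
  | (typeG | typeL | typeJ), 0 => Some false
  | _, 0 => Some true
  | (typeJ | typeM | typeN | typeK0 | typeKinf), 1 => Some true
  | _, 1 => Some false
  | (typeL | typeT1 | typeT2 | typeM), 2 => Some true
  | typeJ, 2 => None
  | _, 2 => Some false
  | typeT1, 3 => Some true
  | typeT2, 3 => Some false
  | typeN, 4 => Some true
  | (typeK0 | typeKinf), 4 => Some false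
  | typeK0, 5 => Some false
  | typeKinf, 5 => Some true
  | _, _ => None
  end.

Lemma feat_conjs i h (g : 'M[k]_3) : g \in unitmx -> feat i h -> feat i (conjs g h).
Proof.
move=> ug; have c0 X : (g *m X *m invmx g == 0) = (X == 0).
  apply/eqP/eqP => [E|->]; last by rewrite mulmx0 mul0mx.
  have := congr1 (fun M => invmx g *m M *m g) E.
  by rewrite !mulmxA mulVmx // mul1mx mulmxKV // mulmx0 mul0mx.
have inj X Y : g *m X *m invmx g = g *m Y *m invmx g -> X = Y.
  by move=> E; apply/eqP; rewrite -subr_eq0 -c0 mulmxBr mulmxBl E subrr eqxx.
case: i => [|[|[|[|[|i]]]]] /=.
- by move=> cm _ _ [X hX <-] [Y hY <-]; rewrite !conjs_mulK // (cm X Y).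
- move=> [X [hX X0 XX Xc]]; exists (g *m X *m invmx g); split.
  + by exists X.
  + by rewrite c0.
  + by rewrite conjs_mulK // XX mulmx0 mul0mx.
  + by move=> _ [Y hY <-]; rewrite !conjs_mulK // (Xc Y).
- move=> [X [hX X0 X1 XX Xc]]; exists (g *m X *m invmx g); split.
  + by exists X.
  + by rewrite c0.
  + apply: contra X1 => /eqP E; apply/eqP/inj; rewrite E mulmx1 mulmxV //.
  + by rewrite conjs_mulK // XX.
  + by move=> _ [Y hY <-]; rewrite !conjs_mulK // (Xc Y).
- move=> sp _ [X hX <-]; have {2}<- := sp _ hX.
  elim: #|k| => [|n IH]; first by rewrite !expr0 mulmx1 mulmxV.
  by rewrite exprS [X ^+ _]exprS IH -!mulmxE conjs_mulK.
- move=> [X [hX X0 XX]]; exists (g *m X *m invmx g); split.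
  + by exists X.
  + by rewrite conjs_mulK // c0.
  + by rewrite !conjs_mulK // XX mulmx0 mul0mx.
- move=> ker _ _ V [X hX <-] [Y hY <-]; rewrite c0 !conjs_mulK // => X0 /eqP; rewrite c0 => /eqP XX.
  move=> /eqP; rewrite c0 => /eqP YY.
  have tr Z : V *m (g *m Z *m invmx g) = 0 <-> (V *m g) *m Z = 0.
    rewrite !mulmxA; split=> [E|->]; last by rewrite mul0mx.
    by rewrite -[LHS](mulmxK (_ : invmx g \in unitmx)) ?unitmx_inv // E mul0mx.
  by move=> /tr E; apply/tr; apply: (ker X Y).
Qed.

Lemma feat_conjsE i h (g : 'M[k]_3) : g \in unitmx -> feat i (conjs g h) <-> feat i h.
Proof.
move=> ug; split; last exact: feat_conjs.
by move=> /(feat_conjs (g := invmx g)); rewrite unitmx_inv conjsK // => /(_ ug).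
Qed.

Lemma irreducible_dvd_sqr f p : irreducible_poly f -> f %| p * p -> f %| p.
Proof.
move=> fI fpp; apply/negPn/negP => nfp; move: (fpp).
by rewrite (Gauss_dvdpr _ (irreducible_coprime fI nfp)) (negPf nfp).
Qed.

Lemma mx_neq (i j : 'I_3) X Y : X i j != Y i j -> X != Y.
Proof. by apply: contra => /eqP ->. Qed.

Lemma mulff_eq0 (x : k) : x * x = 0 -> x = 0.
Proof. by move/eqP; rewrite mulf_eq0 orbb => /eqP. Qed.

Lemma mulff_id (x : k) : x * x = x -> x = 0 \/ x = 1.
Proof.
move=> E; have /eqP : x * (x - 1) = 0 by rewrite mulrBr mulr1 E subrr.
by rewrite mulf_eq0 subr_eq0 => /orP[/eqP|/eqP]; [left|right].
Qed.

Lemma featG i (b : bool) : feat_table typeG i = Some b -> feat i [set: 'M[k]_3] <-> b.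
Proof.
have n1 : (1 : k) != 0 by rewrite oner_eq0.
case: i => [|[|[|[|[|i]]]]] //= [<-]; split=> //.
- move=> /(_ (mx3 0 1 0 0 0 0 0 0 0) (mx3 0 0 0 1 0 0 0 0 0) I I).
  by rewrite !mx3E => /mx3_inj[[]]; rewrite !mul01E => /eqP; rewrite (negPf n1).
- move=> [X [_ X0 XX Xc]].
  have /central_scalar/is_scalar_mxP[a aE] : forall Y, Y *m X = X *m Y by move=> Y; rewrite Xc.
  move: XX X0; rewrite aE !mx3E => /mx3_inj[[]]; rewrite !mul01E => /mulff_eq0 ->.
  by rewrite eqxx.
- move=> [X [_ X0 X1 XX Xc]].
  have /central_scalar/is_scalar_mxP[a aE] : forall Y, Y *m X = X *m Y by move=> Y; rewrite Xc.
  move: XX X0 X1; rewrite aE !mx3E => /mx3_inj[[]]; rewrite !mul01E => /mulff_id[] ->.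
    by rewrite eqxx.
  by rewrite eqxx.
Qed.

Lemma featL i (b : bool) : feat_table typeL i = Some b -> feat i (@algL k) <-> b.
Proof.
have n1 : (1 : k) != 0 by rewrite oner_eq0.
have h01 : algL (mx3 0 1 0 0 0 0 0 0 (0 : k)) by do 5!eexists.
have h10 : algL (mx3 0 0 0 1 0 0 0 0 (0 : k)) by do 5!eexists.
have h22 : algL (mx3 0 0 0 0 0 0 0 0 (1 : k)) by do 5!eexists.
case: i => [|[|[|[|[|i]]]]] //= [<-]; split=> //.
- move=> /(_ _ _ h01 h10).
  by rewrite !mx3E => /mx3_inj[[]]; rewrite !mul01E => /eqP; rewrite (negPf n1).
- move=> [X [[a [b' [c [d [e ->]]]]] X0 + Xc]]; move: (Xc _ h01) (Xc _ h10) X0.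
  rewrite !mx3E => /mx3_inj[[E1 E2 _] _] /mx3_inj[[E3 _ _] _] X0 /mx3_inj[[+ _ _] [_ [_ _ +]]].
  move: E1 E2 E3 X0; rewrite !mul01E => <- -> ->; rewrite !mul01E => X0.
  by move=> /mulff_eq0 d0 /mulff_eq0 e0; move: X0; rewrite d0 e0 eqxx.
- move=> _; exists (mx3 0 0 0 0 0 0 0 0 1); split=> //.
  + by apply: (mx_neq (i := o2) (j := o2)); rewrite !mxE.
  + by apply: (mx_neq (i := o0) (j := o0)); rewrite !mxE eq_sym.
  + by rewrite !mx3E; apply: mx3_eq; ring.
  + by move=> _ [a [b' [c [d [e ->]]]]]; rewrite !mx3E; apply: mx3_eq; ring.
Qed.

Lemma featJ i (b : bool) : feat_table typeJ i = Some b -> feat i (@algJ k) <-> b.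
Proof.
have n1 : (1 : k) != 0 by rewrite oner_eq0.
have h01 : algJ (mx3 0 1 0 0 0 0 0 0 (0 : k)) by do 5!eexists.
have h11 : algJ (mx3 0 0 0 0 1 0 0 0 (0 : k)) by do 5!eexists.
case: i => [|[|[|[|[|i]]]]] //= [<-]; split=> //.
- move=> /(_ _ _ h01 h11).
  by rewrite !mx3E => /mx3_inj[[_]]; rewrite !mul01E => /eqP; rewrite (negPf n1).
- move=> _; exists (mx3 0 0 1 0 0 0 0 0 0); split=> //.
  + by do 5!eexists.
  + by apply: (mx_neq (i := o0) (j := o2)); rewrite !mxE.
  + by rewrite !mx3E; apply: mx3_eq; ring.
  + by move=> _ [a [b' [c [d [e ->]]]]]; rewrite !mx3E; apply: mx3_eq; ring.
Qed.

Lemma mx3_diagX (a b c : k) n :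
  mx3 a 0 0 0 b 0 0 0 c ^+ n = mx3 (a ^+ n) 0 0 0 (b ^+ n) 0 0 0 (c ^+ n).
Proof.
elim: n => [|n IH]; first by rewrite !expr0 -mx3_scalar.
by rewrite !exprS IH -mulmxE mx3M !mul01E.
Qed.

Lemma featT1 i (b : bool) : feat_table typeT1 i = Some b -> feat i [set X : 'M[k]_3 | is_diag_mx X] <-> b.
Proof.
have n1 : (1 : k) != 0 by rewrite oner_eq0.
case: i => [|[|[|[|[|i]]]]] //= [<-]; split=> //.
- move=> _ X Y /diag_mx3[a [b' [c ->]]] /diag_mx3[a1 [b1 [c1 ->]]].
  by rewrite !mx3E; apply: mx3_eq; ring.
- move=> [X [/diag_mx3[a [b' [c ->]]] X0 + _]]; move: X0.
  rewrite !mx3E => X0 /mx3_inj[[+ _ _] [[_ + _] [_ _ +]]]; move: X0; rewrite !mul01E.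
  by move=> X0 /mulff_eq0 a0 /mulff_eq0 b0 /mulff_eq0 c0; move: X0; rewrite a0 b0 c0 eqxx.
- move=> _; exists (mx3 0 0 0 0 0 0 0 0 1); split=> //.
  + by apply/diag_mx3; do 3!eexists.
  + by apply: (mx_neq (i := o2) (j := o2)); rewrite !mxE.
  + by apply: (mx_neq (i := o0) (j := o0)); rewrite !mxE eq_sym.
  + by rewrite !mx3E; apply: mx3_eq; ring.
  + by move=> _ /diag_mx3[a [b' [c ->]]]; rewrite !mx3E; apply: mx3_eq; ring.
- by move=> _ X /diag_mx3[a [b' [c ->]]]; rewrite mx3_diagX !expf_card.
Qed.

Lemma featK0 i (b : bool) : feat_table typeK0 i = Some b -> feat i (@algK0 k) <-> b.
Proof.
have n1 : (1 : k) != 0 by rewrite oner_eq0.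
have h02 : algK0 (mx3 0 0 1 0 0 0 0 0 (0 : k)) by apply/algK0E; do 3!eexists.
have h12 : algK0 (mx3 0 0 0 0 0 1 0 0 (0 : k)) by apply/algK0E; do 3!eexists.
case: i => [|[|[|[|[|[|i]]]]]] //= [<-]; split=> //.
- move=> _ X Y /algK0E[a [b' [c ->]]] /algK0E[a1 [b1 [c1 ->]]].
  by rewrite !mx3E; apply: mx3_eq; ring.
- move=> _; exists (mx3 0 0 1 0 0 0 0 0 0); split=> //.
  + by apply: (mx_neq (i := o0) (j := o2)); rewrite !mxE.
  + by rewrite !mx3E; apply: mx3_eq; ring.
  + by move=> _ /algK0E[a [b' [c ->]]]; rewrite !mx3E; apply: mx3_eq; ring.
- move=> [X [/algK0E[t [s [u ->]]] X0 X1 + _]]; move: X0 X1.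
  rewrite !mx3E !mul01E => X0 X1 /mx3_inj[[+ _ Es] [[_ _ Eu] _]].
  move=> /mulff_id[t0|t1]; first by move: Es Eu X0; rewrite t0 !mul01E => <- <-; rewrite eqxx.
  move: Es Eu X1; rewrite t1 !mul01E => /eqP; rewrite -subr_eq0 addrK => /eqP ->.
  by move=> /eqP; rewrite -subr_eq0 addrK => /eqP ->; rewrite eqxx.
- move=> [X [/algK0E[t [s [u ->]]]]]; rewrite !mx3E !mul01E => XX /mx3_inj[[/eqP + _ _] _].
  rewrite !mulf_eq0 !orbb => /eqP t0; move: XX; rewrite t0 !mul01E; rewrite eqxx //.
(* $E_{12}$ annihilates $E_{13}$ from the left but not $E_{23}$, and both are square-zero elements
   of the algebra. *)
- move=> ker; have : mx3 0 1 0 0 0 0 0 0 0 *m mx3 0 0 0 0 0 1 0 0 (0 : k) = 0.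
    apply: (ker _ _ _ h02 h12).
    + by apply: (mx_neq (i := o0) (j := o2)); rewrite !mxE.
    + by rewrite !mx3E; apply: mx3_eq; ring.
    + by rewrite !mx3E; apply: mx3_eq; ring.
    + by rewrite !mx3E; apply: mx3_eq; ring.
  by rewrite !mx3E => /mx3_inj[[_ _]]; rewrite !mul01E => /eqP; rewrite (negPf n1).
Qed.

(** For the last feature: a square-zero element is the second unit column times a row [(s, 0, u)].
    If nonzero, it is annihilated from the left exactly by the matrices with zero second column. *)
Lemma featKinf i (b : bool) : feat_table typeKinf i = Some b -> feat i (@algKinf k) <-> b.
Proof.
have n1 : (1 : k) != 0 by rewrite oner_eq0.
have h12 : algKinf (mx3 0 0 0 0 0 1 0 0 (0 : k)) by apply/algKinfE; do 3!eexists.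
case: i => [|[|[|[|[|i]]]]] //=.
- case=> <-; split=> // _ X Y /algKinfE[a [b' [c ->]]] /algKinfE[a1 [b1 [c1 ->]]].
  by rewrite !mx3E; apply: mx3_eq; ring.
- case=> <-; split=> // _; exists (mx3 0 0 0 0 0 1 0 0 0); split=> //.
  + by apply: (mx_neq (i := o1) (j := o2)); rewrite !mxE.
  + by rewrite !mx3E; apply: mx3_eq; ring.
  + by move=> _ /algKinfE[a [b' [c ->]]]; rewrite !mx3E; apply: mx3_eq; ring.
- case=> <-; split=> // -[X [/algKinfE[t [s [u ->]]] X0 X1 + _]]; move: X0 X1.
  rewrite !mx3E !mul01E => X0 X1 /mx3_inj[[+ _ _] [[Es _ Eu] _]].
  move=> /mulff_id[t0|t1]; first by move: Es Eu X0; rewrite t0 !mul01E => <- <-; rewrite eqxx.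
  move: Es Eu X1; rewrite t1 !mul01E => /eqP; rewrite -subr_eq0 addrK => /eqP ->.
  by move=> /eqP; rewrite -subr_eq0 addrK => /eqP ->; rewrite eqxx.
- case=> <-; split=> // -[X [/algKinfE[t [s [u ->]]]]]; rewrite !mx3E !mul01E => XX /mx3_inj[[/eqP + _ _] _].
  rewrite !mulf_eq0 !orbb => /eqP t0; move: XX; rewrite t0 !mul01E; rewrite eqxx //.
- case: i => [|//] [<-]; split=> // _ X Y V /algKinfE[t [s [u ->]]] /algKinfE[t' [s' [u' ->]]].
  rewrite [V]mx3_eta; move: (V o0 o0) (V o0 o1) (V o0 o2) (V o1 o0) (V o1 o1) (V o1 o2)
    (V o2 o0) (V o2 o1) (V o2 o2) => v00 v01 v02 v10 v11 v12 v20 v21 v22.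
  rewrite !mx3E !mul01E => X0 /mx3_inj[[/mulff_eq0 t0 _ _] _] /mx3_inj[[/mulff_eq0 t'0 _ _] _].
  move: X0; rewrite t0 t'0 !mul01E => X0 /mx3_inj[[E1 _ E2] [[E3 _ E4] [E5 _ E6]]].
  have h0 v : v * s = 0 -> v * u = 0 -> v = 0.
    move=> /eqP; rewrite mulf_eq0 => /orP[/eqP-> //|/eqP s0] /eqP.
    rewrite mulf_eq0 => /orP[/eqP-> //|/eqP u0].
    by move: X0; rewrite s0 u0 eqxx.
  by rewrite (h0 _ E1 E2) (h0 _ E3 E4) (h0 _ E5 E6) !mul01E.
Qed.

(** * Invariants of [k[X]] read off the minimal polynomial of [X] *)

Section Regular.
Variable X : 'M[k]_3.
Hypothesis sX : size (mxminpoly X) = 4.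
Local Notation m := (mxminpoly X).
Local Notation "p ^X" := (horner_mx X p) (at level 2, format "p ^X").

Lemma horner_eq0 p : (p^X == 0) = (m %| p).
Proof. by rewrite dvd_mxminpoly. Qed.

Lemma reg_comm : feat 0 (centraliser X).
Proof.
move=> Y Z /(centraliser_horner _ sX)[p ->] /(centraliser_horner _ sX)[q ->].
by rewrite !mulmxE -!rmorphM mulrC.
Qed.

Lemma reg_nilF : (forall p, m %| p ^+ 2 -> m %| p) -> ~ feat 1 (centraliser X).
Proof.
move=> sqf [Y [/(centraliser_horner _ sX)[p ->] Y0 YY _]].
by move/negP: Y0; apply; rewrite horner_eq0 sqf // -horner_eq0 expr2 rmorphM /= -mulmxE YY.
Qed.

Lemma reg_nilT p : m %| p ^+ 2 -> ~~ (m %| p) -> feat 1 (centraliser X).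
Proof.
move=> mp nmp; exists (p^X); split.
- by apply/(centraliser_horner _ sX); exists p.
- by rewrite horner_eq0.
- by apply/eqP; rewrite mulmxE -rmorphM horner_eq0 -expr2.
- by move=> Y hY; apply: reg_comm => //; apply/(centraliser_horner _ sX); exists p.
Qed.

Lemma reg_idemF : (forall p, m %| p * (p - 1) -> (m %| p) || (m %| p - 1)) ->
  ~ feat 2 (centraliser X).
Proof.
move=> idf [Y [/(centraliser_horner _ sX)[p ->] Y0 Y1 YY _]].
have /idf : m %| p * (p - 1).
  by rewrite -horner_eq0 mulrBr mulr1 rmorphB rmorphM /= -mulmxE YY subrr.
rewrite -!horner_eq0 (negPf Y0) rmorphB rmorph1 subr_eq0 /=.
by move: Y1 => /negPf ->.
Qed.

(** The idempotent comes from the Chinese remainder theorem: if [u f + v p = 1], then [u f] is 0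
    modulo [f] and 1 modulo [p]. *)
Lemma reg_idemT f p : coprimep f p -> m = f * p -> (1 < size f)%N -> (1 < size p)%N ->
  feat 2 (centraliser X).
Proof.
move=> /Bezout_eq1_coprimepP[[u v] /= E] mE sf sp.
have big q r : (1 < size q)%N -> q %| r -> q %| 1 - r -> False.
  move=> sq qr; rewrite dvdp_subl // => /dvdp_leq; rewrite oner_eq0 size_poly1 => /(_ isT).
  by rewrite leqNgt sq.
exists ((u * f)^X); split.
- by apply/(centraliser_horner _ sX); eexists.
- rewrite horner_eq0 mE; apply/negP => d; apply: (big p (u * f)) => //.
    by apply: dvdp_trans d; apply: dvdp_mull.
  by rewrite -E addrC addKr dvdp_mull.
- have -> : 1%:M = horner_mx X 1 by rewrite !rmorph1.
  rewrite -subr_eq0 -rmorphB horner_eq0 mE; apply/negP => d.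
  apply: (big f (u * f)) => //; first exact: dvdp_mull.
  by rewrite -opprB dvdpNr; apply: dvdp_trans d; apply: dvdp_mulr.
- apply/eqP; rewrite mulmxE -rmorphM -subr_eq0 -rmorphB horner_eq0 mE.
  rewrite (_ : _ - _ = f * p * (- u * v)); first by apply: dvdp_mulr.
  have E' : v * p = 1 - u * f by rewrite -E addrC addKr.
  rewrite (_ : f * p * _ = - (u * f) * (v * p)); last by ring.
  by rewrite E'; ring.
- by move=> Y hY; apply: reg_comm => //; apply/(centraliser_horner _ sX); eexists.
Qed.

(** If [X ^+ #|k| = X], the minimal polynomial divides $t^q - t$, a product of linear factors, and
    has no irreducible factor of degree above 1. *)
Lemma reg_splitF f : (2 < size f)%N -> irreducible_poly f -> f %| m -> ~ feat 3 (centraliser X).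
Proof.
move=> sf fI fm sp; have : m %| 'X^#|k| - 'X.
  rewrite -horner_eq0 rmorphB rmorphXn /= horner_mx_X subr_eq0; apply/eqP/sp.
  by apply/(centraliser_horner _ sX); exists 'X; rewrite horner_mx_X.
rewrite finField_genPoly => /(dvdp_trans fm)/dvdp_prod_XsubC[s].
case: (mask _ _) => [|a r] fE.
  by move: (eqp_size fE); rewrite big_nil size_poly1 => E; rewrite E in sf.
have /negP[] := irreducible_root a fI sf.
by rewrite (eqp_root fE) big_cons rootM root_XsubC eqxx.
Qed.

End Regular.

Lemma lie_class_feat s h i (b : bool) : lie_class s h -> feat_table s i = Some b -> feat i h <-> b.
Proof.
have [st|nst] := boolP (is_std s).
  move=> /(lie_class_std _ st)[g ug ->] E; rewrite feat_conjsE //.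
  by case: s st E => //= _; [apply: featG|apply: featL|apply: featJ|apply: featT1|apply: featK0|apply: featKinf].
move=> /(lie_class_reg _ nst)[X rX ->]; have sX := reg_poly_size rX.
have mX := mxminpoly_monic X.
case: s nst rX => //= _.
- move=> [a [f [fI sf mE]]].
  have fa : ~~ root f a by apply: irreducible_root; rewrite ?sf.
  have cop : coprimep ('X - a%:P) f by rewrite coprimep_sym coprimep_XsubC.
  case: i => [|[|[|[|[|i]]]]] //= [<-]; split=> //; try by move=> _; exact: reg_comm.
  + suff: ~ feat 1 (centraliser X) by move=> /[apply].
    by apply: reg_nilF => // p; rewrite mE !Gauss_dvdp // expr2 => /andP[+ /(irreducible_dvd_sqr fI) ->];
      rewrite !dvdp_XsubCl rootM orbb => ->.
  + by move=> _; apply: (reg_idemT sX cop mE); rewrite ?size_XsubC ?sf.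
  + suff: ~ feat 3 (centraliser X) by move=> /[apply].
    by apply: (reg_splitF sX _ fI); rewrite ?sf // mE dvdp_mull.
- move=> [mI _]; case: i => [|[|[|[|[|i]]]]] //= [<-]; split=> //; try by move=> _; exact: reg_comm.
  + suff: ~ feat 1 (centraliser X) by move=> /[apply].
    by apply: reg_nilF => // p; rewrite expr2; apply: irreducible_dvd_sqr.
  + suff: ~ feat 2 (centraliser X) by move=> /[apply].
    apply: reg_idemF => // p mp; have [//|/(irreducible_coprime mI) cop] := boolP (_ %| p).
    by rewrite -(Gauss_dvdpr _ cop) mp.
- move=> [a [b' [ab mE]]]; case: i => [|[|[|[|[|i]]]]] //= [<-]; split=> //; try by move=> _; exact: reg_comm.
  + move=> _; apply: (@reg_nilT _ sX (('X - a%:P) * ('X - b'%:P))).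
      by rewrite mE exprMn expr2 -mulrA dvdp_mull.
    rewrite mE; apply/negP => /dvdp_leq; rewrite mulXX XsubC12 mulXquad size_cub size_quad.
    by move=> /(_ (monic_neq0 (quad_monic _ _))).
  + move=> _; apply: (reg_idemT sX _ mE); rewrite ?size_XsubC //.
      by rewrite coprimep_expr // coprimep_XsubC root_XsubC eq_sym.
    by rewrite expr2 mulXX size_quad.
- move=> [a mE]; case: i => [|[|[|[|[|i]]]]] //= [<-]; split=> //; try by move=> _; exact: reg_comm.
  + move=> _; apply: (@reg_nilT _ sX (('X - a%:P) ^+ 2)).
      by rewrite mE -exprM dvdp_exp2l.
    rewrite mE; apply/negP => /dvdp_leq; rewrite expr2 mulXX XsubC3 mulXquad size_cub size_quad.
    by move=> /(_ (monic_neq0 (quad_monic _ _))).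
  + suff: ~ feat 2 (centraliser X) by move=> /[apply].
    apply: reg_idemF => // p; rewrite mE => mp.
    have [pa|npa] := boolP (root p a).
      have cop : coprimep (('X - a%:P) ^+ 3) (p - 1).
        rewrite coprimep_expl // coprimep_sym coprimep_XsubC rootE hornerD hornerN hornerC.
        by move: pa; rewrite rootE => /eqP ->; rewrite sub0r oppr_eq0 oner_eq0.
      by rewrite -(Gauss_dvdpl p cop) mp.
    have cop : coprimep (('X - a%:P) ^+ 3) p.
      by rewrite coprimep_expl // coprimep_sym coprimep_XsubC.
    by rewrite -(Gauss_dvdpr (p - 1) cop) mp orbT.
  + move=> _; exists (horner_mx X ('X - a%:P)); split.
    * by apply/(centraliser_horner _ sX); eexists.
    * rewrite mulmxE -rmorphM horner_eq0 // mE; apply/negP => /dvdp_leq.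
      rewrite mulXX XsubC3 mulXquad size_cub size_quad.
      by move=> /(_ (monic_neq0 (quad_monic _ _))).
    * by apply/eqP; rewrite !mulmxE -!rmorphM horner_eq0 // mE exprSr expr2.
Qed.

Lemma lie_class_inj s t h : lie_class s h -> lie_class t h -> s = t.
Proof.
move=> hs ht.
have tab i (b : bool) : feat_table s i = Some b -> feat_table t i = Some (~~ b) -> False.
  move=> /(lie_class_feat hs) Es /(lie_class_feat ht) Et.
  by case: b Es Et => -[h1 h2] [h3 h4]; [have := h3 (h2 isT)|have := h1 (h4 isT)].
move: tab; clear hs ht; case: s; case: t => // tab; exfalso;
  first [exact: (tab 0%N _ erefl erefl) | exact: (tab 1%N _ erefl erefl) |
    exact: (tab 2%N _ erefl erefl) | exact: (tab 3%N _ erefl erefl) |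
    exact: (tab 4%N _ erefl erefl) | exact: (tab 5%N _ erefl erefl)].
Qed.

End LieClassDisjoint.

(** * Derivations of the ten algebras *)

Section Inner.
Variable k : finFieldType.
Implicit Types (X Y V : 'M[k]_3) (h : set 'M[k]_3).

Lemma alt_expand4 h D x1 x2 x3 x4 (c a1 a2 a3 a4 c' b1 b2 b3 b4 : k) :
  alt_deriv h D -> subalg h -> h x1 -> h x2 -> h x3 -> h x4 ->
  \tr (D (c%:M + (a1 *: x1 + (a2 *: x2 + (a3 *: x3 + a4 *: x4)))) *m
       (c'%:M + (b1 *: x1 + (b2 *: x2 + (b3 *: x3 + b4 *: x4))))) =
  (a1 * b2 - a2 * b1) * \tr (D x1 *m x2) + (a1 * b3 - a3 * b1) * \tr (D x1 *m x3) +
  (a1 * b4 - a4 * b1) * \tr (D x1 *m x4) + (a2 * b3 - a3 * b2) * \tr (D x2 *m x3) +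
  (a2 * b4 - a4 * b2) * \tr (D x2 *m x4) + (a3 * b4 - a4 * b3) * \tr (D x3 *m x4).
Proof.
move=> hD ha h1 h2 h3 h4; have [[_ hDD hZ] h1' _] := ha.
have hs c0 : h c0%:M by rewrite -scalemx1; apply: hZ.
have [hZ1 hZ2 hZ3 hZ4] := And4 (hZ a1 _ h1) (hZ a2 _ h2) (hZ a3 _ h3) (hZ a4 _ h4).
have h34 := hDD _ _ hZ3 hZ4; have h234 := hDD _ _ hZ2 h34; have h1234 := hDD _ _ hZ1 h234.
have hsum := hDD _ _ (hs c) h1234.
rewrite altDr (alt1r hD ha) // add0r 3!altDr !altZr.
have E w : h w -> \tr (D (c%:M + (a1 *: x1 + (a2 *: x2 + (a3 *: x3 + a4 *: x4)))) *m w) =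
    a1 * \tr (D x1 *m w) + a2 * \tr (D x2 *m w) + a3 * \tr (D x3 *m w) + a4 * \tr (D x4 *m w).
  by move=> hw; rewrite !(altD hD) // (alt1 hD ha) // !(altZ hD) //; ring.
have [_ _ alt _] := hD.
rewrite !E // (alt _ h1) (alt _ h2) (alt _ h3) (alt _ h4).
rewrite (altC hD ha h2 h1) (altC hD ha h3 h1) (altC hD ha h4 h1) (altC hD ha h3 h2).
by rewrite (altC hD ha h4 h2) (altC hD ha h4 h3); ring.
Qed.

Definition inner_alg h : Prop := forall D, alt_deriv h D -> inner_for h D.

(** The algebra is $\mathfrak{gl}_2 \times k$. The Leibniz rule for [e11 *m e11], [e11 *m e12] and
    [e21 *m e11] kills the pairings with [e33]. On $\mathfrak{gl}_2$ modulo scalars an alternating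
    form has three values, and inner derivations attain all of them. *)
Lemma inner_algL : inner_alg (@algL k).
Proof.
move=> D hD; have ha : subalg (@algL k).
  have n01 : (0 : k) != 1 by rewrite eq_sym oner_eq0.
  by have <- := centraliser_L n01; exact: subalg_centraliser.
pose e11 : 'M[k]_3 := mx3 1 0 0 0 0 0 0 0 0; pose e12 : 'M[k]_3 := mx3 0 1 0 0 0 0 0 0 0.
pose e21 : 'M[k]_3 := mx3 0 0 0 1 0 0 0 0 0; pose e33 : 'M[k]_3 := mx3 0 0 0 0 0 0 0 0 1.
have h11 : algL e11 by do 5!eexists. have h12 : algL e12 by do 5!eexists.
have h21 : algL e21 by do 5!eexists. have h33 : algL e33 by do 5!eexists.
have z1 : e11 *m e33 = 0 by rewrite /e11 /e33 !mx3E; apply: mx3_eq; ring.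
have z2 : e33 *m e11 = 0 by rewrite /e33 /e11 !mx3E; apply: mx3_eq; ring.
have z3 : e12 *m e33 = 0 by rewrite /e12 /e33 !mx3E; apply: mx3_eq; ring.
have z6 : e33 *m e21 = 0 by rewrite /e33 /e21 !mx3E; apply: mx3_eq; ring.
have i1 : e11 *m e11 = e11 by rewrite /e11 !mx3E; apply: mx3_eq; ring.
have i2 : e11 *m e12 = e12 by rewrite /e11 /e12 !mx3E; apply: mx3_eq; ring.
have i3 : e21 *m e11 = e21 by rewrite /e11 /e21 !mx3E; apply: mx3_eq; ring.
have B1 : \tr (D e11 *m e33) = 0.
  by rewrite -i1 (altM hD) // z1 z2 mulmx0 mxtrace0 addr0.
have B2 : \tr (D e12 *m e33) = 0.
  by rewrite -i2 (altM hD) // z3 z2 !mulmx0 mxtrace0 addr0.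
have B3 : \tr (D e21 *m e33) = 0.
  by rewrite -i3 (altM hD) // z1 z6 !mulmx0 mxtrace0 addr0.
have ex a b c d e : mx3 a b 0 c d 0 0 0 e =
    d%:M + ((a - d) *: e11 + (b *: e12 + (c *: e21 + (e - d) *: e33))) :> 'M[k]_3.
  by rewrite /e11 /e12 /e21 /e33 !mx3E; apply: mx3_eq; ring.
(* The entries solve $\mathrm{tr}([X, Z] Y) = -\mathrm{tr}(D(X) Y)$ for the three pairs among [e11],
   [e12], [e21]. *)
exists (mx3 (\tr (D e12 *m e21)) (- \tr (D e11 *m e21)) 0 (\tr (D e11 *m e12)) 0 0 0 0 0).
move=> X [a [b [c [d [e XE]]]]] Y [a' [b' [c' [d' [e' YE]]]]].
have DE := alt_expand4 d (a - d) b c (e - d) d' (a' - d') b' c' (e' - d') hD ha h11 h12 h21 h33.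
rewrite XE YE mulmxDl mxtraceD; move: DE; rewrite -!ex => ->.
by rewrite B1 B2 B3 !mx3E; ring.
Qed.

(** Here the Leibniz rule puts [e13] into the radical; the three remaining values, on pairs among
    [e1], [e12], [e23], are again those of an inner derivation. *)
Lemma inner_algJ : inner_alg (@algJ k).
Proof.
move=> D hD; have ha : subalg (@algJ k) by have <- := @centraliser_J k 0; exact: subalg_centraliser.
pose e1 : 'M[k]_3 := mx3 1 0 0 0 0 0 0 0 1; pose e12 : 'M[k]_3 := mx3 0 1 0 0 0 0 0 0 0.
pose e23 : 'M[k]_3 := mx3 0 0 0 0 0 1 0 0 0; pose e13 : 'M[k]_3 := mx3 0 0 1 0 0 0 0 0 0.
pose e2 : 'M[k]_3 := mx3 0 0 0 0 1 0 0 0 0.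
have h1 : algJ e1 by do 5!eexists. have h12 : algJ e12 by do 5!eexists.
have h23 : algJ e23 by do 5!eexists. have h13 : algJ e13 by do 5!eexists.
have h2 : algJ e2 by do 5!eexists.
have i1 : e1 *m e1 = e1 by rewrite /e1 !mx3E; apply: mx3_eq; ring.
have i2 : e12 *m e2 = e12 by rewrite /e2 /e12 !mx3E; apply: mx3_eq; ring.
have i3 : e2 *m e23 = e23 by rewrite /e2 /e23 !mx3E; apply: mx3_eq; ring.
have z1 : e1 *m e13 = e13 by rewrite /e1 /e13 !mx3E; apply: mx3_eq; ring.
have z2 : e13 *m e1 = e13 by rewrite /e13 /e1 !mx3E; apply: mx3_eq; ring.
have z3 : e2 *m e13 = 0 by rewrite /e2 /e13 !mx3E; apply: mx3_eq; ring.
have z4 : e13 *m e12 = 0 by rewrite /e13 /e12 !mx3E; apply: mx3_eq; ring.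
have z5 : e23 *m e13 = 0 by rewrite /e23 /e13 !mx3E; apply: mx3_eq; ring.
have z6 : e13 *m e2 = 0 by rewrite /e13 /e2 !mx3E; apply: mx3_eq; ring.
have z := (z1, z2, z3, z4, z5, z6).
have B1 : \tr (D e1 *m e13) = 0.
  have /eqP := altM hD h1 h1 h13; rewrite i1 !z.
  by rewrite -subr_eq subrr eq_sym => /eqP.
have B2 : \tr (D e12 *m e13) = 0.
  by rewrite -i2 (altM hD) // !z !mulmx0 mxtrace0 addr0.
have B3 : \tr (D e23 *m e13) = 0.
  by rewrite -i3 (altM hD) // !z !mulmx0 mxtrace0 addr0.
have ex a b c d e : mx3 a b c 0 d e 0 0 a =
    d%:M + ((a - d) *: e1 + (b *: e12 + (e *: e23 + c *: e13))) :> 'M[k]_3.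
  by rewrite /e1 /e12 /e23 /e13 !mx3E; apply: mx3_eq; ring.
exists (mx3 0 0 0 (\tr (D e1 *m e12)) 0 0 (\tr (D e12 *m e23)) (- \tr (D e1 *m e23)) 0).
move=> X [a [b [c [d [e XE]]]]] Y [a' [b' [c' [d' [e' YE]]]]].
have DE := alt_expand4 d (a - d) b e c d' (a' - d') b' e' c' hD ha h1 h12 h23 h13.
rewrite XE YE mulmxDl mxtraceD; move: DE; rewrite -!ex => ->.
by rewrite B1 B2 B3 !mx3E; ring.
Qed.

Lemma inner_conjs h (g : 'M[k]_3) : g \in unitmx -> inner_alg h -> inner_alg (conjs g h).
Proof.
move=> ug inn D [oD oZ alt oM].
have cj X : h X -> conjs g h (g *m X *m invmx g) by exists X.
pose D' X := invmx g *m D (g *m X *m invmx g) *m g.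
have gD' X : g *m D' X *m invmx g = D (g *m X *m invmx g).
  by rewrite /D' !mulmxA mulmxV // mul1mx mulmxK.
have oc W : orth (conjs g h) (g *m W *m invmx g) -> orth h W by move/(orth_conjs _ _ ug).
have hD' : alt_deriv h D'.
  split=> [X Y hX hY|c X hX|X hX|X Y hX hY].
  - apply: oc; rewrite mulmxBr mulmxBl !mulmxDr !mulmxDl !gD' !mulmxDr !mulmxDl.
    by apply: oD; apply: cj.
  - apply: oc; rewrite mulmxBr mulmxBl gD' -!scalemxAr -!scalemxAl gD'.
    exact: oZ (cj _ hX).
  - by rewrite -(conj_mxtrace _ ug) -conjs_mulK // gD'; apply: alt; apply: cj.
  - apply: oc; rewrite mulmxBr mulmxBl mulmxDr mulmxDl gD' -conjs_mulK //.
    rewrite -[g *m (D' X *m Y) *m _]conjs_mulK // -[g *m (X *m D' Y) *m _]conjs_mulK //.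
    by rewrite !gD'; apply: oM; apply: cj.
have [Z hZ] := inn _ hD'; exists (g *m Z *m invmx g) => _ [X hX <-].
have /(orth_conjs _ _ ug) := hZ _ hX.
by rewrite mulmxDr mulmxDl gD' mulmxBr mulmxBl -!conjs_mulK.
Qed.

Lemma lie_class_inner s h : s = typeL \/ s = typeJ -> lie_class s h -> inner_alg h.
Proof.
case=> -> /lie_class_std => /(_ isT) [g ug ->]; apply: inner_conjs => //.
  exact: inner_algL.
exact: inner_algJ.
Qed.

End Inner.

(** * The commutative types as three-dimensional algebras *)

Section Span3.
Variable k : finFieldType.
Implicit Types (X Y V b c : 'M[k]_3) (h : set 'M[k]_3).

Definition span3 h b c : Prop :=
  [/\ forall X, h X <-> exists x y z, X = x%:M + y *: b + z *: c,
      forall x y z, x%:M + y *: b + z *: c = 0 -> [/\ x = 0, y = 0 & z = 0]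
    & b *m c = c *m b].

Definition is_comm3 (s : stype) : bool :=
  match s with typeG | typeL | typeJ => false | _ => true end.

Lemma span3_conjs h b c (g : 'M[k]_3) : g \in unitmx -> span3 h b c ->
  span3 (conjs g h) (g *m b *m invmx g) (g *m c *m invmx g).
Proof.
move=> ug [hs free bc].
have E x y z : g *m (x%:M + y *: b + z *: c) *m invmx g =
    x%:M + y *: (g *m b *m invmx g) + z *: (g *m c *m invmx g).
  rewrite !mulmxDr !mulmxDl -!scalemxAr -!scalemxAl; congr (_ + _ + _).
  by rewrite -scalemx1 -scalemxAr -scalemxAl mulmx1 mulmxV.
split; last by rewrite !conjs_mulK // bc.
- move=> X; split=> [[Y /hs[x [y [z ->]]] <-]|[x [y [z ->]]]].
    by exists x, y, z.
  by exists (x%:M + y *: b + z *: c); [apply/hs; exists x, y, z|].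
- move=> x y z; rewrite -E => /(congr1 (fun M => invmx g *m M *m g)).
  rewrite mulmx0 mul0mx !mulmxA mulVmx // mul1mx mulmxKV //; exact: free.
Qed.

Lemma lie_class_span3 s h : is_comm3 s -> lie_class s h -> exists b c, span3 h b c.
Proof.
move=> cs; have [st|nst] := boolP (is_std s).
  move=> /(lie_class_std _ st)[g ug ->].
  suff [b [c bc]] : exists b c, span3 (@std_alg k s) b c.
    by do 2!eexists; apply: span3_conjs ug bc.
  case: s cs st => //= _ _.
  - exists (mx3 0 0 0 0 1 0 0 0 0), (mx3 0 0 0 0 0 0 0 0 1); split.
    + move=> X; rewrite /= diag_mx3; split=> -[x [y [z ->]]].
        by exists x, (y - x), (z - x); rewrite !mx3E; apply: mx3_eq; ring.
      by exists x, (x + y), (x + z); rewrite !mx3E; apply: mx3_eq; ring.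
    + move=> x y z; rewrite !mx3E => /mx3_inj[[E1 _ _] [[_ E2 _] [_ _ E3]]].
      rewrite !mul01E in E1 E2 E3; move: E2 E3; rewrite E1 !mul01E.
      by split.
    + by rewrite !mx3E; apply: mx3_eq; ring.
  - exists (elem_mx k 1 3), (elem_mx k 2 3); split=> //.
    + move=> x y z; rewrite !elem_mxE !mx3E => /mx3_inj[[E1 _ E2] [[_ _ E3] _]].
      by rewrite !mul01E in E1 E2 E3.
    + by rewrite !elem_mxE !mx3E; apply: mx3_eq; ring.
  - exists (elem_mx k 2 1), (elem_mx k 2 3); split=> //.
    + move=> x y z; rewrite !elem_mxE !mx3E => /mx3_inj[[E1 _ _] [[E2 _ E3] _]].
      by rewrite !mul01E in E1 E2 E3.
    + by rewrite !elem_mxE !mx3E; apply: mx3_eq; ring.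
move=> /(lie_class_reg _ nst)[X rX ->]; have sX := reg_poly_size rX.
exists X, (X *m X); split; [exact: centraliser_regular| |by rewrite mulmxA].
move=> x y z E.
have : mxminpoly X %| Poly [:: x; y; z].
  apply: mxminpoly_min.
  rewrite (_ : Poly _ = x%:P + y%:P * 'X + z%:P * ('X * 'X)).
    by rewrite !rmorphD !rmorphM /= !horner_mx_C horner_mx_X -!mulmxE !mul_scalar_mx.
  rewrite /= !cons_poly_def; ring.
have [P0 _|P0 /dvdp_leq] := eqVneq (Poly [:: x; y; z]) 0.
  have cf i : (Poly [:: x; y; z])`_i = 0 by rewrite P0 coef0.
  by move: (cf 0%N) (cf 1%N) (cf 2%N); rewrite !coef_Poly /= => -> -> ->.
by move=> /(_ P0); rewrite sX => /leq_trans/(_ (size_Poly _)).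
Qed.

Lemma lie_class_subalg s h : lie_class s h -> subalg h.
Proof.
have [st|nst] := boolP (is_std s); last first.
  by move=> /(lie_class_reg _ nst)[X _ ->]; apply: subalg_centraliser.
move=> hs; have [cs|ncs] := boolP (is_comm3 s).
  have /(lie_class_std _ st)[g ug hE] := hs.
  rewrite hE; apply: subalg_conjs => //.
  case: s cs st {hs hE} => //= _ _.
  - split=> [|/=|X Y /diag_mx3[a [b [c ->]]] /diag_mx3[a' [b' [c' ->]]]].
    + split=> [/=|X Y /diag_mx3[a [b [c ->]]] /diag_mx3[a' [b' [c' ->]]]|x X /diag_mx3[a [b [c ->]]]].
      * by apply/diag_mx3; exists 0, 0, 0; rewrite mx3_0.
      * by apply/diag_mx3; do 3!eexists; rewrite !mx3E !addr0.
      * by apply/diag_mx3; do 3!eexists; rewrite !mx3E !mulr0.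
    + by apply/diag_mx3; do 3!eexists; rewrite mx3_scalar.
    + by apply/diag_mx3; do 3!eexists; rewrite !mx3E !mul01E.
  - split=> [|/=|X Y /algK0E[a [b [c ->]]] /algK0E[a' [b' [c' ->]]]].
    + split=> [/=|X Y /algK0E[a [b [c ->]]] /algK0E[a' [b' [c' ->]]]|x X /algK0E[a [b [c ->]]]].
      * by apply/algK0E; exists 0, 0, 0; rewrite mx3_0.
      * by apply/algK0E; do 3!eexists; rewrite !mx3E !addr0.
      * by apply/algK0E; do 3!eexists; rewrite !mx3E !mulr0.
    + by apply/algK0E; exists 1, 0, 0; rewrite mx3_scalar.
    + by apply/algK0E; do 3!eexists; rewrite !mx3E !mul01E.
  - split=> [|/=|X Y /algKinfE[a [b [c ->]]] /algKinfE[a' [b' [c' ->]]]].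
    + split=> [/=|X Y /algKinfE[a [b [c ->]]] /algKinfE[a' [b' [c' ->]]]|x X /algKinfE[a [b [c ->]]]].
      * by apply/algKinfE; exists 0, 0, 0; rewrite mx3_0.
      * by apply/algKinfE; do 3!eexists; rewrite !mx3E !addr0.
      * by apply/algKinfE; do 3!eexists; rewrite !mx3E !mulr0.
    + by apply/algKinfE; exists 1, 0, 0; rewrite mx3_scalar.
    + by apply/algKinfE; do 3!eexists; rewrite !mx3E !mul01E.
case: s st ncs hs => //= _ _ [X].
- by move=> [a [_ ->]]; apply: subalg_centraliser.
- by move=> [a [b [_ _ ->]]]; apply: subalg_centraliser.
- by move=> [a [_ ->]]; apply: subalg_centraliser.
Qed.

End Span3.

(** * Counting quadratic and cubic polynomials *)

Definition stype_num (s : stype) : nat :=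
  match s with
  | typeG => 0 | typeL => 1 | typeJ => 2 | typeT1 => 3 | typeT2 => 4
  | typeT3 => 5 | typeM => 6 | typeN => 7 | typeK0 => 8 | typeKinf => 9 end.

Definition stype_of_num (i : nat) : stype :=
  nth typeG [:: typeG; typeL; typeJ; typeT1; typeT2; typeT3; typeM; typeN; typeK0; typeKinf] i.

Lemma stype_numK : cancel stype_num stype_of_num.
Proof. by case. Qed.

Lemma stype_num_lt s : (stype_num s < 10)%N.
Proof. by case: s. Qed.

Lemma stype_of_numK i : (i < 10)%N -> stype_num (stype_of_num i) = i.
Proof. by do 10?[case: i => [//|i]]. Qed.

HB.instance Definition _ := Equality.copy stype (can_type stype_numK).

Section CubicCounting.
Variable k : finFieldType.
Implicit Types (a b c : k) (p : {poly k}).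

Definition pc (x : k * k * k) : {poly k} := cub x.1.1 x.1.2 x.2.
Definition pq (x : k * k) : {poly k} := quad x.1 x.2.
Definition rts p : {set k} := [set x | root p x]%SET.

Lemma pc_inj : injective pc.
Proof. by move=> [[a b] c] [[a' b'] c'] /cub_inj[/= -> -> ->]. Qed.

Lemma pq_inj : injective pq.
Proof. by move=> [a b] [a' b'] /quad_inj[/= -> ->]. Qed.

Lemma pc_surj p : p \is monic -> size p = 4 -> exists x, p = pc x.
Proof. by move=> pm /(monic_cub pm)[a [b [c ->]]]; exists (a, b, c). Qed.

Lemma pq_surj p : p \is monic -> size p = 3 -> exists x, p = pq x.
Proof. by move=> pm /(monic_quad pm)[a [b ->]]; exists (a, b). Qed.

(** Polynomials form an infinite type, so they are counted by comparing two injective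
    parametrisations: [P] will be by coefficients, [F] by roots or factors. *)
Lemma card_pred_image (A B : finType) (C : Type) (P : B -> C) (F : A -> C) (Q : pred B) :
  injective P -> injective F -> (forall x, exists y, P y = F x) ->
  (forall y, Q y <-> exists x, P y = F x) -> #|Q| = #|A|.
Proof.
move=> Pi Fi ex QE; have /choice[f fE] := ex.
have fI : injective f by move=> x x' E; apply: Fi; rewrite -!fE E.
rewrite -(card_codom fI); apply: eq_card => y.
apply/idP/codomP => [/QE[x yx]|[x ->]]; first by exists x; apply: Pi; rewrite fE.
by apply/QE; exists x; rewrite fE.
Qed.

Lemma card_predE (T : finType) (P : pred T) : #|[pred x | P x]| = (\sum_x P x)%N.
Proof. by rewrite -sum1_card big_mkcond; apply: eq_bigr => x _; rewrite inE; case: (P x). Qed.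

Definition set_poly (A : {set k}) : {poly k} := \prod_(a in A) ('X - a%:P).

Lemma root_set_poly A x : root (set_poly A) x = (x \in A).
Proof. by rewrite /set_poly -big_enum /= root_prod_XsubC mem_enum. Qed.

Lemma size_set_poly A : size (set_poly A) = #|A|.+1.
Proof. by rewrite /set_poly -big_enum /= size_prod_XsubC -cardE. Qed.

Lemma set_poly_monic A : set_poly A \is monic.
Proof. by rewrite /set_poly -big_enum /= monic_prod_XsubC. Qed.

Lemma rts_set_poly A : rts (set_poly A) = A.
Proof. by apply/finset.setP => x; rewrite finset.inE root_set_poly. Qed.

Lemma set_poly_rts p : p \is monic -> size p = #|rts p|.+1 -> p = set_poly (rts p).
Proof.
move=> pm sp; apply/esym/monic_dvd_size => //; first exact: set_poly_monic.
  rewrite /set_poly -big_enum /=; apply: uniq_roots_dvdp.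
    by apply/allP => x; rewrite mem_enum finset.inE.
  by rewrite uniq_rootsE enum_uniq.
by rewrite size_set_poly sp.
Qed.

(** Monic polynomials with as many roots as their degree are the products of ['X - a%:P] over the
    [n]-element subsets of [k]. *)
Lemma card_rts_eq n (T : finType) (P : T -> {poly k}) :
  injective P -> (forall x, P x \is monic /\ size (P x) = n.+1) ->
  (forall p, p \is monic -> size p = n.+1 -> exists x, p = P x) ->
  #|[pred x | #|rts (P x)| == n]| = 'C(#|k|, n).
Proof.
move=> inj mon surj; rewrite -card_draws cardsE -[RHS]card_sig.
pose F (A : {A : {set k} | #|A| == n}) := set_poly (val A).
apply: (@card_pred_image _ _ _ P F) => //.
- by move=> A B /(congr1 rts); rewrite !rts_set_poly => /val_inj.
- move=> [A /= hA]; have [|x E] := surj (set_poly A) (set_poly_monic A); last by exists x.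
  by rewrite size_set_poly (eqP hA).
- move=> x; rewrite inE; split=> [/eqP hx|[[A /= hA] ->]]; last by rewrite /F rts_set_poly.
  have hA : #|rts (P x)| == n by rewrite hx.
  exists (exist (fun A : {set k} => #|A| == n) _ hA); apply: set_poly_rts; first by case: (mon x).
  by rewrite hx; case: (mon x).
Qed.

Lemma rts_quad2 a b : rts (('X - a%:P) * ('X - b%:P)) = [set a; b]%SET.
Proof. by apply/finset.setP => x; rewrite !finset.inE rootM !root_XsubC. Qed.

Variant quad_spec p : nat -> Prop :=
  | Quad2 a b of a != b & p = ('X - a%:P) * ('X - b%:P) : quad_spec p 2
  | Quad1 a of p = ('X - a%:P) * ('X - a%:P) : quad_spec p 1
  | Quad0 of (forall x, ~~ root p x) : quad_spec p 0.

Lemma dvdX_monic a p n : p \is monic -> size p = n.+2 -> root p a ->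
  exists q, [/\ q \is monic, size q = n.+1 & p = ('X - a%:P) * q].
Proof.
move=> pm sp /factor_theorem[q pE]; exists q; rewrite mulrC in pE.
have qm : q \is monic by apply: (@monic_factor _ a); rewrite -pE.
split=> //; move: sp; rewrite pE size_monicM ?monicXsubC ?monic_neq0 // size_XsubC.
by rewrite addSn => -[].
Qed.

Lemma monic_size2 p : p \is monic -> size p = 2 -> exists a, p = 'X - a%:P.
Proof.
move=> pm sp; have [a ra] := poly2_root sp; exists a.
have [q [qm sq pE]] := dvdX_monic pm sp ra.
move: sq => /eqP /size_poly1P[c c0 qE]; move: qm; rewrite pE qE monicE lead_coefC => /eqP ->.
by rewrite mulr1.
Qed.

Lemma quadP p : p \is monic -> size p = 3 -> quad_spec p #|rts p|.
Proof.
move=> pm sp; have [[a ra]|nr] := pselect (exists a, root p a); last first.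
  have nr' x : ~~ root p x by apply/negP => rx; apply: nr; exists x.
  rewrite (_ : #|rts p| = 0%N); first exact: Quad0.
  by apply: eq_card0 => x; rewrite finset.inE (negPf (nr' x)).
have [q [qm sq pE]] := dvdX_monic pm sp ra.
have [b qE] := monic_size2 qm sq.
rewrite pE qE rts_quad2 cards2; have [ab|ab] := eqVneq a b.
  by rewrite ab; apply: (Quad1 (a := b)).
exact: (Quad2 ab).
Qed.

Variant cub_spec p : stype -> Prop :=
  | CubT1 a b c of a != b & a != c & b != c &
      p = ('X - a%:P) * (('X - b%:P) * ('X - c%:P)) : cub_spec p typeT1
  | CubM a b of a != b & p = ('X - a%:P) * ('X - b%:P) ^+ 2 : cub_spec p typeM
  | CubN a of p = ('X - a%:P) ^+ 3 : cub_spec p typeN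
  | CubT2 a y of (forall x, ~~ root (pq y) x) & p = ('X - a%:P) * pq y : cub_spec p typeT2
  | CubT3 of (forall x, ~~ root p x) : cub_spec p typeT3.

(** A cubic with a single root in [k] is either a cube or a linear factor times an irreducible
    quadratic; only in this case does the number of roots not decide the type. *)
Definition cub_type p : stype :=
  match #|rts p| with
  | 3 => typeT1
  | 2 => typeM
  | 0 => typeT3
  | _ => if [exists a, p == ('X - a%:P) ^+ 3] then typeN else typeT2
  end.

Lemma cubP p : p \is monic -> size p = 4 -> cub_spec p (cub_type p).
Proof.
move=> pm sp; have [[a ra]|nr] := pselect (exists a, root p a); last first.
  have nr' x : ~~ root p x by apply/negP => rx; apply: nr; exists x.
  rewrite /cub_type (_ : #|rts p| = 0%N); first exact: CubT3.
  by apply: eq_card0 => x; rewrite finset.inE (negPf (nr' x)).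
have [q [qm sq pE]] := dvdX_monic pm sp ra.
have rE : rts p = (a |: rts q)%SET.
  by apply/finset.setP => x; rewrite !finset.inE pE rootM root_XsubC.
rewrite /cub_type rE cardsU1 finset.inE.
case: (quadP qm sq) => [b c bc qE|b qE|nr].
- have -> : root q a = (a == b) || (a == c) by rewrite qE rootM !root_XsubC.
  have [ab|ab] := eqVneq a b; first by apply: (@CubM _ c b); rewrite 1?eq_sym // pE qE ab; ring.
  have [ac|ac] := eqVneq a c; first by apply: (@CubM _ b c) => //; rewrite pE qE ac; ring.
  by apply: (@CubT1 _ a b c) => //; rewrite pE qE.
- have -> : root q a = (a == b) by rewrite qE rootM !root_XsubC orbb.
  have [ab|ab] := eqVneq a b => /=; last by apply: (CubM ab); rewrite pE qE expr2.
  have E : p = ('X - b%:P) ^+ 3 by rewrite pE qE ab; ring.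
  by case: existsP => [_|[]]; [exact: CubN E|exists b; rewrite E].
- rewrite (negPf (nr a)) /=; have [y yE] := pq_surj qm sq.
  case: existsP => [[b /eqP pb]|_]; last by apply: (@CubT2 _ a y); rewrite -?yE // pE.
  have ab : a = b by move: ra; rewrite pb root_exp_XsubC // => /eqP.
  exfalso; move: pb; rewrite pE ab exprS => /(mulfI (negbT (polyXsubC_eq0 b))) qE.
  by have := nr b; rewrite qE root_exp_XsubC eqxx.
Qed.

Lemma pc_monic x : pc x \is monic /\ size (pc x) = 4.
Proof. by rewrite /pc cub_monic size_cub. Qed.

Lemma pq_monic y : pq y \is monic /\ size (pq y) = 3.
Proof. by rewrite /pq quad_monic size_quad. Qed.

Lemma cub_typeN a : cub_type (('X - a%:P) ^+ 3) = typeN.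
Proof.
rewrite /cub_type (_ : rts _ = [set a]%SET) ?cards1 /=.
  by case: existsP => // -[]; exists a.
by apply/finset.setP => x; rewrite !finset.inE root_exp_XsubC.
Qed.

Lemma cub_typeM a b : a != b -> cub_type (('X - a%:P) * ('X - b%:P) ^+ 2) = typeM.
Proof.
move=> ab; rewrite /cub_type (_ : rts _ = [set a; b]%SET) ?cards2 ?ab //.
by apply/finset.setP => x; rewrite !finset.inE rootM root_exp_XsubC // root_XsubC.
Qed.

Lemma cub_typeT2 a y : (forall x, ~~ root (pq y) x) -> cub_type (('X - a%:P) * pq y) = typeT2.
Proof.
move=> nr; rewrite /cub_type (_ : rts _ = [set a]%SET) ?cards1 /=; last first.
  by apply/finset.setP => x; rewrite !finset.inE rootM root_XsubC (negPf (nr x)) orbF.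
case: existsP => // -[b /eqP E].
have : root (('X - a%:P) * pq y) a by rewrite rootM root_XsubC eqxx.
rewrite E root_exp_XsubC // => /eqP ab.
move: E; rewrite ab exprS => /(mulfI (negbT (polyXsubC_eq0 b))) qE.
by have := nr b; rewrite qE root_exp_XsubC // eqxx.
Qed.

Lemma cub_typeT1 x : (cub_type (pc x) == typeT1) = (#|rts (pc x)| == 3).
Proof.
rewrite /cub_type; case: #|rts (pc x)| => [|[|[|[|n]]]] //=; by case: ifP.
Qed.

Lemma card_quad2 : #|[pred y | #|rts (pq y)| == 2]| = 'C(#|k|, 2).
Proof. by apply: card_rts_eq; [exact: pq_inj|exact: pq_monic|exact: pq_surj]. Qed.

Lemma card_quad1 : #|[pred y | #|rts (pq y)| == 1%N]| = #|k|.
Proof.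
pose F (a : k) := ('X - a%:P) * ('X - a%:P).
apply: (@card_pred_image _ _ _ pq F) => //; first exact: pq_inj.
- move=> a b; rewrite /F !mulXX => /quad_inj[/oppr_inj E1 E2].
  apply: sqrB_eq0.
  (* The coefficients give $2a = 2b$ and $a^2 = b^2$; this identity uses both and so works in every
     characteristic. *)
  rewrite (_ : _ ^+ 2 = a * ((a + a) - (b + b)) - (a * a - b * b)); last by ring.
  by rewrite E1 E2 !subrr mulr0 subrr.
- by move=> a; exists (- (a * a), a + a); rewrite /F mulXX.
- move=> y; rewrite inE; have [pm sp] := pq_monic y; split.
    by case: (quadP pm sp) => // a E _; exists a.
  by move=> [a ->]; rewrite rts_quad2 cards2 eqxx.
Qed.

Definition nirr2 := #|[pred y | #|rts (pq y)| == 0%N]|.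

(** The three terms are the quadratics with no root, a double root and two roots. The count of
    irreducible ones is obtained from this by subtraction. *)
Lemma card_quads : (#|k| * #|k| = nirr2 + #|k| + 'C(#|k|, 2))%N.
Proof.
rewrite -{3}card_quad1 -card_quad2 /nirr2 -card_prod.
rewrite -sum1_card !card_predE -!big_split; apply: eq_bigr => y _ /=.
have [pm sp] := pq_monic y.
by case: (quadP pm sp).
Qed.

Lemma card_cubT1 : #|[pred x | cub_type (pc x) == typeT1]| = 'C(#|k|, 3).
Proof.
rewrite -(@card_rts_eq 3 _ pc) //; [|exact: pc_inj|exact: pc_monic|exact: pc_surj].
by apply: eq_card => x; rewrite !inE cub_typeT1.
Qed.

Lemma card_cubN : #|[pred x | cub_type (pc x) == typeN]| = #|k|.
Proof.
pose F (a : k) := ('X - a%:P) ^+ 3.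
apply: (@card_pred_image _ _ _ pc F) => //; first exact: pc_inj.
- move=> a b E; have : root (F a) b by rewrite E /F root_exp_XsubC.
  by rewrite /F root_exp_XsubC // => /eqP.
- move=> a; have [|x E] := @pc_surj (F a) (monic_exp _ (monicXsubC _)); last by exists x.
  by rewrite /F XsubC3 mulXquad size_cub.
- move=> x; rewrite inE; have [pm sp] := pc_monic x; split.
    by case: (cubP pm sp) => // a E _; exists a.
  by move=> [a ->]; rewrite cub_typeN.
Qed.

Lemma card_cubM : #|[pred x | cub_type (pc x) == typeM]| = #|{: dpair k}|.
Proof.
pose F (ab : dpair k) : {poly k} := ('X - (val ab).1%:P) * ('X - (val ab).2%:P) ^+ 2.
apply: (@card_pred_image _ _ _ pc F) => //; first exact: pc_inj.
- move=> [[a b] /= ab] [[a' b'] /= ab']; rewrite /F /= => E.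
  have rt x : ((x == a) || (x == b)) = ((x == a') || (x == b')).
    by have := congr1 (fun p => root p x) E; rewrite /= !rootM ?root_exp_XsubC ?root_XsubC ?orbb.
  move: E; rewrite !XsubC12 !mulXquad => /cub_inj[_ _ E].
  apply: val_inj => /=; have := rt a; have := rt b; rewrite !eqxx orbT /=.
  have [ba|ba] := eqVneq b a'; have [bb|bb] := eqVneq b b' => //= _ /esym.
  + by move: ab'; rewrite -ba bb eqxx.
  (* The set of roots does not show which one is double; the coefficient [a + 2b] excludes the
     swap. *)
  + rewrite -ba (negPf ab) /= => /eqP ab2; case/eqP: ab; move: E.
    rewrite -ba -ab2 => /eqP; rewrite -subr_eq0 (_ : _ - _ = b - a); last by ring.
    by rewrite subr_eq0 => /eqP.
  + by rewrite -bb (negPf ab) orbF => /eqP ->.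
- move=> ab; have [||x E] := @pc_surj (F ab); last by exists x.
    by rewrite /F monicMl ?monicXsubC // monic_exp // monicXsubC.
  by rewrite /F XsubC12 mulXquad size_cub.
- move=> x; rewrite inE; have [pm sp] := pc_monic x; split.
    by case: (cubP pm sp) => // a b ab E _; exists (exist _ (a, b) ab).
  by move=> [[[a b] /= ab] ->]; rewrite /F /= cub_typeM.
Qed.

Lemma card_cubT2 : #|[pred x | cub_type (pc x) == typeT2]| = (#|k| * nirr2)%N.
Proof.
pose I := {y : k * k | #|rts (pq y)| == 0%N}.
have nrI (y : I) x : ~~ root (pq (val y)) x.
  apply/negP => rx; have := valP y; rewrite cards_eq0 => /eqP/finset.setP/(_ x).
  by rewrite !finset.inE rx.
rewrite (_ : nirr2 = #|{: I}|); last by rewrite card_sig.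
rewrite -card_prod.
pose F (ay : k * I) := ('X - ay.1%:P) * pq (val ay.2).
apply: (@card_pred_image _ _ _ pc F) => //; first exact: pc_inj.
- move=> [a y] [a' y']; rewrite /F /= => E.
  have aa : a = a'.
    have : root (('X - a'%:P) * pq (val y')) a by rewrite -E rootM root_XsubC eqxx.
    by rewrite rootM root_XsubC (negPf (nrI _ _)) orbF => /eqP.
  by move: E; rewrite aa => /(mulfI (negbT (polyXsubC_eq0 a'))) /pq_inj /val_inj ->.
- move=> [a y]; have [||x E] := @pc_surj (F (a, y)); last by exists x.
    by rewrite /F monicMl ?monicXsubC //; case: (pq_monic (val y)).
  by rewrite /F /pq mulXquad size_cub.
- move=> x; rewrite inE; have [pm sp] := pc_monic x; split.
    case: (cubP pm sp) => // a y nr E _.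
    have hy : #|rts (pq y)| == 0%N.
      by rewrite cards_eq0; apply/eqP/finset.setP => z; rewrite !finset.inE (negPf (nr z)).
    by exists (a, exist (fun y => #|rts (pq y)| == 0%N) y hy).
  by move=> [[a y] ->]; rewrite /F /= (cub_typeT2 _ (nrI y)).
Qed.

Lemma card_cubs : (#|k| * #|k| * #|k| =
  #|[pred x | cub_type (pc x) == typeT1]| + #|[pred x | cub_type (pc x) == typeT2]| +
  #|[pred x | cub_type (pc x) == typeT3]| + #|[pred x | cub_type (pc x) == typeM]| +
  #|[pred x | cub_type (pc x) == typeN]|)%N.
Proof.
rewrite -!card_prod -sum1_card !card_predE -!big_split.
apply: eq_bigr => x _ /=; have [pm sp] := pc_monic x.
by case: (cubP pm sp).
Qed.

Lemma card_dpair : (#|k| * #|k| = #|k| + #|{: dpair k}|)%N.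
Proof.
rewrite -card_prod -(cardC [pred ab : k * k | ab.1 == ab.2]) card_sig; congr addn.
rewrite -[RHS](card_codom (f := fun a : k => (a, a))); last by move=> a b [].
apply: eq_card => -[a b]; rewrite !inE /=; apply/eqP/codomP => [->|[c [-> ->]]] //.
by exists b.
Qed.

End CubicCounting.

(** * Orbits on the duals of the ten algebras *)

Section CformTypes.
Variable k : finFieldType.
Implicit Types (X Y V : 'M[k]_3) (h : set 'M[k]_3) (a b c : k).

Definition cform_type (x : cform k) : stype :=
  match x with
  | inl (inl _) => typeG
  | inl (inr _) => typeL
  | inr (inl _) => typeJ
  | inr (inr y) => cub_type (pc y)
  end.

Lemma pc_comp3 (y : k * k * k) : mxminpoly (cform_mx (inr (inr y))) = pc y.
Proof. by case: y => [[a b] c]; rewrite mxminpoly_cform. Qed.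

Lemma pq_irreducible (y : k * k) : (forall x, ~~ root (pq y) x) -> irreducible_poly (pq y).
Proof. by apply: cubic_irreducible; rewrite size_quad. Qed.

Lemma mul_neq_eq0 (a b x : k) : a != b -> x * a = b * x -> x = 0.
Proof.
move=> ab /eqP; rewrite [b * x]mulrC -subr_eq0 -mulrBr mulf_eq0 subr_eq0 (negPf ab) orbF.
by move/eqP.
Qed.

Lemma diag3_minpoly a b c : a != b -> a != c -> b != c ->
  mxminpoly (mx3 a 0 0 0 b 0 0 0 c) = ('X - a%:P) * (('X - b%:P) * ('X - c%:P)).
Proof.
move=> ab ac bc; rewrite mulXX mulXquad.
have sz : size (mxminpoly (mx3 a 0 0 0 b 0 0 0 c)) = 4.
  apply: size_minpoly_free => [x y z|].
    rewrite !mx3E => /mx3_inj[[E1 _ _] [[_ E2 _] [_ _ E3]]].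
    rewrite !mul01E in E1 E2 E3.
    (* Divided differences of $x + yt + zt^2$, which vanishes at the three distinct points [a], [b],
       [c]. *)
    have d1 : y + z * (a + b) = 0.
      apply/(mulfI (_ : a - b != 0)); rewrite ?subr_eq0 // mulr0.
      rewrite [LHS](_ : _ = (x + y * a + z * (a * a)) - (x + y * b + z * (b * b))); last by ring.
      by rewrite E1 E2 subrr.
    have d2 : y + z * (a + c) = 0.
      apply/(mulfI (_ : a - c != 0)); rewrite ?subr_eq0 // mulr0.
      rewrite [LHS](_ : _ = (x + y * a + z * (a * a)) - (x + y * c + z * (c * c))); last by ring.
      by rewrite E1 E3 subrr.
    apply/(mulIf (_ : b - c != 0)); rewrite ?subr_eq0 // mul0r.
    rewrite [LHS](_ : _ = (y + z * (a + b)) - (y + z * (a + c))); last by ring.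
    by rewrite d1 d2 subrr.
  by apply: contra ab => /is_scalar_mxP[x]; rewrite mx3_scalar => /mx3_inj[[-> _ _] [[_ -> _] _]].
apply: mxminpoly_eq; rewrite ?cub_monic ?sz ?size_cub //.
by rewrite horner_mx_cub !mx3E; apply: mx3_eq; ring.
Qed.

Lemma centraliser_diag3 a b c : a != b -> a != c -> b != c ->
  centraliser (mx3 a 0 0 0 b 0 0 0 c) = [set X | is_diag_mx X].
Proof.
move=> ab ac bc; apply/seteqP; split=> X; last first.
  by move=> /diag_mx3[x [y [z ->]]]; rewrite /centraliser /= !mx3E; apply: mx3_eq; ring.
rewrite /centraliser /= {1 2}[X]mx3_eta !mx3E => /mx3_inj[[_ E1 E2] [[E3 _ E4] [E5 E6 _]]].
rewrite !mul01E in E1 E2 E3 E4 E5 E6; apply/diag_mx3.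
exists (X o0 o0), (X o1 o1), (X o2 o2); rewrite {1}[X]mx3_eta.
rewrite (mul_neq_eq0 _ E1) 1?eq_sym // (mul_neq_eq0 _ E2) 1?eq_sym // (mul_neq_eq0 _ E3) //.
by rewrite (mul_neq_eq0 _ E4) 1?eq_sym // (mul_neq_eq0 _ E5) // (mul_neq_eq0 _ E6).
Qed.

Lemma lie_class_cub X (y : k * k * k) : mxminpoly X = pc y ->
  lie_class (cub_type (pc y)) (centraliser X).
Proof.
have [pm sp] := pc_monic y; move: (pc y) pm sp => p pm sp mE.
case: (cubP pm sp) => [a b c ab ac bc pE|a b ab pE|a pE|a z nr pE|nr].
- have sX : size (mxminpoly X) = 4 by rewrite mE.
  have /simil_sym/simil_centraliser[g ug ->] : simil X (mx3 a 0 0 0 b 0 0 0 c).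
    exact: simil_of_minpoly sX (etrans (etrans mE pE) (esym (diag3_minpoly ab ac bc))).
  by rewrite centraliser_diag3 //; exists g.
- by apply/lie_class_reg => //; exists X => //; rewrite mE; exists a, b.
- by apply/lie_class_reg => //; exists X => //; rewrite mE; exists a.
- apply/lie_class_reg => //; exists X => //; rewrite mE; exists a, (pq z).
  by split=> //; [exact: pq_irreducible|rewrite size_quad].
- apply/lie_class_reg => //; exists X => //; rewrite mE; split=> //.
  by apply: cubic_irreducible; rewrite ?sp.
Qed.

Lemma lie_class_cform (x : cform k) : lie_class (cform_type x) (centraliser (cform_mx x)).
Proof.
case: x => [[a|[[a b] ab]]|[a|y]].
- by exists (cform_mx (inl (inl a))), a; rewrite mxminpoly_cform.
- by exists (cform_mx (inl (inr (exist _ (a, b) ab)))), a, b; rewrite mxminpoly_cform.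
- by exists (cform_mx (inr (inl a))), a; rewrite mxminpoly_cform.
- by apply: lie_class_cub; rewrite pc_comp3.
Qed.

(** [T] parametrises the orbits of the units of [h] on the dual of [h], and [ty] gives the type of
    the stabiliser; counting the fibres of [ty] yields the polynomials $a_{\sigma,\tau}$. *)
Definition orb_transversal h (T : finType) (nf : T -> 'M[k]_3) (ty : T -> stype) : Prop :=
  [/\ forall Z, exists x, eqv h Z (nf x), forall x y, eqv h (nf x) (nf y) -> x = y
    & forall x, lie_class (ty x) (radf h (nf x))].

Lemma transversal_conjs h T nf ty (g : 'M[k]_3) : g \in unitmx -> @orb_transversal h T nf ty ->
  orb_transversal (conjs g h) (fun x => g *m nf x *m invmx g) ty.
Proof.
move=> ug [ex inj typ]; split=> [Z|x y|x].
- have [x Zx] := ex (invmx g *m Z *m g); exists x.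
  rewrite -[Z](_ : g *m (invmx g *m Z *m g) *m invmx g = Z); first exact/eqv_conjs.
  by rewrite !mulmxA mulmxV // mul1mx mulmxK.
- by move=> /(eqv_conjs _ _ _ ug)/inj.
- by rewrite radf_conjs //; apply: lie_class_conjs.
Qed.

Lemma orthT W : orth [set: 'M[k]_3] W -> W = 0.
Proof. by move=> o; apply: mxtrace_nondeg => X; apply: o. Qed.

Lemma orth0 h : orth h 0.
Proof. by move=> X _; rewrite mul0mx mxtrace0. Qed.

Lemma radfT Z : radf [set: 'M[k]_3] Z = centraliser Z.
Proof.
apply/seteqP; split=> X.
  by move=> [_ /orthT/eqP]; rewrite subr_eq0 => /eqP.
by rewrite /centraliser /= => XZ; split=> //; rewrite XZ subrr; apply: orth0.
Qed.

Lemma eqvT X Y : eqv setT X Y <-> simil X Y.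
Proof.
split=> [[g _ [ug /orthT/eqP]]|[g ug E]].
  by rewrite subr_eq0 => /eqP; exists g.
by exists g => //; split=> //; rewrite E subrr; apply: orth0.
Qed.

(** The orthogonal of the full matrix algebra is zero, so orbits are similarity classes over [k] and
    stabilisers are centralisers. *)
Lemma transversalG : orb_transversal setT (@cform_mx k) cform_type.
Proof.
split=> [Z|x y /eqvT/cform_inj //|x]; last by rewrite radfT; apply: lie_class_cform.
by have [x Zx] := cformP Z; exists x; apply/eqvT.
Qed.

End CformTypes.

(** * Type L: orbits on the dual of $\mathfrak{gl}_2 \times k$ *)

Section TransversalL.
Variable k : finFieldType.
Implicit Types (X Y V : 'M[k]_3) (h : set 'M[k]_3) (a b c : k).

Lemma orth_algL (a b c d e f g h i : k) :
  orth (@algL k) (mx3 a b c d e f g h i) <-> [/\ a = 0, b = 0, d = 0, e = 0 & i = 0].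
Proof.
split=> [o|[-> -> -> -> ->] _ [x [y [z [t [u ->]]]]]]; last by rewrite !mx3E; ring.
have mem x y z t u : algL (mx3 x y 0 z t 0 0 0 (u : k)) by do 5!eexists.
move: (o _ (mem 1 0 0 0 0)) (o _ (mem 0 0 1 0 0)) (o _ (mem 0 1 0 0 0)) (o _ (mem 0 0 0 1 0)) (o _ (mem 0 0 0 0 1)).
by rewrite !mx3E !mul01E.
Qed.

(** A functional is a 2x2 matrix up to similarity, either scalar or a companion block, together with
    a value [e] on the second factor. *)
Definition Lform : Type := (k * (k + k * k))%type.
HB.instance Definition _ := Finite.on Lform.

Definition Lform_mx (x : Lform) : 'M[k]_3 :=
  match x with
  | (e, inl a) => mx3 a 0 0 0 a 0 0 0 e
  | (e, inr (a, b)) => mx3 0 1 0 a b 0 0 0 e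
  end.

Definition Lform_type (x : Lform) : stype :=
  match x with
  | (_, inl _) => typeL
  | (_, inr y) => match #|rts (pq y)| with 0 => typeT2 | 1 => typeM | _ => typeT1 end
  end.

Lemma subalgL : subalg (@algL k).
Proof.
have n01 : (0 : k) != 1 by rewrite eq_sym oner_eq0.
by have <- := centraliser_L n01; exact: subalg_centraliser.
Qed.

Lemma eqvL_ex Z : exists x, eqv (@algL k) Z (Lform_mx x).
Proof.
rewrite [Z]mx3_eta; move: (Z o0 o0) (Z o0 o1) (Z o0 o2) (Z o1 o0) (Z o1 o1) (Z o1 o2)
  (Z o2 o0) (Z o2 o1) (Z o2 o2) => a b c d e f g h i.
have cyc x y : x * (x * b + y * e) - y * (x * a + y * d) != 0 ->
    exists x, eqv (@algL k) (mx3 a b c d e f g h i) (Lform_mx x).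
  move=> D0; exists (i, inr (b * d - a * e, a + e)).
  exists (mx3 x y 0 (x * a + y * d) (x * b + y * e) 0 0 0 1); first by do 5!eexists.
  split; first by rewrite mx3_unit; apply: contra D0 => /eqP <-; apply/eqP; ring.
  by rewrite /= !mx3E; apply/orth_algL; split; ring.
have [b0|b0] := eqVneq b 0; last first.
  by apply: (cyc 1 0); apply: contra b0 => /eqP <-; apply/eqP; ring.
have [d0|d0] := eqVneq d 0; last first.
  by apply: (cyc 0 1); rewrite -oppr_eq0; apply: contra d0 => /eqP <-; apply/eqP; ring.
have [ae|ae] := eqVneq a e; last first.
  apply: (cyc 1 1); rewrite b0 d0 -oppr_eq0; apply: contra ae => /eqP E.
  by rewrite -subr_eq0 -E; apply/eqP; ring.
exists (i, inl a); apply: eqv_orth; first exact: subalgL.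
by rewrite /= b0 d0 ae !mx3E; apply/orth_algL; split; ring.
Qed.

Lemma eqvL_inj (x y : Lform) : eqv (@algL k) (Lform_mx x) (Lform_mx y) -> x = y.
Proof.
move=> [_ [p [q [r [s [t ->]]]]]]; rewrite mx3_unit.
rewrite (_ : _ + _ = (p * s - q * r) * t); last by ring.
rewrite mulf_eq0 negb_or => -[/andP[D0 t0]].
case: x => [e [a|[a b]]]; case: y => [e' [a'|[a' b']]]; rewrite /= !mx3E => /orth_algL[E1 E2 E3 E4 E5];
  (have -> : e = e' by apply: (mulfI t0); apply/eqP; rewrite -subr_eq0 -[X in _ == X]E5; apply/eqP; ring).
- have [->|aa] := eqVneq a a'; first by [].
  have z u : (a - a') * u = 0 -> u = 0.
    by move=> /eqP; rewrite mulf_eq0 subr_eq0 (negPf aa) => /eqP.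
  have p0 : p = 0 by apply: z; rewrite -E1; ring.
  have q0 : q = 0 by apply: z; rewrite -E2; ring.
  by move: D0; rewrite p0 q0 !mul0r subrr eqxx.
- case/eqP: D0; have -> : r = p * a by apply/eqP; rewrite eq_sym -subr_eq0 -[X in _ == X]E1; apply/eqP; ring.
  have -> : s = q * a by apply/eqP; rewrite eq_sym -subr_eq0 -[X in _ == X]E2; apply/eqP; ring.
  by ring.
- case/eqP: D0; have -> : p = q * (a' - b) by apply/eqP; rewrite -subr_eq0 -[X in _ == X]E2; apply/eqP; ring.
  have -> : r = s * (a' - b) by apply/eqP; rewrite -subr_eq0 -[X in _ == X]E4; apply/eqP; ring.
  by ring.
- have rE : r = q * a by apply/eqP; rewrite eq_sym -subr_eq0 -[X in _ == X]E1; apply/eqP; ring.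
  have sE : s = p + q * b by apply/eqP; rewrite eq_sym -subr_eq0 -[X in _ == X]E2; apply/eqP; ring.
  have F1 : p * (a - a') + r * (b - b') = 0 by rewrite -E3 sE rE; ring.
  have F2 : q * (a - a') + s * (b - b') = 0 by rewrite -E4 rE; ring.
  have G1 : (p * s - q * r) * (a - a') = 0.
    rewrite [LHS](_ : _ = s * (p * (a - a') + r * (b - b')) - r * (q * (a - a') + s * (b - b'))); last by ring.
    by rewrite F1 F2 !mulr0 subrr.
  have G2 : (p * s - q * r) * (b - b') = 0.
    rewrite [LHS](_ : _ = p * (q * (a - a') + s * (b - b')) - q * (p * (a - a') + r * (b - b'))); last by ring.
    by rewrite F1 F2 !mulr0 subrr.
  move: G1 G2 => /eqP + /eqP; rewrite !mulf_eq0 (negPf D0) !subr_eq0 /= => /eqP-> /eqP->.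
  by [].
Qed.

(** The stabiliser does not depend on [e]. Putting in its place an [r] that is not an eigenvalue of
    the block makes the matrix regular, and its centraliser is then contained in [algL]. *)
Lemma radf_Lform (e a b r : k) : ~~ root (pq (a, b)) r ->
  radf (@algL k) (mx3 0 1 0 a b 0 0 0 e) = centraliser (mx3 0 1 0 a b 0 0 0 r).
Proof.
rewrite rootE horner_quad => nr; apply/seteqP; split=> X.
  move=> [[x [y [z [t [u ->]]]]]]; rewrite !mx3E => /orth_algL[E1 E2 E3 E4 _].
  have sub0 (v w d : k) : d = 0 -> v - w = d -> v = w.
    by move=> -> /eqP; rewrite subr_eq0 => /eqP.
  rewrite /centraliser /= !mx3E; apply: mx3_eq;
    first [ring | apply: sub0 E1 _; ring | apply: sub0 E2 _; ring
       | apply: sub0 E3 _; ring | apply: sub0 E4 _; ring].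
rewrite /centraliser /= [X]mx3_eta; move: (X o0 o0) (X o0 o1) (X o0 o2) (X o1 o0) (X o1 o1) (X o1 o2)
  (X o2 o0) (X o2 o1) (X o2 o2) => x00 x01 x02 x10 x11 x12 x20 x21 x22.
rewrite !mx3E => /mx3_inj[[E1 E2 E3] [[E4 E5 E6] [E7 E8 _]]].
rewrite !mul01E in E1 E2 E3 E4 E5 E6 E7 E8.
have z u : (r ^+ 2 - b * r - a) * u = 0 -> u = 0.
  by move=> /eqP; rewrite mulf_eq0 (negPf nr) => /eqP.
have h02 : x02 = 0.
  apply: z; rewrite [LHS](_ : _ = x02 * r * r - (a * x02 + b * (x02 * r))); last by ring.
  by rewrite {2 1}E3 E6 subrr.
have h21 : x21 = 0.
  apply: z; rewrite [LHS](_ : _ = r * (r * x21 - x21 * b) - x21 * a); last by ring.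
  by rewrite -E8 addrK -E7 subrr.
have h12 : x12 = 0 by rewrite -E3 h02 mul0r.
have h20 : x20 = 0 by move: E8; rewrite h21 !mul01E.
rewrite h02 h21 h12 h20; split; first by do 5!eexists.
rewrite !mx3E; apply/orth_algL; split; rewrite ?mul01E.
- by rewrite E1 subrr.
- by rewrite E2 subrr.
- by rewrite E4 subrr.
- by rewrite E5 subrr.
- by rewrite mulrC subrr.
Qed.

Lemma Lform_minpoly (a b r : k) : ~~ root (pq (a, b)) r ->
  mxminpoly (mx3 0 1 0 a b 0 0 0 r) = ('X - r%:P) * pq (a, b).
Proof.
rewrite rootE horner_quad => nr; rewrite /pq mulXquad /=.
have sz : size (mxminpoly (mx3 0 1 0 a b 0 0 0 r)) = 4.
  apply: size_minpoly_free => [x y z|].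
    rewrite !mx3E => /mx3_inj[[E1 E2 _] [_ [_ _ E3]]].
    rewrite !mul01E in E1 E2 E3.
    have /eqP : (r ^+ 2 - b * r - a) * z = 0; last by rewrite mulf_eq0 (negPf nr) => /eqP.
    rewrite [LHS](_ : _ = (x + y * r + z * (r * r)) - (x + z * a) - r * (y + z * b)); last by ring.
    by rewrite E1 E2 E3 mulr0 !subr0.
  apply/negP => /is_scalar_mxP[x]; rewrite mx3_scalar => /mx3_inj[[_ /eqP]].
  by rewrite oner_eq0.
apply: mxminpoly_eq; rewrite ?cub_monic ?sz ?size_cub //.
by rewrite horner_mx_cub !mx3E; apply: mx3_eq; ring.
Qed.

(** For [q = 2] every element of [k] is an eigenvalue of the block, so [radf_Lform] has no [r] to
    offer. Instead [Q], built from the left eigenvectors of the block, diagonalises the functional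
    and preserves [algL]. *)
Lemma radf_Lform_split (e b c : k) : b != c ->
  lie_class typeT1 (radf (@algL k) (mx3 0 1 0 (- (b * c)) (b + c) 0 0 0 e)).
Proof.
move=> bc; have bc0 : b - c != 0 by rewrite subr_eq0.
pose Q : 'M[k]_3 := mx3 (- c) 1 0 (- b) 1 0 0 0 1.
pose P : 'M[k]_3 := mx3 (b - c)^-1 (- (b - c)^-1) 0 (b / (b - c)) (- (c / (b - c))) 0 0 0 1.
have QP : Q *m P = 1%:M.
  by rewrite /P /Q !mx3E; apply: mx3_eq; field.
have [uQ QV] := unitmx_of_mulmx QP.
have LQ : conjs Q (@algL k) = @algL k.
  apply/seteqP; split=> X.
    move=> [_ [x [y [z [t [u ->]]]]] <-]; rewrite QV /P /Q !mx3M.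
    by do 5!eexists; apply: mx3_eq; try reflexivity; ring.
  move=> [x [y [z [t [u ->]]]]]; apply/conjsP => //; rewrite QV /P /Q !mx3M.
  by do 5!eexists; apply: mx3_eq; try reflexivity; ring.
set Z := mx3 0 1 0 _ _ _ _ _ _.
have QZ : Q *m Z *m invmx Q = mx3 b 0 0 0 c 0 0 0 e.
  by rewrite QV /P /Q /Z !mx3E; apply: mx3_eq; field.
have := radf_conjs (@algL k) Z uQ; rewrite LQ QZ.
move=> /(congr1 (conjs (invmx Q))); rewrite conjsK // => <-.
apply: lie_class_conjs; first by rewrite unitmx_inv.
rewrite (_ : radf _ _ = [set X | is_diag_mx X]); first by exists 1%:M; rewrite ?unitmx1 // -/(conjs _ _) conjs1.
apply/seteqP; split=> X.
  move=> [[x [y [z [t [u ->]]]]]]; rewrite !mx3E => /orth_algL[_ E1 E2 _ _].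
  have cb : c != b by rewrite eq_sym.
  have -> : y = 0.
    apply: (mul_neq_eq0 cb); apply/eqP; rewrite -subr_eq0 -[X in _ == X]E1.
    by apply/eqP; ring.
  have -> : z = 0.
    apply: (mul_neq_eq0 bc); apply/eqP; rewrite -subr_eq0 -[X in _ == X]E2.
    by apply/eqP; ring.
  by apply/diag_mx3; exists x, t, u.
move=> /diag_mx3[x [y [z ->]]]; split; first by do 5!eexists.
by rewrite !mx3E; apply/orth_algL; split; ring.
Qed.

Lemma transversalL : orb_transversal (@algL k) Lform_mx Lform_type.
Proof.
split; [exact: eqvL_ex|exact: eqvL_inj|move=> [e [a|[a b]]]].
  apply/lie_class_std => //; exists 1%:M; rewrite ?unitmx1 // conjs1 /=.
  apply/seteqP; split=> [X []//|_ [x [y [z [t [u ->]]]]]]; split; first by do 5!eexists.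
  by rewrite !mx3E; apply/orth_algL; split; ring.
rewrite /Lform_type /Lform_mx; have [pm sp] := pq_monic (a, b).
case: (quadP pm sp) => [b1 b2 bb pE|b1 pE|nr].
- move: pE; rewrite mulXX /pq /= => /quad_inj[-> ->]; exact: radf_Lform_split.
(* The block has the single eigenvalue [b1], so [b1 + 1] can serve as [r]; without eigenvalues in
   [k], [0] does below. *)
- have nr : ~~ root (pq (a, b)) (b1 + 1).
    by rewrite pE rootM orbb root_XsubC -subr_eq0 [b1 + 1]addrC addrK oner_eq0.
  rewrite (radf_Lform e nr); apply/lie_class_reg => //; eexists; last by [].
  rewrite (Lform_minpoly nr); exists (b1 + 1), b1; rewrite pE expr2; split=> //.
  by rewrite -subr_eq0 [b1 + 1]addrC addrK oner_eq0.
- rewrite (radf_Lform e (nr 0)); apply/lie_class_reg => //; eexists; last by [].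
  rewrite (Lform_minpoly (nr 0)); exists 0, (pq (a, b)); split=> //.
  exact: pq_irreducible.
Qed.

End TransversalL.

(** * Type J: orbits on the dual of [algJ] *)

Section TransversalJ.
Variable k : finFieldType.
Implicit Types (X Y V : 'M[k]_3) (h : set 'M[k]_3) (a b c : k).

Lemma orth_algJ (a b c d e f g h i : k) :
  orth (@algJ k) (mx3 a b c d e f g h i) <-> [/\ d = 0, g = 0, h = 0, e = 0 & a + i = 0].
Proof.
split=> [o|[-> -> -> -> ai] _ [x [y [z [t [u ->]]]]]]; last first.
  by rewrite !mx3E !mul01E -mulrDl ai mul0r.
have mem x y z t u : algJ (mx3 x y z 0 t u 0 0 (x : k)) by do 5!eexists.
move: (o _ (mem 0 1 0 0 0)) (o _ (mem 0 0 1 0 0)) (o _ (mem 0 0 0 0 1)) (o _ (mem 0 0 0 1 0)) (o _ (mem 1 0 0 0 0)).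
by rewrite !mx3E !mul01E.
Qed.

Lemma sub_eq_of (v w d : k) : d = 0 -> v - w = d -> v = w.
Proof. by move=> -> /eqP; rewrite subr_eq0 => /eqP. Qed.

Definition nz : Type := {x : k | x != 0}.
HB.instance Definition _ := Finite.on nz.

Definition Jform : Type := ((k * k + k * k * nz) + (k * nz + (k + k)))%type.
HB.instance Definition _ := Finite.on Jform.

(* A functional on [algJ] is given by the trace pairing with the entries
   (0,0)+(2,2), (1,1), (1,0), (2,0), (2,1). *)
Definition Jform_mx (x : Jform) : 'M[k]_3 :=
  match x with
  | inl (inl (a, d)) => mx3 a 0 0 0 d 0 0 0 0
  | inl (inr (a, d, c)) => mx3 a 0 0 0 d 0 (val c) 0 0
  | inr (inl (d, e)) => mx3 0 0 0 1 d 0 0 (val e) 0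
  | inr (inr (inl d)) => mx3 0 0 0 1 d 0 0 0 0
  | inr (inr (inr d)) => mx3 0 0 0 0 d 0 0 1 0
  end.

Definition Jform_type (x : Jform) : stype :=
  match x with
  | inl (inl _) => typeJ
  | inl (inr _) => typeM
  | inr (inl _) => typeN
  | inr (inr (inl _)) => typeK0
  | inr (inr (inr _)) => typeKinf
  end.

(** A nonzero coordinate at (2,0) clears those at (1,0) and (2,1). If it is zero, a nonzero
    coordinate at (1,0) or (2,1) is scaled to 1 and absorbs (0,0)+(2,2), so that the full trace
    survives at (1,1); if both are nonzero, their product survives too. *)
Lemma eqvJ_ex Z : exists x, eqv (@algJ k) Z (Jform_mx x).
Proof.
rewrite [Z]mx3_eta; move: (Z o0 o0) (Z o0 o1) (Z o0 o2) (Z o1 o0) (Z o1 o1) (Z o1 o2)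
  (Z o2 o0) (Z o2 o1) (Z o2 o2) => z00 z01 z02 z10 z11 z12 z20 z21 z22.
have go p q s t x : p != 0 -> s != 0 ->
    orth (@algJ k) (mx3 p q 0 0 s t 0 0 p *m mx3 z00 z01 z02 z10 z11 z12 z20 z21 z22
      - Jform_mx x *m mx3 p q 0 0 s t 0 0 p) ->
    exists x, eqv (@algJ k) (mx3 z00 z01 z02 z10 z11 z12 z20 z21 z22) (Jform_mx x).
  move=> p0 s0 o; exists x, (mx3 p q 0 0 s t 0 0 p); first by do 5!eexists.
  split=> //; rewrite mx3_unit [X in X != 0](_ : _ = p * p * s); last by ring.
  by rewrite !mulf_neq0.
have n1 : (1 : k) != 0 by rewrite oner_eq0.
have [c0|c0] := eqVneq z20 0; last first.
  apply: (go 1 (z21 / z20) 1 (- (z10 / z20))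
    (inl (inr (z00 + z22 + z21 * z10 / z20, z11 - z10 * z21 / z20, exist _ z20 c0)))) => //.
  by rewrite /= !mx3E; apply/orth_algJ; split; field.
have [b0|b0] := eqVneq z10 0; have [e0|e0] := eqVneq z21 0.
- apply: (go 1 0 1 0 (inl (inl (z00 + z22, z11)))) => //.
  by rewrite /= c0 b0 e0 !mx3E; apply/orth_algJ; split; ring.
- apply: (go 1 0 z21 (z00 + z22) (inr (inr (inr (z00 + z22 + z11))))) => //.
  by rewrite /= c0 b0 !mx3E; apply/orth_algJ; split; ring.
- apply: (go z10 (- (z00 + z22)) 1 0 (inr (inr (inl (z00 + z22 + z11))))) => //.
  by rewrite /= c0 e0 !mx3E; apply/orth_algJ; split; ring.
- have be : z10 * z21 != 0 by rewrite mulf_neq0.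
  apply: (go z10 (- (z00 + z22)) 1 0 (inr (inl (z00 + z22 + z11, exist _ (z10 * z21) be)))) => //.
  by rewrite /= c0 !mx3E; apply/orth_algJ; split; ring.
Qed.

Lemma eqvJ_entries (a b c d e a' b' c' d' e' : k) :
  eqv (@algJ k) (mx3 a 0 0 b d 0 c e 0) (mx3 a' 0 0 b' d' 0 c' e' 0) ->
  exists p q s t : k, [/\ p != 0, s != 0 & [/\ s * b + t * c = b' * p, p * c = c' * p,
    p * e = c' * q + e' * s, s * d + t * e = b' * q + d' * s
    & exists r, p * a + q * b + r * c = a' * p + c' * r + e' * t]].
Proof.
move=> [_ [p [q [r [s [t ->]]]]]]; rewrite mx3_unit.
rewrite [X in X != 0](_ : _ = p * p * s); last by ring.
rewrite !mulf_eq0 orbb negb_or => -[/andP[p0 s0]].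
rewrite !mx3E => /orth_algJ[E1 E2 E3 E4 E5]; exists p, q, s, t; split=> //; split.
- by apply: sub_eq_of E1 _; ring.
- by apply: sub_eq_of E2 _; ring.
- by apply: sub_eq_of E3 _; ring.
- by apply: sub_eq_of E4 _; ring.
- by exists r; apply: sub_eq_of E5 _; ring.
Qed.

Lemma eqvJ_inj (x y : Jform) : eqv (@algJ k) (Jform_mx x) (Jform_mx y) -> x = y.
Proof.
have z (u v : k) : u != 0 -> u * v = 0 -> v = 0.
  by move=> u0 /eqP; rewrite mulf_eq0 (negPf u0) => /eqP.
have zr (u v : k) : u != 0 -> v * u = 0 -> v = 0 by move=> u0; rewrite mulrC; apply: z.
case: x => [[[a d]|[[a d] [c c0]]]|[[d [e e0]]|[d|d]]];
case: y => [[[a' d']|[[a' d'] [c' c'0]]]|[[d' [e' e'0]]|[d'|d']]] /= /eqvJ_entries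
  [p [q [s [t [p0 s0 [E1 E2 E3 E4 [r E5]]]]]]]; rewrite ?mul01E in E1 E2 E3 E4 E5;
  (* Most pairs from different families are excluded by comparing which coordinates vanish. *)
  try (by have := zr _ _ p0 (esym E2) => /eqP; rewrite ?(negPf c'0));
  try (by have := z _ _ p0 E2 => /eqP; rewrite ?(negPf c0));
  try (by have := zr _ _ p0 (esym E1) => /eqP; rewrite ?oner_eq0);
  try (by move: p0; rewrite -E1 eqxx);
  try (by move: s0; rewrite E1 eqxx);
  try (by move: s0; rewrite -E3 eqxx);
  try (by move: p0; rewrite E3 eqxx);
  try (by have := zr _ _ s0 (esym E3) => /eqP; rewrite ?(negPf e'0)).
- have -> : d = d' by apply: (mulfI s0); rewrite E4 mulrC.
  by have -> : a = a' by apply: (mulfI p0); rewrite E5 mulrC.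
- have cc : c = c' by apply: (mulfI p0); rewrite E2 mulrC.
  have -> : d = d' by apply: (mulfI s0); rewrite E4 mulrC.
  have -> : a = a' by apply: (mulfI p0); apply: (addIr (r * c)); rewrite E5 cc mulrC [c' * r]mulrC.
  by congr (inl (inr (_, _))); apply: val_inj.
- have ee : e = e' by apply: (mulfI p0); rewrite E3 E1 mulrC.
  have -> : d = d' by apply: (mulfI s0); apply: (addIr (t * e)); rewrite E4 E5 ee addrC [e' * t]mulrC [d' * s]mulrC.
  by congr (inr (inl (_, _))); apply: val_inj.
- by have := z _ _ p0 E3 => /eqP; rewrite (negPf e0).
- have -> : d = d' by apply: (mulfI s0); rewrite E4 E5 add0r mulrC.
  by [].
- have -> : d = d' by apply: (mulfI s0); apply: (addIr t); rewrite E4 -E5 addr0 mulrC.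
  by [].
Qed.

Lemma comm_algJ (p q r s t a b c d e : k) :
  orth (@algJ k) (mx3 p q r 0 s t 0 0 p *m mx3 a 0 0 b d 0 c e 0 -
                  mx3 a 0 0 b d 0 c e 0 *m mx3 p q r 0 s t 0 0 p) <->
  [/\ s * b + t * c = b * p, p * e = c * q + e * s, t * e = b * q
    & q * b = e * t].
Proof.
rewrite !mx3E; split=> [/orth_algJ[E1 E2 E3 E4 E5]|[E1 E3 E4 E5]].
  split.
  - by apply: sub_eq_of E1 _; ring.
  - by apply: sub_eq_of E3 _; ring.
  - by apply: sub_eq_of E4 _; ring.
  - by apply: sub_eq_of E5 _; ring.
apply/orth_algJ; split.
- by rewrite [LHS](_ : _ = (s * b + t * c) - b * p) ?E1 ?subrr //; ring.
- by ring.
- by rewrite [LHS](_ : _ = p * e - (c * q + e * s)) ?E3 ?subrr //; ring.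
- by rewrite [LHS](_ : _ = t * e - b * q) ?E4 ?subrr //; ring.
- by rewrite [LHS](_ : _ = q * b - e * t) ?E5 ?subrr //; ring.
Qed.

Lemma transversalJ : orb_transversal (@algJ k) Jform_mx Jform_type.
Proof.
split; [exact: eqvJ_ex|exact: eqvJ_inj|].
have n1 : (1 : k) != 0 by rewrite oner_eq0.
have std s h : is_std s -> h = @std_alg k s -> lie_class s h.
  by move=> st ->; apply/lie_class_std => //; exists 1%:M; rewrite ?unitmx1 // conjs1.
case=> [[[a d]|[[a d] [c c0]]]|[[d [e e0]]|[d|d]]]; rewrite /Jform_type /Jform_mx.
- apply: std => //; apply/seteqP; split=> [X []//|_ [p [q [r [s [t ->]]]]]].
  split; first by do 5!eexists.
  by apply/comm_algJ; split; ring.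
(* A nonzero coordinate at (2,0) forces [q = t = 0]; the remaining matrices form the centraliser of
   $E_{13} + E_{22}$. *)
- apply/lie_class_reg => //; exists (mx3 0 0 1 0 1 0 0 0 0).
    exists 1, 0; split=> //; rewrite XsubC12 mulXquad.
    apply: mxminpoly_eq; rewrite ?cub_monic ?size_cub //.
      by rewrite horner_mx_cub !mx3E; apply: mx3_eq; ring.
    rewrite size_minpoly_free // => [x y z|].
      rewrite !mx3E => /mx3_inj[[E1 _ E2] [[_ E3 _] _]]; rewrite !mul01E in E1 E2 E3.
      by move: E3; rewrite E1 E2 !add0r.
    apply/negP => /is_scalar_mxP[x]; rewrite mx3_scalar => /mx3_inj[[_ _ /eqP]].
    by rewrite (negPf n1).
  apply/seteqP; split=> X.
    move=> [[p [q [r [s [t ->]]]]] /comm_algJ[E1 E2 _ _]].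
    rewrite !mul01E in E1 E2.
    have -> : t = 0 by move/eqP: E1; rewrite mulf_eq0 (negPf c0) orbF => /eqP.
    have -> : q = 0 by move/esym/eqP: E2; rewrite mulf_eq0 (negPf c0) => /eqP.
    by rewrite /centraliser /= !mx3E; apply: mx3_eq; ring.
  rewrite /centraliser /= [X]mx3_eta; move: (X o0 o0) (X o0 o1) (X o0 o2) (X o1 o0)
    (X o1 o1) (X o1 o2) (X o2 o0) (X o2 o1) (X o2 o2) => x00 x01 x02 x10 x11 x12 x20 x21 x22.
  rewrite !mx3E => /mx3_inj[[E1 E2 E3] [[E4 _ E5] [_ E6 E7]]].
  rewrite !mul01E in E1 E2 E3 E4 E5 E6 E7.
  rewrite E2 -E5 -E3 E6 -E4 E7; split; first by do 5!eexists.
  by apply/comm_algJ; split; ring.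
(* Here [s = p] and [q = t * e], so the stabiliser consists of the polynomials in the regular
   nilpotent matrix $e E_{12} + E_{23}$. *)
- apply/lie_class_reg => //; exists (mx3 0 e 0 0 0 1 0 0 0).
    exists 0; rewrite XsubC3 mulXquad.
    apply: mxminpoly_eq; rewrite ?cub_monic ?size_cub //.
      by rewrite horner_mx_cub !mx3E; apply: mx3_eq; ring.
    rewrite size_minpoly_free // => [x y z|].
      rewrite !mx3E => /mx3_inj[[_ _ E1] _]; rewrite !mul01E in E1.
      by move/eqP: E1; rewrite mulf_eq0 (negPf e0) orbF => /eqP.
    apply/negP => /is_scalar_mxP[x]; rewrite mx3_scalar => /mx3_inj[[_ /eqP]].
    by rewrite (negPf e0).
  apply/seteqP; split=> X.
    move=> [[p [q [r [s [t ->]]]]] /comm_algJ[E1 _ E3 _]].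
    rewrite !mul01E in E1 E3.
    by rewrite E1 -E3 /centraliser /= !mx3E; apply: mx3_eq; ring.
  rewrite /centraliser /= [X]mx3_eta; move: (X o0 o0) (X o0 o1) (X o0 o2) (X o1 o0)
    (X o1 o1) (X o1 o2) (X o2 o0) (X o2 o1) (X o2 o2) => x00 x01 x02 x10 x11 x12 x20 x21 x22.
  rewrite !mx3E => /mx3_inj[[E1 E2 E3] [[E4 _ E5] [_ _ E6]]].
  rewrite !mul01E in E1 E2 E3 E4 E5 E6.
  have h10 : x10 = 0 by move/esym/eqP: E1; rewrite mulf_eq0 (negPf e0) => /eqP.
  have h00 : x00 = x11 by apply: (mulfI e0); rewrite -E2 mulrC.
  rewrite E3 h10 -E4 E6 -E5 h00; split; first by do 5!eexists.
  by apply/comm_algJ; split; ring.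
- apply: std => //; apply/seteqP; split=> X.
    move=> [[p [q [r [s [t ->]]]]] /comm_algJ[E1 _ E3 _]].
    rewrite !mul01E in E1 E3.
    by apply/algK0E; rewrite E1 -E3; do 3!eexists.
  move=> /algK0E[p [r [t ->]]]; split; first by do 5!eexists.
  by apply/comm_algJ; split; ring.
(* The stabiliser is spanned by the identity, $E_{12}$ and $E_{13}$; exchanging the first two basis
   vectors turns it into [algKinf]. *)
- apply/lie_class_std => //; exists (mx3 0 1 0 1 0 0 0 0 1).
    by rewrite mx3_unit (_ : _ + _ = -1) ?oppr_eq0 //; ring.
  have PP : mx3 0 1 0 1 0 0 0 0 1 *m mx3 0 1 0 1 0 0 0 0 1 = 1%:M :> 'M[k]_3.
    by rewrite !mx3E; apply: mx3_eq; ring.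
  have [uP PV] := unitmx_of_mulmx PP.
  apply/seteqP; split=> X.
    move=> [[p [q [r [s [t ->]]]]] /comm_algJ[_ E2 _ E4]].
    rewrite !mul01E in E2 E4; apply/conjsP => //; rewrite PV; apply/algKinfE.
    exists p, q, r; rewrite -E4 E2 !mx3E; apply: mx3_eq; ring.
  move=> /(conjsP _ _ uP); rewrite PV => /algKinfE[p [q [r E]]].
  have -> : X = mx3 p q r 0 p 0 0 0 p.
    rewrite -[X]mul1mx -PP -[LHS]mulmx1 -PP.
    rewrite -!mulmxA [X *m (_ *m _)]mulmxA [mx3 _ _ _ _ _ _ _ _ _ *m (X *m _ *m _)]mulmxA.
    rewrite [mx3 0 1 0 1 0 0 0 0 1 *m (X *m mx3 0 1 0 1 0 0 0 0 1)]mulmxA E !mx3E.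
    by apply: mx3_eq; ring.
  split; first by do 5!eexists.
  by apply/comm_algJ; split; ring.
Qed.

End TransversalJ.

(** * Commutative types: the trivial action on the dual *)

Section TransversalComm.
Variable k : finFieldType.
Implicit Types (X Y V W : 'M[k]_3) (h : set 'M[k]_3) (a b c : 'M[k]_3).

(* By finiteness of [k] the inverse is a power. *)
Lemma subalg_inv h (g : 'M[k]_3) : subalg h -> h g -> g \in unitmx -> h (invmx g).
Proof.
move=> [hs h1 hM] hg ug.
have hX n : h (g ^+ n) by elim: n => [|n IH]; rewrite ?expr0 // exprS; apply: hM.
have ugi m : g ^+ m \in unitmx by apply: (unitrX m ug).
have [i [j [ij E]]] : exists i j, (i < j)%N /\ g ^+ i = g ^+ j.
  pose f (i : 'I_(#|{: 'M[k]_3}|.+1)) := g ^+ i.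
  have /injectivePn[i [j ij Eij]] : ~~ injectiveb f.
    by apply/negP => /injectiveP /leq_card; rewrite card_ord ltnn.
  move: ij; rewrite neq_ltn => /orP[lt|lt]; first by exists i, j.
  by exists j, i.
have E1 : g *m g ^+ (j - i).-1 = 1%:M.
  apply: (can_inj (mulKmx (ugi i))).
  rewrite mulmx1 !mulmxE -exprS -exprD prednK ?subn_gt0 // subnKC ?(ltnW ij) //.
by have [_ ->] := unitmx_of_mulmx E1.
Qed.

Lemma dual_elt h X : is_subspace h -> ~ h X -> exists W, orth h W /\ \tr (W *m X) = 1.
Proof.
move=> hs nX; apply: contrapT => nW; apply: nX; apply: orth_orth => // W oW.
apply: contrapT => /eqP t0; apply: nW; exists ((\tr (X *m W))^-1 *: W); split.
  by have [_ _ oZ] := orth_subspace h; apply: oZ.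
by rewrite -scalemxAl mxtraceZ [\tr (W *m X)]mxtrace_mulC mulVf.
Qed.

Lemma dual_basis3 h b c : span3 h b c -> exists W1 W2 W3,
  [/\ \tr W1 = 1, \tr (W1 *m b) = 0 & \tr (W1 *m c) = 0] /\
  [/\ \tr W2 = 0, \tr (W2 *m b) = 1 & \tr (W2 *m c) = 0] /\
  [/\ \tr W3 = 0, \tr (W3 *m b) = 0 & \tr (W3 *m c) = 1].
Proof.
move=> [_ free _].
have sub2 u v : is_subspace [set X | exists y z : k, X = y *: u + z *: v].
  split=> [|X Y [y [z ->]] [y' [z' ->]]|x X [y [z ->]]].
  - by exists 0, 0; rewrite !scale0r addr0.
  - by exists (y + y'), (z + z'); rewrite !scalerDl addrACA.
  - by exists (x * y), (x * z); rewrite scalerDr !scalerA.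
have in2 u v W : orth [set X | exists y z : k, X = y *: u + z *: v] W ->
    \tr (W *m u) = 0 /\ \tr (W *m v) = 0.
  move=> o; split; apply: o.
    by exists 1, 0; rewrite scale1r scale0r addr0.
  by exists 0, 1; rewrite scale1r scale0r add0r.
have n1 : (-1 : k) = 0 -> False by move/eqP; rewrite oppr_eq0 oner_eq0.
have [|W1 [/in2[o1 o2] t1]] := dual_elt (sub2 b c) (X := 1%:M).
  move=> [y [z E]]; have [] // := free (-1) y z.
  by rewrite -addrA -E raddfN /= addNr.
have [|W2 [/in2[o3 o4] t2]] := dual_elt (sub2 1%:M c) (X := b).
  move=> [y [z E]]; have [] // := free y (-1) z.
  by rewrite scaleN1r addrAC -scalemx1 -E subrr.
have [|W3 [/in2[o5 o6] t3]] := dual_elt (sub2 1%:M b) (X := c).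
  move=> [y [z E]]; have [] // := free y z (-1).
  by rewrite scaleN1r -scalemx1 -E subrr.
rewrite !mulmx1 in t1 o3 o5.
by exists W1, W2, W3.
Qed.

(** Units of a commutative [h] fix every functional on [h], and so does [h] infinitesimally. Each
    functional is thus an orbit with stabiliser [h], and it is given by its values on [1], [b], [c]
    through the dual basis. *)
Lemma transversal_comm h b c s : span3 h b c -> subalg h -> lie_class s h ->
  exists nf : k * k * k -> 'M[k]_3, orb_transversal h nf (fun=> s).
Proof.
move=> sp ha hs; have [W1 [W2 [W3 [[a1 a2 a3] [[b1 b2 b3] [c1 c2 c3]]]]]] := dual_basis3 sp.
have [hE _ bc] := sp.
have comm X Y : h X -> h Y -> X *m Y = Y *m X.
  have cb x y z x' y' z' : (x%:M + y *: b + z *: c) *m (x'%:M + y' *: b + z' *: c) =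
     (x * x')%:M + (x * y' + y * x') *: b + (x * z' + z * x') *: c +
     ((y * y') *: (b *m b) + (y * z' + z * y') *: (b *m c) + (z * z') *: (c *m c)).
    rewrite !mulmxDl !mulmxDr !mul_scalar_mx !mul_mx_scalar -!scalemxAl -!scalemxAr.
    rewrite !scalerA scale_scalar_mx -bc.
    move: (b *m b) (b *m c) (c *m c) => bb bc' cc.
    by apply/matrixP => i j; rewrite !mxE; case: (i == j); rewrite ?mulr1n ?mulr0n; ring.
  move=> /hE[x [y [z ->]]] /hE[x' [y' [z' ->]]]; rewrite !cb.
  by rewrite (mulrC x x') (mulrC y y') (mulrC z z'); congr (_%:M + _ *: _ + _ *: _ + (_ + _ *: _ + _)); ring.
pose nf (t : k * k * k) := t.1.1 *: W1 + t.1.2 *: W2 + t.2 *: W3.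
have nfE t : [/\ \tr (nf t) = t.1.1, \tr (nf t *m b) = t.1.2 & \tr (nf t *m c) = t.2].
  rewrite /nf !mulmxDl -!scalemxAl !mxtraceD !mxtraceZ.
  by rewrite a1 a2 a3 b1 b2 b3 c1 c2 c3 !mulr0 !mulr1 !addr0 !add0r.
have orthE Z : \tr Z = 0 -> \tr (Z *m b) = 0 -> \tr (Z *m c) = 0 -> orth h Z.
  move=> z1 z2 z3 X /hE[x [y [z ->]]].
  rewrite !mulmxDr mul_mx_scalar -!scalemxAr !mxtraceD !mxtraceZ z1 z2 z3.
  by rewrite !mulr0 !addr0.
have [h1 hb hc] : [/\ h 1%:M, h b & h c].
  split; first by case: ha.
    by apply/hE; exists 0, 1, 0; rewrite raddf0 scale1r scale0r add0r addr0.
  by apply/hE; exists 0, 0, 1; rewrite raddf0 scale1r scale0r !add0r.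
exists nf; split=> [Z|t t' [g hg [ug o]]|t].
- exists (\tr Z, \tr (Z *m b), \tr (Z *m c)); set t := (_, _, _).
  have [n1 n2 n3] := nfE t.
  apply: eqv_orth => //; apply: orthE; rewrite ?mulmxBl raddfB /= ?n1 ?n2 ?n3 subrr //.
- have o' : orth h (nf t - nf t').
    move=> X hX; have hgX : h (invmx g *m X).
      by have [_ _ hM] := ha; apply: hM => //; exact: subalg_inv.
    have gc : invmx g *m X = X *m invmx g by apply: comm => //; exact: subalg_inv.
    have := o _ hgX; rewrite !mulmxBl !raddfB /= {1}gc !mulmxA.
    by rewrite -(mulmxA (_ *m g)) mulmxA mulmxK // -(conj_mxtrace (nf t *m X) ug) !mulmxA.
  have [n1 n2 n3] := nfE t; have [m1 m2 m3] := nfE t'.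
  have := o' _ h1; rewrite mulmx1 raddfB /= n1 m1 => /eqP; rewrite subr_eq0 => /eqP e1.
  have := o' _ hb; rewrite mulmxBl raddfB /= n2 m2 => /eqP; rewrite subr_eq0 => /eqP e2.
  have := o' _ hc; rewrite mulmxBl raddfB /= n3 m3 => /eqP; rewrite subr_eq0 => /eqP e3.
  by case: t t' {n1 n2 n3 m1 m2 m3 o o'} e1 e2 e3 => [[x y] z] [[x' y'] z'] /= -> -> ->.
- rewrite (_ : radf h _ = h) //; apply/seteqP; split=> [X []//|X hX]; split=> // Y hY.
  rewrite mulmxBl raddfB /= -!mulmxA [X in X - _]mxtrace_mulC -!mulmxA.
  by rewrite (comm Y X) // subrr.
Qed.

End TransversalComm.

(** * Counting orbits *)

(* Coefficients of [6 * a_{s,t}], the constant term first. *)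
Definition acoef (s t : stype) : seq int :=
  match s, t with
  | typeG, (typeG | typeJ | typeN) => [:: 0; 6; 0; 0]
  | typeG, (typeL | typeM) => [:: 0; - 6%:Z; 6; 0]
  | typeG, typeT1 => [:: 0; 2; - 3%:Z; 1]
  | typeG, typeT2 => [:: 0; 0; - 3%:Z; 3]
  | typeG, typeT3 => [:: 0; - 2%:Z; 0; 2]
  | typeL, (typeL | typeM) => [:: 0; 0; 6; 0]
  | typeL, (typeT1 | typeT2) => [:: 0; 0; - 3%:Z; 3]
  | typeJ, typeJ => [:: 0; 0; 6; 0]
  | typeJ, typeM => [:: 0; 0; - 6%:Z; 6]
  | typeJ, typeN => [:: 0; - 6%:Z; 6; 0]
  | typeJ, (typeK0 | typeKinf) => [:: 0; 6; 0; 0]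
  | typeT1, typeT1 | typeT2, typeT2 | typeT3, typeT3 | typeM, typeM | typeN, typeN
  | typeK0, typeK0 | typeKinf, typeKinf => [:: 0; 0; 0; 6]
  | _, _ => [::]
  end.

Definition apoly (s t : stype) : {poly rat} :=
  \poly_(i < 4) (((acoef s t)`_i)%:~R / 6%:R).

Lemma over_Zinv6_apoly s t : over_Zinv6 (apoly s t).
Proof.
move=> i; rewrite /apoly coef_poly; case: ifP => _.
  by exists ((acoef s t)`_i), 1%N; rewrite expr1.
by exists 0, 0%N; rewrite mul0r.
Qed.

Lemma horner_apoly s t x : (apoly s t).[x] =
  (((acoef s t)`_0)%:~R + ((acoef s t)`_1)%:~R * x + ((acoef s t)`_2)%:~R * x ^+ 2
   + ((acoef s t)`_3)%:~R * x ^+ 3) / 6%:R.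
Proof.
rewrite /apoly horner_poly !big_ord_recl big_ord0 /= /bump /= expr0 expr1.
by rewrite !addn0 !add1n; ring.
Qed.

Section Counts.
Variable k : finFieldType.
Local Notation q := #|k|.
Local Notation Q := (#|k|%:R : rat).

Lemma card_sum_pred (A B : finType) (P : pred (A + B)) :
  #|[pred x | P x]| = (#|[pred a | P (inl a)]| + #|[pred b | P (inr b)]|)%N.
Proof. by rewrite !card_predE big_sumType. Qed.

Lemma card_prod_pred2 (A B : finType) (P : pred B) :
  #|[pred x : A * B | P x.2]| = (#|A| * #|[pred b | P b]|)%N.
Proof.
rewrite !card_predE -(pair_big xpredT xpredT (fun a b => P b : nat)) /=.
by rewrite sum_nat_const sum1_card.
Qed.

Lemma card_predT (A : finType) (b : bool) : #|[pred x : A | b]| = (b * #|A|)%N.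
Proof. by case: b; rewrite ?mul1n ?mul0n; [apply: eq_card|apply: eq_card0] => x; rewrite inE. Qed.

Lemma q_gt1 : exists n, q = n.+2.
Proof. by have := card_finNzRing_gt1 k; case: #|_| => [|[|n]] // _; exists n. Qed.

Lemma natrS_sub1 (n : nat) : n%:R = n.+1%:R - 1 :> rat.
Proof. by rewrite -natr1 addrK. Qed.

Lemma ratC2 : ('C(q, 2))%:R = Q * (Q - 1) / 2%:R :> rat.
Proof.
have [n ->] := q_gt1; apply: (@mulIf _ 2%:R) => //.
rewrite divfK // -natrS_sub1 -!natrM; congr _%:R.
by have := bin_ffact n.+2 2; rewrite !ffactnS ffactn0 /= muln1.
Qed.

Lemma ratC3 : ('C(q, 3))%:R = Q * (Q - 1) * (Q - 2%:R) / 6%:R :> rat.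
Proof.
have [n ->] := q_gt1; apply: (@mulIf _ 6%:R) => //.
rewrite divfK // (_ : n.+2%:R - 2%:R = n.+2%:R - 1 - 1); last by ring.
rewrite -!natrS_sub1 -!natrM; congr _%:R.
by have := bin_ffact n.+2 3; rewrite !ffactnS ffactn0 /= muln1 mulnA.
Qed.

Lemma rat_dpair : #|{: dpair k}|%:R = Q ^+ 2 - Q :> rat.
Proof.
have /(congr1 (fun m : nat => m%:R : rat)) := card_dpair k; rewrite natrM natrD expr2 => ->.
by rewrite addrAC subrr add0r.
Qed.

Lemma rat_nirr2 : (nirr2 k)%:R = Q * (Q - 1) / 2%:R :> rat.
Proof.
have /(congr1 (fun m : nat => m%:R : rat)) := card_quads k; rewrite natrM !natrD ratC2 => E.
have -> : (nirr2 k)%:R = Q * Q - Q - Q * (Q - 1) / 2%:R :> rat by rewrite E; ring.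
by field.
Qed.

Lemma rat_nz : #|{: nz k}|%:R = Q - 1 :> rat.
Proof.
by rewrite card_sig -(cardC (pred1 (0 : k))) card1 natrD [X in _ = X - _]addrC addrK.
Qed.

Definition cub_count (t : stype) : rat :=
  match t with
  | typeT1 => Q * (Q - 1) * (Q - 2%:R) / 6%:R
  | typeT2 => Q * (Q * (Q - 1) / 2%:R)
  | typeT3 => (Q ^+ 3 - Q) / 3%:R
  | typeM => Q ^+ 2 - Q
  | typeN => Q
  | _ => 0
  end.

Lemma cub_countE t : #|[pred y : k * k * k | cub_type (pc y) == t]|%:R = cub_count t.
Proof.
have z t' : (forall p : {poly k}, p \is monic -> size p = 4 -> cub_type p != t') ->
    #|[pred y : k * k * k | cub_type (pc y) == t']|%:R = 0 :> rat.
  move=> h; rewrite (_ : #|_| = 0%N) //; apply: eq_card0 => y; rewrite inE.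
  by have [pm sp] := pc_monic y; rewrite (negPf (h _ pm sp)).
case: t => /=.
- by apply: z => p pm sp; case: (cubP pm sp).
- by apply: z => p pm sp; case: (cubP pm sp).
- by apply: z => p pm sp; case: (cubP pm sp).
- by rewrite card_cubT1 ratC3.
- by rewrite card_cubT2 natrM rat_nirr2.
(* The irreducible cubics are what remains of the $q^3$ monic cubics once the four other types are
   subtracted. *)
- have /(congr1 (fun m : nat => m%:R : rat)) := card_cubs k; rewrite !natrM !natrD.
  rewrite card_cubT1 card_cubT2 card_cubM card_cubN natrM rat_nirr2 ratC3 rat_dpair => E.
  apply: (addIr (Q * (Q - 1) * (Q - 2%:R) / 6%:R + Q * (Q * (Q - 1) / 2%:R) + (Q ^+ 2 - Q) + Q)).
  rewrite [LHS](_ : _ = Q * Q * Q); last by rewrite E; ring.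
  by field.
- by rewrite card_cubM rat_dpair.
- by rewrite card_cubN.
- by apply: z => p pm sp; case: (cubP pm sp).
- by apply: z => p pm sp; case: (cubP pm sp).
Qed.

Lemma countG t : #|[pred x : cform k | cform_type x == t]|%:R = (apoly typeG t).[Q].
Proof.
rewrite (@card_sum_pred _ _ (fun x => cform_type x == t)).
rewrite (@card_sum_pred _ _ (fun x => cform_type (inl x) == t)).
rewrite (@card_sum_pred _ _ (fun x => cform_type (inr x) == t)) /=.
rewrite (card_predT k (typeG == t)) (card_predT (dpair k) (typeL == t)) (card_predT k (typeJ == t)).
rewrite !natrD !natrM cub_countE rat_dpair horner_apoly.
by case: t => /=; field.
Qed.

Definition quad_count (t : stype) : rat :=
  match t with typeT1 | typeT2 => Q * (Q - 1) / 2%:R | typeM => Q | _ => 0 end.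

Lemma quad_countE t :
  #|[pred y : k * k | Lform_type (0 : k, inr y) == t]|%:R = quad_count t.
Proof.
have cnt n : (forall y : k * k, (Lform_type (0 : k, inr y) == t) = (#|rts (pq y)| == n)) ->
    #|[pred y : k * k | Lform_type (0 : k, inr y) == t]| = #|[pred y : k * k | #|rts (pq y)| == n]|.
  by move=> h; apply: eq_card => y; rewrite !inE h.
have z : (forall y : k * k, Lform_type (0 : k, inr y) != t) ->
    #|[pred y : k * k | Lform_type (0 : k, inr y) == t]|%:R = 0 :> rat.
  by move=> h; rewrite (_ : #|_| = 0%N) //; apply: eq_card0 => y; rewrite inE (negPf (h y)).
have tyE (y : k * k) : Lform_type (0 : k, inr y) =
    match #|rts (pq y)| with 0 => typeT2 | 1 => typeM | _ => typeT1 end by [].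
have spec (y : k * k) : quad_spec (pq y) #|rts (pq y)| by have [pm sp] := pq_monic y; exact: quadP.
case: t cnt z => cnt z; rewrite /quad_count;
  try (by apply: z => y; rewrite tyE; case: (spec y)).
- by rewrite (cnt 2) ?card_quad2 ?ratC2 // => y; rewrite tyE; case: (spec y).
- rewrite (cnt 0%N); first exact: rat_nirr2.
  by move=> y; rewrite tyE; case: (spec y).
- by rewrite (cnt 1%N) ?card_quad1 // => y; rewrite tyE; case: (spec y).
Qed.

Lemma countL t : #|[pred x : Lform k | Lform_type x == t]|%:R = (apoly typeL t).[Q].
Proof.
pose f (x : k + k * k) := Lform_type (0, x).
rewrite (_ : #|_| = #|[pred x : k * (k + k * k) | (f x.2 == t)]|); last first.
  by apply: eq_card => -[e [a|y]].
rewrite (card_prod_pred2 k (fun x => f x == t)) (@card_sum_pred _ _ (fun x => f x == t)) /f /=.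
rewrite (card_predT k (typeL == t)) natrM natrD natrM.
rewrite (quad_countE t : #|[pred y | Lform_type (0, inr y) == t]|%:R = _).
by rewrite horner_apoly; case: t => /=; field.
Qed.

Lemma countJ t : #|[pred x : Jform k | Jform_type x == t]|%:R = (apoly typeJ t).[Q].
Proof.
pose P := fun x : Jform k => Jform_type x == t.
rewrite (@card_sum_pred _ _ P) (@card_sum_pred _ _ (fun x => P (inl x))).
rewrite (@card_sum_pred _ _ (fun x => P (inr x))) (@card_sum_pred _ _ (fun x => P (inr (inr x)))).
have card_const (A : finType) (f : pred A) b : (forall x, f x = b) -> #|[pred x | f x]| = (b * #|A|)%N.
  by move=> fb; rewrite -card_predT; apply: eq_card => x; rewrite !inE fb.
rewrite (@card_const _ _ (typeJ == t)); last by case.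
rewrite (@card_const _ _ (typeM == t)); last by case=> -[].
rewrite (@card_const _ _ (typeN == t)); last by case.
rewrite (@card_const _ _ (typeK0 == t)) // (@card_const _ _ (typeKinf == t)) //.
rewrite !card_prod !natrD !natrM rat_nz horner_apoly.
by case: t {P} => /=; field.
Qed.

Lemma count_comm s t : is_comm3 s -> #|[pred x : k * k * k | s == t]|%:R = (apoly s t).[Q].
Proof.
move=> cs; rewrite card_predT !card_prod !natrM horner_apoly.
by case: s cs => // _; case: t => /=; field.
Qed.

Lemma class_transversal s h : @lie_class k s h ->
  exists (T : finType) (nf : T -> 'M[k]_3) (ty : T -> stype),
    orb_transversal h nf ty /\
    forall t, #|[pred x | ty x == t]|%:R = (apoly s t).[Q].
Proof.
move=> hs; have [cs|ncs] := boolP (is_comm3 s).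
  have [b [c bc]] := lie_class_span3 cs hs.
  have [nf nfT] := transversal_comm bc (lie_class_subalg hs) hs.
  by exists (k * k * k)%type, nf, (fun=> s); split=> // t; apply: count_comm.
have st : is_std s by case: s ncs {hs}.
have /(lie_class_std _ st)[g ug ->] := hs.
case: s ncs {hs st} => //= _.
- by do 3!eexists; split; [exact: transversal_conjs ug (transversalG k)|exact: countG].
- by do 3!eexists; split; [exact: transversal_conjs ug (transversalL k)|exact: countL].
- by do 3!eexists; split; [exact: transversal_conjs ug (transversalJ k)|exact: countJ].
Qed.

End Counts.

(** * Shadows *)

Section ShadowClasses.
Variables (o : idomainType) (k : finFieldType) (res : {rmorphism o -> k}).
Variable p : o.
Hypothesis p0 : p != 0.
Hypothesis pE : forall x, nonunits x <-> exists y, x = y * p.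
Hypothesis res_surj : forall y, exists x, res x = y.
Hypothesis res_ker : forall x, res x = 0 <-> nonunits x.
Implicit Types A B : 'M[o]_3.
Local Notation csh := (csh res p).
Local Notation good := (good res p).
Local Notation dvm := (dvm p).

Lemma lie_classT s : @lie_class k s setT -> s = typeG.
Proof.
move=> hs; apply: (lie_class_inj hs); apply/lie_class_std => //.
by exists 1%:M; rewrite ?unitmx1 // conjs1.
Qed.

Lemma map_res_inv (g : 'M[o]_3) : g \in unitmx ->
  map_mx res (invmx g) = invmx (map_mx res g).
Proof.
move=> ug; have [|_ ->] // := @unitmx_of_mulmx _ _ (map_mx res g) (map_mx res (invmx g)).
by rewrite -map_mxM mulmxV // map_mx1.
Qed.

Lemma csh_conj l A B (g : 'M[o]_3) : g \in unitmx -> dvm l (g *m A - B *m g) ->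
  csh l B = conjs (map_mx res g) (csh l A).
Proof.
move=> ug [W E]; have urg : map_mx res g \in unitmx by rewrite -(unitmx_res res_ker).
have key h A' B' W' : h \in unitmx -> h *m A' - B' *m h = p ^+ l *: W' ->
    forall X, csh l A' X -> csh l B' (map_mx res h *m X *m invmx (map_mx res h)).
  move=> uh E' _ [X [Y [XE <-]]].
  exists (h *m X *m invmx h), ((h *m Y - h *m X *m invmx h *m W' + W' *m X) *m invmx h); split; last first.
    by rewrite !map_mxM map_res_inv.
  apply: (can_inj (mulmxK uh)); rewrite scalemxAl mulmxKV //.
  rewrite scalerDr scalerBr (scalemxAr _ h Y) (scalemxAr _ (h *m X *m invmx h) W') (scalemxAl _ W' X).
  rewrite -XE -E' comm3.unlock !(mulmxBl, mulmxBr) !mulmxA !(mulmxKV uh).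
  by rewrite opprB [X in _ = X + _]addrC [X in _ = X + _]addrA subrK addrA subrK.
apply/seteqP; split=> X.
  move=> hX; apply/conjsP => //.
  have /key -/(_ _ X hX) : invmx g *m B - A *m invmx g = p ^+ l *: (- (invmx g *m W *m invmx g)).
    rewrite scalerN scalemxAl scalemxAr -E mulmxBr mulmxBl !mulmxA mulVmx // mul1mx.
    by rewrite mulmxK // opprB.
  by rewrite unitmx_inv map_res_inv // invmxK; apply.
by move=> [Y hY <-]; apply: key ug E _ hY.
Qed.

Lemma class_good l A s : lie_class s (csh l.+1 A) ->
  exists Z, good l.+1 (A + p ^+ l.+1 *: Z).
Proof.
move=> hs; have [cs|ncs] := boolP (is_comm3 s).
  have [b [c [hE _ _]]] := lie_class_span3 cs hs.
  apply: (@good_span3 _ _ _ _ p0 pE res_surj res_ker l A b c).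
  - by move=> hT; move: hs cs; rewrite hT => /lie_classT ->.
  - by apply/hE; exists 0, 1, 0; rewrite raddf0 scale1r scale0r add0r addr0.
  - by apply/hE; exists 0, 0, 1; rewrite raddf0 scale1r scale0r !add0r.
  - by move=> X /hE.
have [sG|sG] := eqVneq s typeG.
  have := hs; rewrite sG => /(@lie_class_std _ typeG _ isT)[g ug E].
  apply: (good_setT p0 pE res_surj res_ker); rewrite E.
  by apply/seteqP; split=> // X _; apply/conjsP.
apply: (good_inner p0 pE res_surj res_ker); apply: lie_class_inner hs.
by case: s ncs sG => //; [left|right].
Qed.

Lemma csh1_class A : exists s, lie_class s (csh 1 A).
Proof.
rewrite (csh1 pE res_surj res_ker).
have [x /simil_sym/simil_centraliser[g ug ->]] := cformP (map_mx res A).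
by exists (cform_type x); apply: lie_class_conjs => //; apply: lie_class_cform.
Qed.

Lemma csh_good_conj l A Z W g : good l.+1 A -> g \in unitmx ->
  dvm l.+2 (g *m (A + p ^+ l.+1 *: Z) - (A + p ^+ l.+1 *: W) *m g) ->
  radf (csh l.+1 A) (map_mx res W) =
  conjs (map_mx res g) (radf (csh l.+1 A) (map_mx res Z)).
Proof.
move=> gA ug d; rewrite -!(csh_good p0 pE res_surj res_ker _ gA).
exact: csh_conj d.
Qed.

(** Around a good [A0] the matrix [A] is a functional, which the units of the shadow move to a
    representative of known type; conjugating back preserves the type. *)
Lemma cshS_class l A s : lie_class s (csh l.+1 A) -> exists t, lie_class t (csh l.+2 A).
Proof.
move=> hs; have [Z gZ] := class_good hs; set A0 := A + _ in gZ.
have hE : csh l.+1 A0 = csh l.+1 A by apply: csh_cong.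
have AE : A = A0 + p ^+ l.+1 *: (- Z) by rewrite scalerN addrK.
rewrite AE (csh_good p0 pE res_surj res_ker _ gZ) hE.
have [T [nf [ty [[ex _ typ] _]]]] := class_transversal hs.
have [x] := ex (map_mx res (- Z)); have [W WE] := map_res_surj res_surj (nf x).
rewrite -WE -hE => /(conj_good p0 pE res_surj res_ker _ _ gZ)[g ug d].
exists (ty x); have := typ x; rewrite -WE -hE (csh_good_conj gZ ug d).
have urg : map_mx res g \in unitmx by rewrite -(unitmx_res res_ker).
move=> /(lie_class_conjs (g := invmx (map_mx res g))); rewrite unitmx_inv conjsK //.
exact.
Qed.

Lemma all_class l A : exists s, lie_class s (csh l A).
Proof.
case: l => [|l]; last by elim: l => [|l [s /cshS_class]]; first exact: csh1_class.
by exists typeG; apply/lie_class_std => //; exists 1%:M; rewrite ?unitmx1 // conjs1 (csh0 p res_surj).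
Qed.

Lemma cform_exists t : (0 < #|[pred x : cform k | cform_type x == t]|)%N ->
  exists A, lie_class t (csh 1 A).
Proof.
move=> /card_gt0P[x]; rewrite inE => /eqP <-.
have [A AE] := map_res_surj res_surj (cform_mx x).
by exists A; rewrite (csh1 pE res_surj res_ker) AE; apply: lie_class_cform.
Qed.

Lemma class_above l A s (T : finType) (nf : T -> 'M[k]_3) ty x :
  orb_transversal (csh l.+1 A) nf ty -> lie_class s (csh l.+1 A) ->
  exists B, lie_class (ty x) (csh l.+2 B).
Proof.
move=> [_ _ typ] hs; have [Z gZ] := class_good hs; set A0 := A + _ in gZ.
have hE : csh l.+1 A0 = csh l.+1 A by apply: csh_cong.
have [W WE] := map_res_surj res_surj (nf x).
exists (A0 + p ^+ l.+1 *: W); rewrite (csh_good p0 pE res_surj res_ker _ gZ) hE WE.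
exact: typ.
Qed.

(** Most types already occur over the residue field: T2 and T3 because their counts are positive, M
    and N through explicit cubics. T1 is taken from above L, because [k] may lack three distinct
    elements, and K0 and Kinf are found above J. *)
Lemma exists_class s : exists l A, lie_class s (csh l A).
Proof.
have one (x : cform k) : exists l A, lie_class (cform_type x) (csh l A).
  have [|A hA] := @cform_exists (cform_type x); last by exists 1%N, A.
  by apply/card_gt0P; exists x; rewrite inE.
have cub (y : k * k * k) : exists l A, lie_class (cub_type (pc y)) (csh l A) by exact: (one (inr (inr y))).
have n01 : (0 : k) != 1 by rewrite eq_sym oner_eq0.
have gt0 t : (0 < #|[pred y : k * k * k | cub_type (pc y) == t]|)%N ->
    exists l A, lie_class t (csh l A).
  by move=> /card_gt0P[y]; rewrite inE => /eqP <-.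
have [n qE] := q_gt1 k.
have cnt t : cub_count k t != 0 -> exists l A, lie_class t (csh l A).
  rewrite -cub_countE => nz0; apply: gt0; rewrite lt0n.
  by apply: contra nz0 => /eqP ->.
have lift t (T : finType) (nf : T -> 'M[k]_3) ty x : orb_transversal (@std_alg k t) nf ty ->
    (exists A, csh 1 A = @std_alg k t) -> is_std t -> exists l A, lie_class (ty x) (csh l A).
  move=> tr [A AE] st.
  have [||B hB] := @class_above 0 A t T nf ty x; rewrite ?AE //; last by exists 2, B.
  by apply/lie_class_std => //; exists 1%:M; rewrite ?unitmx1 // conjs1.
have exL : exists A, csh 1 A = @std_alg k typeL.
  have [A AE] := map_res_surj res_surj (mx3 0 0 0 0 0 0 0 0 1 : 'M[k]_3).
  by exists A; rewrite (csh1 pE res_surj res_ker) AE; apply: centraliser_L.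
have exJ : exists A, csh 1 A = @std_alg k typeJ.
  have [A AE] := map_res_surj res_surj (mx3 0 0 1 0 0 0 0 0 0 : 'M[k]_3).
  by exists A; rewrite (csh1 pE res_surj res_ker) AE; apply: centraliser_J.
have Qn : (#|k|%:R : rat) = n%:R + 2%:R by rewrite qE -addn2 natrD.
have n0 : (0 : rat) <= n%:R by rewrite ler0n.
case: s.
- exact: (one (inl (inl 0))).
- exact: (one (inl (inr (exist _ (0, 1) n01)))).
- exact: (one (inr (inl 0))).
(* The block with eigenvalues 0 and 1, which exist and differ in every field. *)
- have := lift typeL _ _ _ (0, inr (- (0 * 1), 0 + 1)) (transversalL k) exL isT.
  rewrite /Lform_type (_ : pq _ = ('X - 0%:P) * ('X - 1%:P)) ?mulXX // -mulXX.
  by rewrite rts_quad2 cards2 n01.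
- by apply: cnt; rewrite /= !mulf_neq0 ?invr_eq0 // Qn; apply/eqP; lra.
- by apply: cnt; rewrite /= !mulf_neq0 ?invr_eq0 // Qn; apply/eqP; nra.
- have [||y yE] := @pc_surj k (('X - 0%:P) * ('X - 1%:P) ^+ 2).
  + by rewrite XsubC12 mulXquad cub_monic.
  + by rewrite XsubC12 mulXquad size_cub.
  by have := cub y; rewrite -yE cub_typeM.
- have [||y yE] := @pc_surj k (('X - 0%:P) ^+ 3).
  + by rewrite XsubC3 mulXquad cub_monic.
  + by rewrite XsubC3 mulXquad size_cub.
  by have := cub y; rewrite -yE cub_typeN.
- exact: (lift typeJ _ _ _ (inr (inr (inl 0))) (transversalJ k) exJ isT).
- exact: (lift typeJ _ _ _ (inr (inr (inr 0))) (transversalJ k) exJ isT).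
Qed.

End ShadowClasses.

Local Open Scope card_scope.

Lemma card_eq_fin (U : Type) (T : finType) (P : pred T) (f : T -> U) :
  (forall x y, P x -> P y -> f x = f y -> x = y) ->
  f @` [set x | P x] #= `I_(#|[pred x | P x]|).
Proof.
move=> inj; pose g (i : 'I_(#|[pred x | P x]|)) := f (enum_val i).
have Pe (i : 'I_(#|[pred x | P x]|)) : P (enum_val i) by have := enum_valP i; rewrite inE.
have -> : f @` [set x | P x] = g @` setT.
  apply/seteqP; split=> [_ [x Px <-]|_ [i _ <-]]; last first.
    by exists (enum_val i) => //; apply: Pe.
  have xP : x \in [pred x | P x] by rewrite inE.
  by exists (enum_rank_in xP x) => //; rewrite /g enum_rankK_in.
apply: card_eq_trans (card_esym card_II).
apply: inj_card_eq => i j _ _ E.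
by apply: enum_val_inj; apply: inj => //; apply: Pe.
Qed.

(** * Shadows of similarity classes and the classes above them *)

Section Shadows.
Variables (o : idomainType) (k : finFieldType) (res : {rmorphism o -> k}).
Variable p : o.
Hypothesis p0 : p != 0.
Hypothesis pE : forall x, nonunits x <-> exists y, x = y * p.
Hypothesis res_surj : forall y, exists x, res x = y.
Hypothesis res_ker : forall x, res x = 0 <-> nonunits x.
Implicit Types A B : 'M[o]_3.
Local Notation csh := (csh res p).
Local Notation good := (good res p).
Local Notation dvm := (dvm p).
Local Notation tr l := (map_mx (@to_trunc o l)).

Lemma trunc_lift l (A : 'M[trunc o l]_3) : exists B, A = tr l B.
Proof.
exists (map_mx (fun x => generic_quotient.repr x : o) A); apply/matrixP => i j; rewrite !mxE.
by rewrite /to_trunc generic_quotient.reprK.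
Qed.

Lemma tr_eq l A B : tr l A = tr l B <-> dvm l (A - B).
Proof. exact: map_to_truncE. Qed.

(** Classes are named by lifts to [o], so that conjugacy and shadows become divisibility statements
    there. *)
Definition cls l A : set 'M[trunc o l]_3 :=
  [set B | exists2 g : 'M[o]_3, g \in unitmx & B = tr l (g *m A *m invmx g)].

Arguments cls : clear implicits.

Lemma similarity_classE l (C : set 'M[trunc o l]_3) :
  similarity_class C <-> exists A, C = cls l A.
Proof.
have E A g : tr l (g *m A *m invmx g) = tr l g *m tr l A *m tr l (invmx g).
  by rewrite !map_mxM.
split=> [[A' ->]|[A ->]].
  have [A ->] := trunc_lift A'; exists A.
  by apply/seteqP; split=> B [g ug ->]; exists g.
by exists (tr l A); apply/seteqP; split=> B [g ug ->]; exists g.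
Qed.

Lemma dvm_mul l A B C : dvm l A -> dvm l (B *m A *m C).
Proof. by move=> [W ->]; exists (B *m W *m C); rewrite -scalemxAr -scalemxAl. Qed.

Lemma dvmN l A : dvm l A -> dvm l (- A).
Proof. by move=> [W ->]; exists (- W); rewrite scalerN. Qed.

Lemma dvm_conj l (g : 'M[o]_3) A B : g \in unitmx ->
  dvm l (g *m A *m invmx g - B) <-> dvm l (g *m A - B *m g).
Proof.
move=> ug; split=> d.
  rewrite -[g *m A](mulmxKV ug) -mulmxBl -[_ *m g]mul1mx mulmxA.
  by rewrite mul1mx -[X in X *m g]mul1mx; apply: dvm_mul.
rewrite -[B](mulmxK ug) -mulmxBl -[X in X *m invmx g]mul1mx.
exact: dvm_mul.
Qed.

Lemma cls_eq l A B : cls l A = cls l B <->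
  exists2 g, g \in unitmx & dvm l (g *m A - B *m g).
Proof.
split=> [E|[g ug /dvm_conj -/(_ ug) /tr_eq E]].
  have : cls l A (tr l B).
    by rewrite E; exists 1%:M; rewrite ?unitmx1 // invmx1 mul1mx mulmx1.
  move=> [g ug /esym/tr_eq/dvm_conj -/(_ ug) d].
  by exists g.
have gg : tr l A = tr l (invmx g *m B *m g).
  by rewrite !map_mxM -E !map_mxM -!mulmxA -!map_mxM !mulmxA mulVmx // mulmxKV // mul1mx.
apply/seteqP; split=> _ [h uh ->].
  exists (h *m invmx g); first by rewrite unitmx_mul uh unitmx_inv.
  rewrite invmx_mulmx ?unitmx_inv // invmxK 2!map_mxM gg -!map_mxM.
  by rewrite !mulmxA.
exists (h *m g); first by rewrite unitmx_mul uh.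
rewrite invmx_mulmx // 2!map_mxM -E -!map_mxM.
by rewrite !mulmxA.
Qed.

Definition sig (s : stype) : shadow_type k :=
  [set P : set {'GL_3[k]} * set 'M[k]_3 | lie_class s P.2 /\ P.1 = [set u : {'GL_3[k]} | P.2 (GLval u)]].

Lemma shadow_glE l A : shadow_gl res (tr l A) = csh l A.
Proof.
apply/seteqP; split=> Z [X].
  by rewrite /= -!map_mxM => /tr_eq[Y E] <-; exists X, Y; rewrite comm3.unlock.
move=> [Y [E <-]]; exists X => //; rewrite /= -!map_mxM; apply/tr_eq; exists Y.
by rewrite -E comm3.unlock.
Qed.

(** A matrix over the local ring [o] is invertible as soon as its residue is, so the group shadow
    consists of the units of the Lie shadow. *)
Lemma shadow_GLE l A : shadow_GL res (tr l A) = [set u : {'GL_3[k]} | csh l A (GLval u)].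
Proof.
apply/seteqP; split=> u.
  move=> [g [ug gA gu]]; rewrite /= -gu -shadow_glE; exists g => //.
move=> /= ; rewrite -shadow_glE => -[X XA Xu]; exists X; split=> //.
by rewrite (unitmx_res res_ker) Xu; exact: (valP u).
Qed.

(** Conjugating matrices over [k] lift to [o], and the algebras of type [s] form one orbit; so all
    of them occur as shadows of members of the class. *)
Lemma shadow_cls l A s : lie_class s (csh l A) -> shadow res (cls l A) = sig s.
Proof.
move=> hs; apply/seteqP; split=> P.
  move=> [_ [g ug ->] <-]; split=> /=; last by rewrite shadow_GLE shadow_glE.
  rewrite shadow_glE (csh_conj res_ker (g := g) (A := A)) //.
    by apply: lie_class_conjs => //; rewrite -(unitmx_res res_ker).
  by apply/dvm_conj => //; rewrite subrr; exists 0; rewrite scaler0.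
move=> [hP P1]; have [g ug gE] := lie_class_orbit hs hP.
have [g' g'E] := map_res_surj res_surj g.
have ug' : g' \in unitmx by rewrite (unitmx_res res_ker) g'E.
have cE : csh l (g' *m A *m invmx g') = P.2.
  rewrite (csh_conj res_ker (g := g') (A := A)) //; first by rewrite g'E -gE.
  by apply/dvm_conj => //; rewrite subrr; exists 0; rewrite scaler0.
exists (tr l (g' *m A *m invmx g')); first by exists g'.
by rewrite shadow_GLE shadow_glE cE -P1; case: P {hP P1 gE cE}.
Qed.

Lemma has_type_sig s t : has_type (sig s) t <-> s = t.
Proof.
have E u : [set P.2 | P in sig u] = [set h | lie_class u h].
  apply/seteqP; split=> h; first by move=> [P [hP _] <-].
  by move=> hu; exists ([set v : {'GL_3[k]} | h (GLval v)], h).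
rewrite /has_type E; split=> [st|-> //].
have [l [A hA]] := exists_class p0 pE res_surj res_ker s.
have : [set h | lie_class s h] (csh l A) by [].
by rewrite st => /(lie_class_inj hA).
Qed.

Lemma sig_inj s t : sig s = sig t -> s = t.
Proof. by move=> E; apply/has_type_sig; rewrite E; apply/has_type_sig. Qed.

Lemma ShE sigma : Sh res sigma <-> exists s, sigma = sig s.
Proof.
split=> [[l [C [/similarity_classE[A ->] ->]]]|[s ->]].
  have [s hs] := all_class p0 pE res_surj res_ker l A.
  by exists s; apply: shadow_cls.
have [l [A hA]] := exists_class p0 pE res_surj res_ker s.
exists l, (cls l A); split; first by apply/similarity_classE; exists A.
by rewrite (shadow_cls hA).
Qed.

Lemma card_Sh : Sh res #= `I_10.
Proof.
have -> : Sh res = (sig \o stype_of_num) @` `I_10.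
  apply/seteqP; split=> sigma.
    move=> /ShE[s ->]; exists (stype_num s); first exact: stype_num_lt.
    by rewrite /= stype_numK.
  by move=> [i _ <-]; apply/ShE; exists (stype_of_num i).
apply: inj_card_eq => i j; rewrite !inE /= => i10 j10 /sig_inj E.
by rewrite -(stype_of_numK i10) E stype_of_numK.
Qed.

Lemma lies_above_cls l A B : lies_above (cls l.+1 B) (cls l A) <-> cls l B = cls l A.
Proof.
rewrite /lies_above; suff -> : [set map_mx (@trunc_red o l) X | X in cls l.+1 B] = cls l B by [].
have E X : map_mx (@trunc_red o l) (tr l.+1 X) = tr l X.
  by apply/matrixP => i j; rewrite !mxE trunc_redE.
apply/seteqP; split=> Z.
  by move=> [_ [g ug ->] <-]; exists g; rewrite ?E.
by move=> [g ug ->]; exists (tr l.+1 (g *m B *m invmx g)); [exists g|rewrite E].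
Qed.

(** The class is given a good member-lift [A0]. Then [F] sends orbit representatives to classes
    above it; [conj_good] makes [F] injective, and the type of the stabiliser is the type of the
    shadow. *)
Lemma count_above l A s t : lie_class s (csh l.+1 A) -> exists2 N : nat,
  [set D : set 'M[trunc o l.+2]_3 |
    [/\ similarity_class D, shadow res D = sig t & lies_above D (cls l.+1 A)]] #= `I_N
  & N%:R = (apoly s t).[#|k|%:R].
Proof.
move=> hs0; have [Z gZ] := class_good p0 pE res_surj res_ker hs0.
have clsA W : cls l.+1 A = cls l.+1 (A + p ^+ l.+1 *: W).
  apply/cls_eq; exists 1%:M; rewrite ?unitmx1 // mul1mx mulmx1 opprD addrA subrr add0r.
  by exists (- W); rewrite scalerN.
move: gZ; rewrite (clsA Z); have hE : csh l.+1 (A + p ^+ l.+1 *: Z) = csh l.+1 A by apply: csh_cong.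
move: hs0 clsA hE; set A0 := A + _ => hs0 _ hE gA.
have hs : lie_class s (csh l.+1 A0) by rewrite hE.
have [T [nf [ty [[ex inj typ] cnt]]]] := class_transversal hs.
have /choice[lf lfE] := map_res_surj res_surj (n := 3) (m := 3) (k := k).
pose F x := cls l.+2 (A0 + p ^+ l.+1 *: lf (nf x)).
have Fcls x : lie_class (ty x) (csh l.+2 (A0 + p ^+ l.+1 *: lf (nf x))).
  by rewrite (csh_good p0 pE res_surj res_ker _ gA) lfE.
exists #|[pred x | ty x == t]|; last exact: cnt.
rewrite (_ : [set D | _] = F @` [set x | ty x == t]).
  apply: card_eq_fin => x y _ _ /cls_eq/(conj_good p0 pE res_surj res_ker _ _ gA).
  by rewrite !lfE; apply: inj.
apply/seteqP; split=> D; last first.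
  move=> [x /eqP tx <-]; split.
  - by apply/similarity_classE; eexists.
  - by rewrite (shadow_cls (Fcls x)) tx.
  - apply/lies_above_cls/cls_eq; exists 1%:M; rewrite ?unitmx1 // mul1mx mulmx1 addrAC subrr add0r.
    by exists (lf (nf x)).
move=> [/similarity_classE[B ->] shB /lies_above_cls/esym/cls_eq[g ug d]].
(* A class above that of [A0] contains a matrix congruent to [A0] modulo $p^{l+1}$, hence of the
   form $A_0 + p^{l+1} W$. *)
have [W WE] : dvm l.+1 (invmx g *m B *m g - A0).
  have := dvmN d; rewrite opprB => /(dvm_mul (invmx g) 1%:M); rewrite mulmx1 mulmxBr.
  by rewrite !mulmxA mulVmx // mul1mx.
have BE : cls l.+2 B = cls l.+2 (A0 + p ^+ l.+1 *: W).
  apply/cls_eq; exists (invmx g); first by rewrite unitmx_inv.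
  rewrite -WE [A0 + _]addrC subrK -!mulmxA mulmxV // mulmx1 subrr.
  by exists 0; rewrite scaler0.
have [x xW] := ex (map_mx res W); rewrite -(lfE (nf x)) in xW.
have FE : cls l.+2 B = F x.
  by rewrite BE; apply/cls_eq/(conj_good p0 pE res_surj res_ker _ _ gA).
exists x => //; apply/eqP/sig_inj.
by rewrite -(shadow_cls (Fcls x)) -/(F x) -FE.
Qed.

End Shadows.

Theorem theorem2p8 :
  exists a : stype -> stype -> {poly rat},
    (forall s t, over_Zinv6 (a s t)) /\
    forall (o : idomainType) (k : finFieldType) (res : {rmorphism o -> k}),
      is_dvr o -> compact [set: adic o] -> is_residue_map res ->
      [/\ Sh res #= `I_10,
          (forall sigma, Sh res sigma -> exists! s, has_type sigma s)
        & (forall s, exists! sigma, Sh res sigma /\ has_type sigma s)] /\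
      (forall (sigma tau : shadow_type k) (s t : stype),
         Sh res sigma -> has_type sigma s ->
         Sh res tau -> has_type tau t ->
         forall (l : nat) (C : set 'M[trunc o l]_3),
           (0 < l)%N -> similarity_class C -> shadow res C = sigma ->
           exists2 N : nat,
             [set D : set 'M[trunc o l.+1]_3 |
                [/\ similarity_class D, shadow res D = tau
                  & lies_above D C]] #= `I_N
             & N%:R = (a s t).[#|k|%:R]).
Proof.
exists apoly; split; first exact: over_Zinv6_apoly.
move=> o k res /dvr_uniformiser[p p0 pE] _ [surj ker].
have shE := ShE p0 pE surj ker; have tyE := has_type_sig p0 pE surj ker.
split; first split.
- exact: card_Sh p0 pE surj ker.
- move=> _ /shE[s ->]; exists s; split; first exact/tyE.
  by move=> t /tyE.
- move=> s; exists (sig s); split; first by split; [apply/shE; exists s|apply/tyE].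
  by move=> _ [/shE[t ->] /tyE ->].
move=> _ _ s t /shE[s' ->] /tyE -> /shE[t' ->] /tyE -> l C + /similarity_classE[A ->] shC.
case: l C A shC => // l _ A shC _.
have [u hu] := all_class p0 pE surj ker l.+1 A.
have us : u = s.
  by apply: (sig_inj p0 pE surj ker); rewrite -shC (shadow_cls pE surj ker hu).
rewrite us in hu.
exact: (count_above p0 pE surj ker).
Qed.
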